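(* Let $(M,\mathcal{T},\Phi)$ be a weighted triangulated surface and $\alpha\in\mathbb{R}$ with $\alpha\chi(M)\le 0$. Then the constant $\alpha$-curvature circle packing metric is unique (if it exists) up to scaling. Moreover, for any initial circle packing metric $r(0)\in\mathbb{R}^N_{>0}$, the following statements are mutually equivalent: (1) There exists a constant $\alpha$-curvature circle packing metric. (2) The solution to the $\alpha$-Ricci flow $\frac{dr_i}{dt}=(R_{\alpha,av}-R_{\alpha,i})r_i$ ($i\in V$) with initial metric $r(0)$ converges. (3) The solution to the $\alpha$-Calabi flow $\frac{dr_i}{dt}=(\Delta_\alpha R_\alpha)_i\,r_i$ ($i\in V$) with initial metric $r(0)$ converges. (4) The solution to the modified $\alpha$-Calabi flow $\dot u=-\frac12\nabla_u\widetilde C_\alpha$ with initial metric $r(0)$ converges. (5) There exists a circle packing metric $r^*$ such that, for every nonempty proper subset $I$ of $V$, $$2\pi\chi(M)\frac{\sum_{i\in I}(r_i^{*})^{\alpha}}{\|r^*\|_\alpha^\alpha}>-\sum_{(e,v)\in Lk(I)}(\pi-\Phi(e))+2\pi\chi(F_I).$$ (6) The following holds: (i) if $\alpha>0$ and $\chi(M)<0$, then $\mathscr{Y}\cap\mathbb{R}^N_{<0}\neq\emptyset$; (ii) if $\alpha<0$ and $\chi(M)>0$, then $\mathscr{Y}\cap\mathbb{R}^N_{>0}\ne\emptyset$; (iii) if $\alpha\chi(M)=0$, then $\frac{2\pi\chi(M)}{|V|}(1,\dots,1)^T\in\mathscr{Y}$.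
   Context: $M$ is a closed connected surface with a triangulation $\mathcal{T}=\{V,E,F\}$ (vertices, edges, faces), $V=\{1,\dots,N\}$, and $\Phi:E\to[0,\pi/2]$ is a weight function; the triple $(M,\mathcal{T},\Phi)$ is called a weighted triangulated surface. $\chi$ denotes Euler characteristic. Write $i\sim j$ if $\{ij\}\in E$. A circle packing metric is a map $r:V\to(0,+\infty)$, i.e. $r\in\mathbb{R}^N_{>0}$. It determines edge lengths $l_{ij}=\sqrt{r_i^2+r_j^2+2r_ir_j\cos\Phi_{ij}}$; for each face $\{ijk\}$ the lengths satisfy the triangle inequalities, so the face is realized as a Euclidean triangle, and $\theta_i^{jk}$ denotes its inner angle at $i$. The classical discrete Gauss curvature is $K_i=2\pi-\sum_{\{ijk\}\in F}\theta_i^{jk}$ (sum over all faces containing $i$). The $\alpha$-curvature is $R_{\alpha,i}=K_i/r_i^\alpha$; $r$ is a constant $\alpha$-curvature metric if $R_{\alpha,i}$ is the same for all $i\in V$. Put $\|r\|_\alpha^\alpha=\sum_{i=1}^N r_i^\alpha$ (equal to $N$ when $\alpha=0$), $R_{\alpha,av}=2\pi\chi(M)/\|r\|_\alpha^\alpha$, and $u_i=\ln r_i$. The $\alpha$-Laplacian acts on $f:V\to\mathbb{R}$ by $(\Delta_\alpha f)_i=\frac{1}{r_i^\alpha}\sum_{j\sim i}\left(-\frac{\partial K_i}{\partial u_j}\right)(f_j-f_i)$. Put $\varphi_{\alpha,i}=K_i-R_{\alpha,av}r_i^\alpha$ and $\widetilde C_\alpha=\sum_{i=1}^N\varphi_{\alpha,i}^2$,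 regarded as a function of $u=(u_1,\dots,u_N)$. A solution of a flow ''converges'' if it exists for all $t\in[0,+\infty)$ and $r(t)$ tends to a point of $\mathbb{R}^N_{>0}$ as $t\to+\infty$. For a nonempty proper subset $I\subset V$, $F_I$ is the subcomplex of $\mathcal{T}$ consisting of all cells whose vertices are all in $I$, and $Lk(I)$ is the set of pairs $(e,v)$ of an edge $e$ and a vertex $v$ such that the end points of $e$ are not in $I$, $v\in I$, and $e$ and $v$ form a triangle of $\mathcal{T}$. Finally $\mathscr{Y}$ is the set of all $x\in\mathbb{R}^N$ with $\sum_{i=1}^N x_i=2\pi\chi(M)$ and $\sum_{i\in I}x_i>-\sum_{(e,v)\in Lk(I)}(\pi-\Phi(e))+2\pi\chi(F_I)$ for every nonempty proper subset $I\subset V$. *)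

(* Defs.v *)
From HB Require Import structures.
From mathcomp Require Import all_boot all_order all_algebra.
From mathcomp Require Import all_classical all_reals all_analysis.

Set Implicit Arguments.
Unset Strict Implicit.
Unset Printing Implicit Defensive.

Import Order.TTheory GRing.Theory Num.Theory.
Import numFieldNormedType.Exports.

Local Open Scope classical_set_scope.
Local Open Scope ring_scope.

(* A triangulation of a closed connected surface is given combinatorially, as a
   connected finite simplicial complex of dimension 2 in which the link of
   every vertex is a simple closed cycle [c].  The vertex set is all of 'I_N;
   [set i; j] (resp. [set i; j; k]) has fewer than 2 (resp. 3) elements when
   indices coincide, and then it is neither an edge nor a face. *)
Record triangulated_surface (N : nat) := TriangulatedSurface {
  edges : {set {set 'I_N}};
  faces : {set {set 'I_N}};
  vertices_gt0 : (0 < N)%N;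
  card_edge : forall e, e \in edges -> #|e| = 2;
  card_face : forall f, f \in faces -> #|f| = 3;
  face_edges : forall e f : {set 'I_N},
    f \in faces -> e \subset f -> #|e| = 2 -> e \in edges;
  vertex_link : forall i : 'I_N, exists c : seq 'I_N,
    [/\ (2 < size c)%N, uniq c,
        forall j, ([set i; j]%SET \in edges) = (j \in c) &
        forall j k, ([set i; j; k]%SET \in faces) =
          [&& j \in c, k \in c & (k == next c j) || (j == next c k)]];
  surface_connected : forall i j : 'I_N,
    connect (fun a b => [set a; b]%SET \in edges) i j
}.

Section Combinatorics.
Variables (N : nat) (T : triangulated_surface N).
Implicit Type I : {set 'I_N}.

Definition adjacent (i j : 'I_N) : bool := [set i; j]%SET \in edges T.

Definition euler_char : int :=
  N%:Z - #|edges T|%:Z + #|faces T|%:Z.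

(* Euler characteristic of the full subcomplex F_I *)
Definition euler_char_sub I : int :=
  #|I|%:Z - #|[set e in edges T | e \subset I]%SET|%:Z
          + #|[set f in faces T | f \subset I]%SET|%:Z.

Definition Lk I : {set {set 'I_N} * 'I_N} :=
  [set p | [&& p.1 \in edges T, [disjoint p.1 & I], p.2 \in I &
            (p.2 |: p.1)%SET \in faces T]]%SET.

End Combinatorics.

Section Geometry.
Variables (R : realType) (N : nat) (T : triangulated_surface N).
Implicit Types (r u x f : 'rV[R]_N) (i j k : 'I_N) (I : {set 'I_N}).

(* A weight is a function on all vertex sets of which only the values on edges
   are ever used. *)
Definition is_weight (Phi : {set 'I_N} -> R) : Prop :=
  forall e, e \in edges T -> 0 <= Phi e <= pi / 2.

Definition circle_packing_metric : set 'rV[R]_N :=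
  [set r | forall i, 0 < r 0 i].

Definition expv u : 'rV[R]_N := map_mx (@expR R) u.
Definition lnv r : 'rV[R]_N := map_mx (@ln R) r.

Definition partial (G : 'rV[R]_N -> R) u j : R := 'D_(delta_mx 0 j) G u.
Definition gradient (G : 'rV[R]_N -> R) u : 'rV[R]_N := \row_j partial G u j.

Variable Phi : {set 'I_N} -> R.

Definition edge_length r i j : R :=
  Num.sqrt (r 0 i ^+ 2 + r 0 j ^+ 2
            + 2 * r 0 i * r 0 j * cos (Phi [set i; j]%SET)).

(* inner angle at i of the Euclidean triangle ijk, by the law of cosines *)
Definition angle r i j k : R :=
  let a := edge_length r j k in
  let b := edge_length r i k in
  let c := edge_length r i j in
  acos ((b ^+ 2 + c ^+ 2 - a ^+ 2) / (2 * b * c)).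

(* Each face {i, j, k} at i is counted once thanks to j < k. *)
Definition curvature r i : R :=
  2 * pi - \sum_(j < N) \sum_(k < N | (j < k)%N
                                      && ([set i; j; k]%SET \in faces T))
             angle r i j k.

Definition curvature_u u i : R := curvature (expv u) i.

Definition total_curvature : R := 2 * pi * (euler_char T)%:~R.

Variable alpha : R.

Definition alpha_norm r : R := \sum_i r 0 i `^ alpha.

Definition alpha_curvature r : 'rV[R]_N :=
  \row_i (curvature r i / r 0 i `^ alpha).

Definition constant_alpha_curvature r : Prop :=
  circle_packing_metric r /\
  exists c : R, forall i, alpha_curvature r 0 i = c.

Definition alpha_curvature_av r : R := total_curvature / alpha_norm r.

Definition alpha_laplacian r f : 'rV[R]_N :=
  \row_i ((r 0 i `^ alpha)^-1 *
          \sum_(j | adjacent T i j)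
             (- partial (curvature_u ^~ i) (lnv r) j) * (f 0 j - f 0 i)).

Definition calabi_energy u : R :=
  \sum_i (curvature_u u i
          - alpha_curvature_av (expv u) * expv u 0 i `^ alpha) ^+ 2.

Definition ricci_field r : 'rV[R]_N :=
  \row_i ((alpha_curvature_av r - alpha_curvature r 0 i) * r 0 i).

Definition calabi_field r : 'rV[R]_N :=
  \row_i (alpha_laplacian r (alpha_curvature r) 0 i * r 0 i).

Definition modified_calabi_field u : 'rV[R]_N :=
  - (2^-1 *: gradient calabi_energy u).

(* x : [0, +oo[ -> D solves x' = X(x), x(0) = x0; the derivative at 0 is the
   one-sided one, and values of x at negative times are irrelevant. *)
Definition flow_solution (D : set 'rV[R]_N) (X : 'rV[R]_N -> 'rV[R]_N)
    (x0 : 'rV[R]_N) (x : R -> 'rV[R]_N) : Prop :=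
  [/\ x 0 = x0,
      forall t, 0 <= t -> D (x t) &
      forall t, 0 <= t ->
        (s - t)^-1 *: (x s - x t) @[s --> within `[0, +oo[ t^'] --> X (x t)].

Definition converges_to_metric (r : R -> 'rV[R]_N) : Prop :=
  exists2 rs, circle_packing_metric rs & r t @[t --> +oo] --> rs.

(* The vector fields are smooth on the space of metrics, so the solution with a
   given initial value is unique: it converges iff some solution does. *)
Definition ricci_flow_converges (r0 : 'rV[R]_N) : Prop :=
  exists2 r : R -> 'rV[R]_N, flow_solution circle_packing_metric ricci_field r0 r
           & converges_to_metric r.

Definition calabi_flow_converges (r0 : 'rV[R]_N) : Prop :=
  exists2 r : R -> 'rV[R]_N, flow_solution circle_packing_metric calabi_field r0 r
           & converges_to_metric r.

Definition modified_calabi_flow_converges (r0 : 'rV[R]_N) : Prop :=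
  exists2 u : R -> 'rV[R]_N, flow_solution setT modified_calabi_field (lnv r0) u
           & converges_to_metric (expv \o u).

(* right-hand side of the inequalities indexed by I *)
Definition link_bound I : R :=
  - (\sum_(p in Lk T I) (pi - Phi p.1))
  + 2 * pi * (euler_char_sub T I)%:~R.

Definition admissible : set 'rV[R]_N :=
  [set x : 'rV[R]_N | \sum_i x 0 i = total_curvature /\
           forall I, I != finset.set0 -> I != [set: 'I_N]%SET ->
             \sum_(i in I) x 0 i > link_bound I].

End Geometry.

(* Main.v *)
Require Import Defs.
From mathcomp Require Import all_boot all_order all_algebra.
From mathcomp Require Import all_classical all_reals all_analysis.
From mathcomp Require Import ring lra.

Set Implicit Arguments.
Unset Strict Implicit.
Unset Printing Implicit Defensive.

Import Order.TTheory GRing.Theory Num.Theory.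
Import numFieldNormedType.Exports.

Local Open Scope classical_set_scope.
Local Open Scope ring_scope.

(** In the coordinates [u = ln r] put [phi_i = K_i - 2 pi chi r_i^alpha / ||r||_alpha^alpha],
    so that constant curvature means [phi = 0].  Since [alpha chi <= 0], the
    Jacobian of [phi] is the Laplacian of a connected weighted graph: edge
    weights coming from the angles plus conductances proportional to
    [- alpha chi r_i^alpha r_j^alpha].  Hence [phi] is the gradient of a potential
    [F] that is convex, strictly so transversally to the direction (1, ..., 1)
    of scalings, and zeros of [phi] are the minima of [F] and unique up to scaling.

    Counting angles face by face writes [sum_(i in I) K_i] as the bound of
    condition (5) plus a positive defect, which tends to 0 when the radii of [I]
    become small relative to the others.  Positivity shows that (5) is
    necessary; smallness of the defect shows that (5) makes [F] coercive modulo
    scalings, so a zero of [phi] exists.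

    In the coordinate [u] each of the three flows decreases [F], is stationary
    only at the zeros of [phi], and conserves [sum_i e^(alpha u_i)] or
    [sum_i u_i].  Coercivity then confines the solution to a compact set, where it
    converges to the only zero of [phi] in its level set.  Conversely the limit of
    a convergent solution is stationary.

    For [alpha <> 0], a point [x] of the polytope with the sign of [chi] yields (5) at
    [r_i = |x_i|^(1/alpha)]; for [alpha chi = 0] the left side of (5) does not depend
    on [r]. *)

(** * Calculus in one variable *)

(** The calculus stays one-dimensional. A gradient is a formula for the derivatives along all lines
    ([has_grad]), and Lipschitz bounds on its components yield quadratic Taylor remainders, hence
    the chain rule along solutions. Global solutions come from truncating the field outside a box:
    the truncated field is bounded and globally Lipschitz, and the a priori bound given by [F] and
    the conserved sum keeps the solution where nothing was truncated. Two obstacles shape convexity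
    and coercivity. An edge with [Phi = 0] can have weight 0, so the connectedness that counts is
    that of the edges of positive weight. And the target curvatures [chi2pi * share] move with u:
    they are exchanged for the fixed ones supplied by condition (5), which changes the radial
    derivative of [F] by an amount bounded below independently of u, because a softmax average lies
    within N of the maximum. *)

Section OneVariable.
Variable R : realType.
Implicit Types (f g : R -> R) (t s a b d e : R).
Local Notation der t f d := (is_derive (t : R) (1 : R) (f : R -> R) (d : R)).

(** The rules are stated on lambda terms: derivatives are assembled as explicit terms and matched
    with the wanted form through [is_derive_eq], often by [ring]. *)
Lemma der_cst t d : der t (fun=> d) 0.
Proof. exact: is_derive_cst. Qed.

Lemma der_id t : der t (fun s => s) 1.
Proof. exact: is_derive_id. Qed.

Lemma derD t f g d e : der t f d -> der t g e -> der t (fun s => f s + g s) (d + e).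
Proof. by move=> df dg; exact: is_deriveD. Qed.

Lemma derN t f d : der t f d -> der t (fun s => - f s) (- d).
Proof. by move=> df; exact: is_deriveN. Qed.

Lemma derB t f g d e : der t f d -> der t g e -> der t (fun s => f s - g s) (d - e).
Proof. by move=> df dg; exact: is_deriveB. Qed.

Lemma derM t f g d e : der t f d -> der t g e ->
  der t (fun s => f s * g s) (d * g t + f t * e).
Proof.
move=> df dg; have := is_deriveM df dg.
rewrite addrC (mulrC d); exact.
Qed.

Lemma derMl t f d e : der t f d -> der t (fun s => e * f s) (e * d).
Proof.
move=> df; apply: is_derive_eq (derM (der_cst t e) df) _.
by rewrite mul0r add0r.
Qed.

Lemma derV t f d : f t != 0 -> der t f d -> der t (fun s => (f s)^-1) (- d / f t ^+ 2).
Proof.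
move=> f0 df; apply: is_derive_eq (is_deriveV f0 df) _.
by rewrite /GRing.scale/= mulrC mulrN mulNr.
Qed.

Lemma der_comp t (h : R -> R) f d e :
  der (f t) h e -> der t f d -> der t (fun s => h (f s)) (e * d).
Proof. by move=> dh df; exact: is_derive1_comp. Qed.

Lemma der_expR t f d : der t f d -> der t (fun s => expR (f s)) (expR (f t) * d).
Proof. by move=> df; exact: der_comp (is_derive_expR _) df. Qed.

Lemma der_sum t (I : Type) (r : seq I) (P : pred I) (F : I -> R -> R) (D : I -> R) :
  (forall i, P i -> der t (F i) (D i)) ->
  der t (fun s => \sum_(i <- r | P i) F i s) (\sum_(i <- r | P i) D i).
Proof.
move=> dF; elim: r => [|i r IH].
  rewrite big_nil (_ : (fun s => _) = (fun=> 0)); first exact: der_cst.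
  by apply/funext => s; rewrite big_nil.
have -> : (fun s => \sum_(j <- i :: r | P j) F j s)
  = (fun s => (if P i then F i s else 0) + \sum_(j <- r | P j) F j s).
  by apply/funext => s; rewrite big_cons; case: ifP; rewrite ?add0r.
rewrite big_cons; case: ifP => Pi; first exact: derD (dF i Pi) IH.
by rewrite -[X in der _ _ X]add0r; exact: derD (der_cst t 0) IH.
Qed.

Lemma der_continuous t f d : der t f d -> {for t, continuous f}.
Proof.
by move=> [df _]; apply: differentiable_continuous; exact/derivable1_diffP.
Qed.

Lemma der_within_continuous f (df : R -> R) a b :
  (forall t, a <= t <= b -> der t f (df t)) -> {within `[a, b], continuous f}.
Proof.
move=> h; apply: derivable_within_continuous => t; rewrite in_itv/= => /h.
by case.
Qed.

Lemma MVT_der f (df : R -> R) a b : a <= b ->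
  (forall t, a <= t <= b -> der t f (df t)) ->
  exists2 c, a <= c <= b & f b - f a = df c * (b - a).
Proof.
move=> ab h.
have h' : forall x : R, x \in `]a, b[%R -> der x f (df x).
  by move=> x; rewrite in_itv/= => /andP[/ltW ax /ltW xb]; apply: h; rewrite ax.
have [c] := MVT_segment ab h' (der_within_continuous h).
by rewrite in_itv/= => cab E; exists c.
Qed.

Lemma der_nondecreasing f (df : R -> R) a b : a <= b ->
  (forall t, a <= t <= b -> der t f (df t)) ->
  (forall t, a <= t <= b -> 0 <= df t) -> f a <= f b.
Proof.
move=> ab h p; have [c cab E] := MVT_der ab h.
by rewrite -subr_ge0 E mulr_ge0 ?p// subr_ge0.
Qed.

(** Mean value inequality with a varying bound: [f + g] and [g - f] are both nondecreasing. The
    Picard iteration uses it with an exponential [g]. *)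
Lemma der_bound f (df : R -> R) g (dg : R -> R) a b : a <= b ->
  (forall t, a <= t <= b -> der t f (df t)) ->
  (forall t, a <= t <= b -> der t g (dg t)) ->
  (forall t, a <= t <= b -> `|df t| <= dg t) -> `|f b - f a| <= g b - g a.
Proof.
move=> ab hf hg p; rewrite ler_norml; apply/andP; split.
- have := @der_nondecreasing (fun t => f t + g t) (fun t => df t + dg t) a b ab
    (fun t ht => derD (hf t ht) (hg t ht)).
  have H : forall t : R, a <= t <= b -> 0 <= df t + dg t.
    by move=> t /p; rewrite ler_norml => /andP[]; lra.
  by move=> /(_ H); lra.
- have := @der_nondecreasing (fun t => g t - f t) (fun t => dg t - df t) a b ab
    (fun t ht => derB (hg t ht) (hf t ht)).
  have H : forall t : R, a <= t <= b -> 0 <= dg t - df t.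
    by move=> t /p; rewrite ler_norml => /andP[]; lra.
  by move=> /(_ H); lra.
Qed.

Lemma der_lipschitz f (df : R -> R) a b (C : R) : a <= b ->
  (forall t, a <= t <= b -> der t f (df t)) ->
  (forall t, a <= t <= b -> `|df t| <= C) -> `|f b - f a| <= C * (b - a).
Proof.
move=> ab hf p; rewrite mulrBr.
apply: (@der_bound f df (fun t => C * t) (fun=> C * 1) a b) => // t ht.
by rewrite mulr1 p.
Qed.

Lemma der_cst_eq f (df : R -> R) a b : a <= b ->
  (forall t, a <= t <= b -> der t f (df t)) ->
  (forall t, a <= t <= b -> df t = 0) -> f a = f b.
Proof.
move=> ab h p; have [c cab E] := MVT_der ab h.
by apply/esym/eqP; rewrite -subr_eq0 E p// mul0r.
Qed.

End OneVariable.

(** * Angles of the triangle of three intersecting circles *)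

Section Triangle.
Variable R : realType.
Implicit Types x y z g : R.

(** Squared distance of the centres of circles of radii x and y, where g is the cosine of the
    weight. Below, [g1], [g2], [g3] belong to the edges opposite to the vertices of radii x, y,
    z. *)
Definition lsq x y g : R := x ^+ 2 + y ^+ 2 + 2 * x * y * g.

(* Four times the squared area of the triangle with side lengths [sqrt (lsq y z g1)],
   [sqrt (lsq x z g2)] and [sqrt (lsq x y g3)], in which positivity is visible. *)
Definition area_sq x y z g1 g2 g3 : R :=
  x ^+ 2 * y ^+ 2 * (1 - g3 ^+ 2) + x ^+ 2 * z ^+ 2 * (1 - g2 ^+ 2)
  + y ^+ 2 * z ^+ 2 * (1 - g1 ^+ 2)
  + 2 * x * y * z * (x * (g1 + g2 * g3) + y * (g2 + g1 * g3)
                     + z * (g3 + g1 * g2)).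

(** The inner product of the two edge vectors at the vertex of radius x, that is half of b^2 + c^2 -
    a^2. *)
Definition cosnum x y z g1 g2 g3 : R :=
  x ^+ 2 + x * z * g2 + x * y * g3 - y * z * g1.

(** Spelled like [angle], so that [angleE] holds by conversion. *)
Definition triangle_angle x y z g1 g2 g3 : R :=
  let a := Num.sqrt (lsq y z g1) in
  let b := Num.sqrt (lsq x z g2) in
  let c := Num.sqrt (lsq x y g3) in
  acos ((b ^+ 2 + c ^+ 2 - a ^+ 2) / (2 * b * c)).

(* The derivative of the angle at [x] with respect to [ln y]. *)
Definition angle_weight x y z g1 g2 g3 : R :=
  x * y * (x * y * (1 - g3 ^+ 2) + z * (x * (g1 + g2 * g3) + y * (g2 + g1 * g3)))
  / (lsq x y g3 * Num.sqrt (area_sq x y z g1 g2 g3)).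

Lemma lsqC x y g : lsq x y g = lsq y x g.
Proof. by rewrite /lsq; ring. Qed.

Lemma lsq_gt0 x y g : 0 < x -> 0 < y -> 0 <= g -> 0 < lsq x y g.
Proof.
move=> x0 y0 g0; rewrite /lsq ltr_wpDr ?addr_gt0 ?exprn_gt0//.
by rewrite !mulr_ge0// ltW.
Qed.

Lemma area_sqE x y z g1 g2 g3 :
  area_sq x y z g1 g2 g3
  = lsq x z g2 * lsq x y g3 - cosnum x y z g1 g2 g3 ^+ 2.
Proof. by rewrite /area_sq /lsq /cosnum; ring. Qed.

(** Nonnegative cosines make every term nonnegative. This stands for the triangle inequalities: it
    puts the argument of [acos] strictly between -1 and 1, where [acos] is differentiable. *)
Lemma area_sq_gt0 x y z g1 g2 g3 : 0 < x -> 0 < y -> 0 < z ->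
  0 <= g1 <= 1 -> 0 <= g2 <= 1 -> 0 <= g3 <= 1 ->
  0 < area_sq x y z g1 g2 g3.
Proof.
move=> x0 y0 z0 /andP[g10 g11] /andP[g20 g21] /andP[g30 g31].
have nn (s t g : R) : 0 < s -> 0 < t -> 0 <= g -> g <= 1 ->
    0 <= s ^+ 2 * t ^+ 2 * (1 - g ^+ 2).
  by move=> ? ? ? ?; rewrite mulr_ge0 ?subr_ge0 ?expr_le1// mulr_ge0 ?exprn_ge0 ?ltW.
have A1 := nn _ _ _ x0 y0 g30 g31; have A2 := nn _ _ _ x0 z0 g20 g21.
have A3 := nn _ _ _ y0 z0 g10 g11.
have B (s a b c : R) : 0 < s -> 0 <= a -> 0 <= b -> 0 <= c -> 0 <= s * (a + b * c).
  by move=> s0 *; rewrite mulr_ge0 ?(ltW s0)// addr_ge0// mulr_ge0.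
have B1 := B _ _ _ _ x0 g10 g20 g30; have B2 := B _ _ _ _ y0 g20 g10 g30.
have B3 := B _ _ _ _ z0 g30 g10 g20.
have xyz : 0 < 2 * x * y * z by rewrite !mulr_gt0.
(* For g3 = 1 the first term vanishes, but then the mixed term contains z * g3 > 0. *)
rewrite /area_sq; have [g3lt|g3ge] := ltrP g3 1.
  have A1' : 0 < x ^+ 2 * y ^+ 2 * (1 - g3 ^+ 2).
    by rewrite mulr_gt0 ?subr_gt0 ?expr_lt1// mulr_gt0 ?exprn_gt0.
  have : 0 <= 2 * x * y * z * (x * (g1 + g2 * g3) + y * (g2 + g1 * g3)
                     + z * (g3 + g1 * g2)).
    by rewrite mulr_ge0 ?(ltW xyz)// !addr_ge0.
  by move=> *; lra.
have B3' : 0 < z * (g3 + g1 * g2).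
  by rewrite mulr_gt0// ltr_wpDr ?mulr_ge0// (lt_le_trans ltr01).
have : 0 < 2 * x * y * z * (x * (g1 + g2 * g3) + y * (g2 + g1 * g3)
                     + z * (g3 + g1 * g2)).
  by rewrite mulr_gt0// ltr_wpDl// addr_ge0.
by move=> *; lra.
Qed.

(** The angle at x varies with ln y as the angle at y varies with ln x. This reciprocity makes the
    Jacobian of the curvature symmetric, hence the curvature a gradient. *)
Lemma angle_weightC x y z g1 g2 g3 :
  angle_weight x y z g1 g2 g3 = angle_weight y x z g2 g1 g3.
Proof.
rewrite /angle_weight (lsqC y x).
have -> : area_sq y x z g2 g1 g3 = area_sq x y z g1 g2 g3.
  by rewrite /area_sq; ring.
by congr (_ / _); ring.
Qed.

Lemma angle_weight_ge0 x y z g1 g2 g3 : 0 < x -> 0 < y -> 0 < z ->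
  0 <= g1 <= 1 -> 0 <= g2 <= 1 -> 0 <= g3 <= 1 ->
  0 <= angle_weight x y z g1 g2 g3.
Proof.
move=> x0 y0 z0 /andP[g10 g11] /andP[g20 g21] /andP[g30 g31].
rewrite /angle_weight divr_ge0//; last first.
  by rewrite mulr_ge0 ?sqrtr_ge0// ltW// lsq_gt0.
have A (s a b c : R) : 0 < s -> 0 <= a -> 0 <= b -> 0 <= c -> 0 <= s * (a + b * c).
  by move=> s0 *; rewrite mulr_ge0 ?(ltW s0)// addr_ge0// mulr_ge0.
have xy0 := mulr_gt0 x0 y0.
have g3_ge0 : 0 <= 1 - g3 ^+ 2 by rewrite subr_ge0 expr_le1.
by rewrite mulr_ge0 ?(ltW xy0)// addr_ge0// mulr_ge0 ?(ltW xy0) ?(ltW z0)// addr_ge0// A.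
Qed.

(* The weight of an edge can vanish (for g3 = 1, g1 = g2 = 0), but a triangle
   has at most one edge of weight 0. *)
Lemma angle_weight_gt0 x y z g1 g2 g3 : 0 < x -> 0 < y -> 0 < z ->
  0 <= g1 <= 1 -> 0 <= g2 <= 1 -> 0 <= g3 <= 1 -> [|| g3 < 1, 0 < g1 | 0 < g2] ->
  0 < angle_weight x y z g1 g2 g3.
Proof.
move=> x0 y0 z0 G1 G2 G3 G.
have S0 := area_sq_gt0 x0 y0 z0 G1 G2 G3.
case/andP: (G1) (G2) (G3) => g10 g11 /andP[g20 g21] /andP[g30 g31].
rewrite /angle_weight divr_gt0 ?mulr_gt0 ?sqrtr_gt0 ?lsq_gt0//.
have A : 0 <= x * y * (1 - g3 ^+ 2).
  by rewrite !mulr_ge0 ?(ltW x0) ?(ltW y0)// subr_ge0 expr_le1.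
have B1 : 0 <= x * (g1 + g2 * g3) by rewrite mulr_ge0 ?addr_ge0 ?mulr_ge0// ltW.
have B2 : 0 <= y * (g2 + g1 * g3) by rewrite mulr_ge0 ?addr_ge0 ?mulr_ge0// ltW.
case/or3P: G => G.
- apply: ltr_pwDl; last by rewrite mulr_ge0 ?addr_ge0// ltW.
  by rewrite !mulr_gt0// subr_gt0 expr_lt1.
- apply: ltr_pwDr => //; rewrite mulr_gt0// ltr_pwDl//.
  by rewrite mulr_gt0// ltr_pwDl// mulr_ge0.
- apply: ltr_pwDr => //; rewrite mulr_gt0// ltr_pwDr//.
  by rewrite mulr_gt0// ltr_pwDl// mulr_ge0.
Qed.

Section Angle.
Variables (x y z g1 g2 g3 : R).
Hypotheses (x0 : 0 < x) (y0 : 0 < y) (z0 : 0 < z).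
Hypotheses (G1 : 0 <= g1 <= 1) (G2 : 0 <= g2 <= 1) (G3 : 0 <= g3 <= 1).
Let b := Num.sqrt (lsq x z g2).
Let c := Num.sqrt (lsq x y g3).
Let g10 : 0 <= g1. Proof. by case/andP: G1. Qed.
Let g20 : 0 <= g2. Proof. by case/andP: G2. Qed.
Let g30 : 0 <= g3. Proof. by case/andP: G3. Qed.
Let b0 : 0 < b. Proof. by rewrite sqrtr_gt0 lsq_gt0. Qed.
Let c0 : 0 < c. Proof. by rewrite sqrtr_gt0 lsq_gt0. Qed.
Let b2 : b ^+ 2 = lsq x z g2. Proof. by rewrite sqr_sqrtr// ltW// lsq_gt0. Qed.
Let c2 : c ^+ 2 = lsq x y g3. Proof. by rewrite sqr_sqrtr// ltW// lsq_gt0. Qed.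

Lemma cos_argE :
  (b ^+ 2 + c ^+ 2 - Num.sqrt (lsq y z g1) ^+ 2) / (2 * b * c)
  = cosnum x y z g1 g2 g3 / (b * c).
Proof.
rewrite b2 c2 sqr_sqrtr ?ltW ?lsq_gt0// /lsq /cosnum.
by field; rewrite ?(gt_eqF b0) ?(gt_eqF c0).
Qed.

Lemma triangle_angleE :
  triangle_angle x y z g1 g2 g3 = acos (cosnum x y z g1 g2 g3 / (b * c)).
Proof. by rewrite /triangle_angle -/b -/c cos_argE. Qed.

Lemma cos_arg_sq :
  1 - (cosnum x y z g1 g2 g3 / (b * c)) ^+ 2
  = area_sq x y z g1 g2 g3 / (b * c) ^+ 2.
Proof.
rewrite area_sqE -b2 -c2; field.
by rewrite (gt_eqF b0) (gt_eqF c0).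
Qed.

Lemma cos_arg_itv : -1 < cosnum x y z g1 g2 g3 / (b * c) < 1.
Proof.
rewrite -ltr_norml -ltr_sqr ?nnegrE// expr1n real_normK ?num_real//.
rewrite -subr_gt0 cos_arg_sq divr_gt0 ?area_sq_gt0//.
by rewrite exprn_gt0 ?mulr_gt0.
Qed.

Lemma cos_triangle_angle :
  cos (triangle_angle x y z g1 g2 g3) = cosnum x y z g1 g2 g3 / (b * c).
Proof.
rewrite triangle_angleE acosK// in_itv/=.
by case/andP: cos_arg_itv => /ltW -> /ltW ->.
Qed.

Lemma sin_triangle_angle :
  sin (triangle_angle x y z g1 g2 g3)
  = Num.sqrt (area_sq x y z g1 g2 g3) / (b * c).
Proof.
rewrite triangle_angleE sin_acos; last by case/andP: cos_arg_itv => /ltW -> /ltW ->.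
rewrite cos_arg_sq sqrtrM ?(ltW (area_sq_gt0 _ _ _ _ _ _))//.
by rewrite -exprVn sqrtr_sqr ger0_norm// invr_ge0 mulr_ge0 ?ltW.
Qed.

Lemma triangle_angle_itv : 0 < triangle_angle x y z g1 g2 g3 < pi.
Proof.
rewrite triangle_angleE; case/andP: cos_arg_itv => h1 h2.
by rewrite acos_gt0 ?acos_ltpi ?h1 ?h2 ?ltW.
Qed.

End Angle.

Lemma triangle_angleC x y z g1 g2 g3 :
  triangle_angle x y z g1 g2 g3 = triangle_angle x z y g1 g3 g2.
Proof.
rewrite /triangle_angle (lsqC y z).
by congr (acos (_ / _)); ring.
Qed.

(** The sum A + B has the cosine of pi - C. Its sine is positive, so that A + B lies in ]0, pi[,
    where the cosine is injective. *)
Lemma triangle_angle_sum x y z g1 g2 g3 : 0 < x -> 0 < y -> 0 < z ->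
  0 <= g1 <= 1 -> 0 <= g2 <= 1 -> 0 <= g3 <= 1 ->
  triangle_angle x y z g1 g2 g3 + triangle_angle y x z g2 g1 g3
  + triangle_angle z x y g3 g1 g2 = pi.
Proof.
move=> x0 y0 z0 G1 G2 G3.
set A := triangle_angle x _ _ _ _ _; set B := triangle_angle y _ _ _ _ _.
set C := triangle_angle z _ _ _ _ _.
have [A0 Api] := andP (triangle_angle_itv x0 y0 z0 G1 G2 G3).
have [B0 Bpi] := andP (triangle_angle_itv y0 x0 z0 G2 G1 G3).
have [C0 Cpi] := andP (triangle_angle_itv z0 x0 y0 G3 G1 G2).
have S0 := area_sq_gt0 x0 y0 z0 G1 G2 G3.
have [g10 _] := andP G1; have [g20 _] := andP G2; have [g30 _] := andP G3.
have a0 : 0 < Num.sqrt (lsq y z g1) by rewrite sqrtr_gt0 lsq_gt0.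
have b0 : 0 < Num.sqrt (lsq x z g2) by rewrite sqrtr_gt0 lsq_gt0.
have c0 : 0 < Num.sqrt (lsq x y g3) by rewrite sqrtr_gt0 lsq_gt0.
have c2 : Num.sqrt (lsq x y g3) ^+ 2 = lsq x y g3 by rewrite sqr_sqrtr// ltW// lsq_gt0.
have SE : area_sq y x z g2 g1 g3 = area_sq x y z g1 g2 g3 by rewrite /area_sq; ring.
have sinAB : 0 < sin (A + B).
  rewrite sinD !cos_triangle_angle// !sin_triangle_angle// SE (lsqC y x).
  set a := Num.sqrt (lsq y z g1) in a0 *; set b := Num.sqrt (lsq x z g2) in b0 *.
  set c := Num.sqrt (lsq x y g3) in c0 c2 *.
  set S := Num.sqrt _.
  have -> : S / (b * c) * (cosnum y x z g2 g1 g3 / (a * c)) +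
     cosnum x y z g1 g2 g3 / (b * c) * (S / (a * c)) = S / (a * b).
    have -> : cosnum x y z g1 g2 g3 = c ^+ 2 - cosnum y x z g2 g1 g3.
      by rewrite c2 /cosnum /lsq; ring.
    by field; rewrite !gt_eqF.
  by rewrite divr_gt0 ?mulr_gt0// /S sqrtr_gt0.
have cosAB : cos (A + B) = - cos C.
  rewrite cosD !cos_triangle_angle// !sin_triangle_angle// SE (lsqC y x).
  rewrite (lsqC z x) (lsqC z y).
  set a := Num.sqrt (lsq y z g1) in a0 *; set b := Num.sqrt (lsq x z g2) in b0 *.
  set c := Num.sqrt (lsq x y g3) in c0 c2 *.
  set S := Num.sqrt _.
  have S2 : S ^+ 2 = area_sq x y z g1 g2 g3 by rewrite sqr_sqrtr// ltW.
  have E : cosnum x y z g1 g2 g3 * cosnum y x z g2 g1 g3 - S ^+ 2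
           = - cosnum z x y g3 g1 g2 * c ^+ 2.
    by rewrite S2 c2 /cosnum /lsq /area_sq; ring.
  have -> : cosnum x y z g1 g2 g3 / (b * c) * (cosnum y x z g2 g1 g3 / (a * c)) -
      S / (b * c) * (S / (a * c))
     = (cosnum x y z g1 g2 g3 * cosnum y x z g2 g1 g3 - S ^+ 2) / (a * b * c ^+ 2).
    by field; rewrite !gt_eqF.
  by rewrite E; field; rewrite !gt_eqF.
have ABpi : A + B < pi.
  rewrite ltNge; apply/negP => h.
  have : 0 <= sin (A + B - pi).
    rewrite sin_ge0_pi// subr_ge0 h/= lerBlDl.
    by apply: ltW; apply: ltrD.
  by rewrite -opprB sinN sinB sinpi cospi; lra.
suff -> : A + B = pi - C by rewrite subrK.
apply: cos_inj.
- by rewrite in_itv/= (ltW ABpi) andbT ltW// addr_gt0.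
- by rewrite in_itv/= subr_ge0 (ltW Cpi)/= gerBl ltW.
- by rewrite cosAB cosB cospi sinpi mul0r addr0 mulN1r.
Qed.

Lemma sqrt_lsq_ge x y g : 0 < x -> 0 < y -> 0 <= g -> y <= Num.sqrt (lsq x y g).
Proof.
move=> x0 y0 g0.
apply: (@le_trans _ _ (Num.sqrt (y ^+ 2))); first by rewrite sqrtr_sqr ger0_norm// ltW.
rewrite ler_wsqrtr// /lsq addrAC lerDr addr_ge0 ?sqr_ge0//.
by rewrite !mulr_ge0// ltW.
Qed.

(** [cosnum] exceeds - y z g1, and y z <= b c because an edge is at least as long as the radius at
    either end. *)
Lemma triangle_angle_lt x y z g1 g2 g3 t : 0 < x -> 0 < y -> 0 < z ->
  0 <= g1 <= 1 -> 0 <= g2 <= 1 -> 0 <= g3 <= 1 -> 0 <= t <= pi -> g1 = cos t ->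
  triangle_angle x y z g1 g2 g3 < pi - t.
Proof.
move=> x0 y0 z0 G1 G2 G3 /andP[t0 tpi] g1E.
have [A0 Api] := andP (triangle_angle_itv x0 y0 z0 G1 G2 G3).
have [g10 _] := andP G1; have [g20 _] := andP G2; have [g30 _] := andP G3.
rewrite -ltr_cos ?in_itv/= ?(ltW A0) ?(ltW Api) ?subr_ge0 ?gerBl ?tpi ?t0//.
rewrite cos_triangle_angle// cosB cospi sinpi mul0r addr0 mulN1r -g1E.
set b := Num.sqrt (lsq x z g2); set c := Num.sqrt (lsq x y g3).
have zb : z <= b by exact: sqrt_lsq_ge.
have yc : y <= c by exact: sqrt_lsq_ge.
have yzbc : y * z <= b * c by rewrite mulrC ler_pM// ltW.
rewrite ltr_pdivlMr ?mulr_gt0 ?(lt_le_trans _ zb) ?(lt_le_trans _ yc)//.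
rewrite /cosnum.
have : 0 < x ^+ 2 by rewrite exprn_gt0.
have : 0 <= x * z * g2 by rewrite !mulr_ge0// ltW.
have : 0 <= x * y * g3 by rewrite !mulr_ge0// ltW.
have : g1 * (y * z) <= g1 * (b * c) by rewrite ler_wpM2l.
by move=> *; lra.
Qed.

Lemma sqrt_lsq_le x y g k : 0 < x -> 0 < y -> 0 <= g <= 1 -> x <= k * y ->
  Num.sqrt (lsq x y g) <= (1 + k) * y.
Proof.
move=> x0 y0 /andP[g0 g1] xy.
apply: (@le_trans _ _ (x + y)); last by rewrite mulrDl mul1r addrC lerD2l.
rewrite -[x + y]ger0_norm; last by rewrite addr_ge0 ?ltW.
rewrite -sqrtr_sqr.
rewrite ler_wsqrtr// /lsq sqrrD [leRHS]addrAC lerD2l.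
have : x * y * g <= x * y by rewrite ler_piMr// mulr_ge0// ltW.
by lra.
Qed.

Lemma triangle_angle_small_apex t e : 0 <= t <= pi / 2 -> 0 < e ->
  exists2 d : R, 0 < d & forall x y z g2 g3, 0 < x -> 0 < y -> 0 < z ->
  0 <= g2 <= 1 -> 0 <= g3 <= 1 -> x <= d * y -> x <= d * z ->
  pi - t - e < triangle_angle x y z (cos t) g2 g3.
Proof.
move=> /andP[t0 t2] e0.
have pi0 := @pi_gt0 R.
(* The cap keeps pi - t - e' in [0, pi], where the cosine decreases. *)
pose e' := Num.min e (pi / 2).
have e'0 : 0 < e' by rewrite lt_min e0/= divr_gt0.
have e'e : e' <= e by rewrite ge_min lexx.
have e'2 : e' <= pi / 2 by rewrite ge_min lexx orbT.
pose m := cos (pi - t - e').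
have mg : 0 < m + cos t.
  have -> : cos t = - cos (pi - t) by rewrite cosB cospi sinpi; ring.
  rewrite subr_gt0 /m ltr_cos ?in_itv/=; try (apply/andP; split); lra.
have m1 : m <= 1 by exact: cos_le1.
have c1 : cos t <= 1 by exact: cos_le1.
have c0 : 0 <= cos t by rewrite cos_ge0_pihalf//; apply/andP; split; lra.
(* Here 7 > 3 + 3: three terms of [cosnum] are at most d y z each, and b c <= (1 + 3 d) y z costs up
   to 3 d more when m is negative, as m >= -1. *)
exists ((m + cos t) / 7); first by rewrite divr_gt0.
move=> x y z g2 g3 x0 y0 z0 G2 G3 xy xz.
have G1 : 0 <= cos t <= 1 by rewrite c0.
set d := (m + cos t) / 7 in xy xz *.
have d0 : 0 < d by rewrite divr_gt0.
have d1 : d < 1 by rewrite /d; lra.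
have dE : 7 * d = m + cos t by rewrite /d; field.
have [A0 Api] := andP (triangle_angle_itv x0 y0 z0 G1 G2 G3).
apply: (@le_lt_trans _ _ (pi - t - e')); first by rewrite lerD2l lerN2.
rewrite -ltr_cos ?in_itv/= ?(ltW A0) ?(ltW Api)//; last first.
  by apply/andP; split; lra.
rewrite cos_triangle_angle// -/m.
set b := Num.sqrt (lsq x z g2); set c := Num.sqrt (lsq x y g3).
have [/andP[g20 g21] /andP[g30 g31]] := (G2, G3).
have zb : z <= b by exact: sqrt_lsq_ge.
have yc : y <= c by exact: sqrt_lsq_ge.
have bz : b <= (1 + d) * z by exact: sqrt_lsq_le.
have cy : c <= (1 + d) * y by exact: sqrt_lsq_le.
have b0 : 0 < b by exact: lt_le_trans zb.
have c_0 : 0 < c by exact: lt_le_trans yc.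
have yz0 : 0 < y * z by rewrite mulr_gt0.
have yzbc : y * z <= b * c by rewrite mulrC ler_pM// ltW.
have bcyz : b * c <= (1 + 3 * d) * (y * z).
  apply: (@le_trans _ _ (((1 + d) * z) * ((1 + d) * y))); first by rewrite ler_pM// ltW.
  have -> : (1 + d) * z * ((1 + d) * y) = (1 + 2 * d + d * d) * (y * z) by ring.
  rewrite ler_pM2r//.
  have : d * d <= d by rewrite ger_pMr// ltW.
  by lra.
rewrite ltr_pdivrMr ?mulr_gt0//.
have x2 : x ^+ 2 <= d * (y * z).
  rewrite expr2; apply: (@le_trans _ _ (d * y * z)); last by rewrite mulrA.
  apply: ler_pM; rewrite ?(ltW x0)//; apply: le_trans xz _.
  by rewrite ger_pMl// ltW.
have xz2 : x * z * g2 <= d * (y * z).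
  apply: (@le_trans _ _ (x * z)); first by rewrite ler_piMr// mulr_ge0 ?(ltW x0) ?(ltW y0) ?(ltW z0).
  by rewrite mulrA ler_pM2r.
have xy2 : x * y * g3 <= d * (y * z).
  apply: (@le_trans _ _ (x * y)); first by rewrite ler_piMr// mulr_ge0 ?(ltW x0) ?(ltW y0) ?(ltW z0).
  by rewrite (mulrC y) mulrA ler_pM2r.
apply: (@le_lt_trans _ _ ((3 * d - cos t) * (y * z))).
  rewrite /cosnum; apply: (@le_trans _ _
     (d * (y * z) + d * (y * z) + d * (y * z) - y * z * cos t)); first by lra.
  by rewrite le_eqVlt; apply/orP; left; apply/eqP; ring.
have [m0|m0] := lerP 0 m.
  apply: (@lt_le_trans _ _ (m * (y * z))); last by rewrite ler_wpM2l.
  by rewrite ltr_pM2r//; lra.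
apply: (@lt_le_trans _ _ (m * ((1 + 3 * d) * (y * z)))); last by rewrite ler_nM2l.
rewrite [ltRHS]mulrA ltr_pM2r//.
have : -1 <= m by exact: cos_geN1.
move=> m1'; have : 0 <= (m + 1) * d by rewrite mulr_ge0 ?(ltW d0)//; lra.
by lra.
Qed.

Lemma triangle_angle_large_apex e : 0 < e ->
  exists2 d : R, 0 < d & forall x y z g1 g2 g3, 0 < x -> 0 < y -> 0 < z ->
  0 <= g1 <= 1 -> 0 <= g2 <= 1 -> 0 <= g3 <= 1 -> y <= d * x -> z <= d * x ->
  triangle_angle x y z g1 g2 g3 < e.
Proof.
move=> e0.
have pi0 := @pi_gt0 R.
pose e' := Num.min e (pi / 2).
have e'0 : 0 < e' by rewrite lt_min e0/= divr_gt0.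
have e'e : e' <= e by rewrite ge_min lexx.
have e'2 : e' <= pi / 2 by rewrite ge_min lexx orbT.
pose k := cos e'.
have k1 : k < 1.
  rewrite -(@cos0 R) /k ltr_cos ?in_itv/= ?lexx ?(ltW pi0)//.
  by apply/andP; split; lra.
have k0 : 0 <= k by rewrite cos_ge0_pihalf//; apply/andP; split; lra.
(* With this d one has k (1 + d) < 1 - d, hence k b c <= k (1 + d)^2 x^2 < (1 - d^2) x^2 <=
   [cosnum]. *)
exists ((1 - k) / 4); first by rewrite divr_gt0//; lra.
move=> x y z g1 g2 g3 x0 y0 z0 G1 G2 G3 yx zx.
set d := (1 - k) / 4 in yx zx *.
have d0 : 0 < d by rewrite divr_gt0//; lra.
have dE : 4 * d = 1 - k by rewrite /d; field.
have [A0 Api] := andP (triangle_angle_itv x0 y0 z0 G1 G2 G3).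
apply: (@lt_le_trans _ _ e') => //.
rewrite -ltr_cos ?in_itv/= ?(ltW A0) ?(ltW Api)//; last first.
  by apply/andP; split; lra.
rewrite cos_triangle_angle// -/k (lsqC x z) (lsqC x y).
set b := Num.sqrt (lsq z x g2); set c := Num.sqrt (lsq y x g3).
have [[/andP[g10 g11] /andP[g20 g21]] /andP[g30 g31]] := (G1, G2, G3).
have xb : x <= b by exact: sqrt_lsq_ge.
have xc : x <= c by exact: sqrt_lsq_ge.
have bx : b <= (1 + d) * x by exact: sqrt_lsq_le.
have cx : c <= (1 + d) * x by exact: sqrt_lsq_le.
have b0 : 0 < b by exact: lt_le_trans xb.
have c0 : 0 < c by exact: lt_le_trans xc.
rewrite ltr_pdivlMr ?mulr_gt0//.
have x2 : 0 < x ^+ 2 by rewrite exprn_gt0.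
apply: (@le_lt_trans _ _ (k * ((1 + d) ^+ 2 * x ^+ 2))).
  by rewrite ler_wpM2l// -exprMn expr2 ler_pM// ltW.
apply: (@lt_le_trans _ _ ((1 - d ^+ 2) * x ^+ 2)).
  rewrite mulrA ltr_pM2r//.
  have -> : 1 - d ^+ 2 = (1 - d) * (1 + d) by ring.
  rewrite expr2 mulrA ltr_pM2r ?addr_gt0//.
  have : k * d <= d by rewrite ger_pMl// ltW.
  by lra.
rewrite /cosnum.
have : 0 <= x * z * g2 by rewrite !mulr_ge0// ltW.
have : 0 <= x * y * g3 by rewrite !mulr_ge0// ltW.
have : y * z * g1 <= d ^+ 2 * x ^+ 2.
  apply: (@le_trans _ _ (y * z)); first by rewrite ler_piMr// mulr_ge0 ?(ltW x0) ?(ltW y0) ?(ltW z0).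
  by rewrite -exprMn expr2 ler_pM// ltW.
by move=> *; lra.
Qed.

Local Notation der t f d := (is_derive (t : R) (1 : R) (f : R -> R) (d : R)).

Lemma der_lsq (x y : R -> R) t wx wy g :
  der t x (x t * wx) -> der t y (y t * wy) ->
  der t (fun s => lsq (x s) (y s) g)
    (2 * (x t ^+ 2 * wx + y t ^+ 2 * wy + x t * y t * g * (wx + wy))).
Proof.
move=> dx dy.
apply: is_derive_eq (derD (derD (derM dx dx) (derM dy dy))
   (derM (derM (derMl 2 dx) dy) (der_cst t g))) _.
by ring.
Qed.

(** Angles are invariant under scaling, so only differences of logarithmic velocities occur. This
    gives the derivative of the curvature the shape of a graph Laplacian. *)
Lemma der_triangle_angle (x y z : R -> R) t wx wy wz g1 g2 g3 :
  (forall s, 0 < x s) -> (forall s, 0 < y s) -> (forall s, 0 < z s) ->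
  0 <= g1 <= 1 -> 0 <= g2 <= 1 -> 0 <= g3 <= 1 ->
  der t x (x t * wx) -> der t y (y t * wy) -> der t z (z t * wz) ->
  der t (fun s => triangle_angle (x s) (y s) (z s) g1 g2 g3)
    (angle_weight (x t) (y t) (z t) g1 g2 g3 * (wy - wx)
     + angle_weight (x t) (z t) (y t) g1 g3 g2 * (wz - wx)).
Proof.
move=> x0 y0 z0 G1 G2 G3 dx dy dz.
have [[/andP[g10 g11] /andP[g20 g21]] /andP[g30 g31]] := (G1, G2, G3).
have -> : (fun s => triangle_angle (x s) (y s) (z s) g1 g2 g3) = (fun s =>
   acos (cosnum (x s) (y s) (z s) g1 g2 g3
         / (Num.sqrt (lsq (x s) (z s) g2) * Num.sqrt (lsq (x s) (y s) g3)))).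
  by apply/funext => s; rewrite triangle_angleE.
have B0 : 0 < lsq (x t) (z t) g2 by rewrite lsq_gt0.
have C0 : 0 < lsq (x t) (y t) g3 by rewrite lsq_gt0.
have db := @der_comp _ t Num.sqrt (fun s => lsq (x s) (z s) g2) _ _
  (is_derive1_sqrt B0) (der_lsq g2 dx dz).
have dc := @der_comp _ t Num.sqrt (fun s => lsq (x s) (y s) g3) _ _
  (is_derive1_sqrt C0) (der_lsq g3 dx dy).
have dn : der t (fun s => cosnum (x s) (y s) (z s) g1 g2 g3)
  (2 * x t ^+ 2 * wx + x t * z t * g2 * (wx + wz) + x t * y t * g3 * (wx + wy)
   - y t * z t * g1 * (wy + wz)).
  apply: is_derive_eq (derB (derD (derD (derM dx dx)
     (derM (derM dx dz) (der_cst t g2))) (derM (derM dx dy) (der_cst t g3)))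
     (derM (derM dy dz) (der_cst t g1))) _.
  by ring.
have [lo hi] := andP (cos_arg_itv (x0 t) (y0 t) (z0 t) G1 G2 G3).
have S0 := area_sq_gt0 (x0 t) (y0 t) (z0 t) G1 G2 G3.
have Sq := cos_arg_sq g1 (x0 t) (y0 t) (z0 t) G2 G3.
have b2 : Num.sqrt (lsq (x t) (z t) g2) ^+ 2 = lsq (x t) (z t) g2.
  by rewrite sqr_sqrtr// ltW.
have c2 : Num.sqrt (lsq (x t) (y t) g3) ^+ 2 = lsq (x t) (y t) g3.
  by rewrite sqr_sqrtr// ltW.
have b0 : 0 < Num.sqrt (lsq (x t) (z t) g2) by rewrite sqrtr_gt0.
have c0 : 0 < Num.sqrt (lsq (x t) (y t) g3) by rewrite sqrtr_gt0.
have bc0 : Num.sqrt (lsq (x t) (z t) g2) * Num.sqrt (lsq (x t) (y t) g3) != 0.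
  by rewrite mulf_neq0 ?gt_eqF.
have dq := derM dn (@derV _ t (fun s => Num.sqrt (lsq (x s) (z s) g2) *
    Num.sqrt (lsq (x s) (y s) g3)) _ bc0 (derM db dc)).
have dq' := @der_comp _ t acos (fun s => cosnum (x s) (y s) (z s) g1 g2 g3
   / (Num.sqrt (lsq (x s) (z s) g2) * Num.sqrt (lsq (x s) (y s) g3))) _ _
   (is_derive1_acos (cos_arg_itv (x0 t) (y0 t) (z0 t) G1 G2 G3)) dq.
apply: is_derive_eq dq' _ => /=.
rewrite Sq sqrtrM ?(ltW S0)// sqrtrV ?sqr_ge0// sqrtr_sqr ger0_norm ?mulr_ge0 ?ltW//.
have SE : area_sq (x t) (z t) (y t) g1 g3 g2 = area_sq (x t) (y t) (z t) g1 g2 g3.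
  by rewrite /area_sq; ring.
rewrite /angle_weight SE.
have : 0 < Num.sqrt (area_sq (x t) (y t) (z t) g1 g2 g3) by rewrite sqrtr_gt0.
move: b2 c2 b0 c0.
set b := Num.sqrt (lsq (x t) (z t) g2); set c := Num.sqrt (lsq (x t) (y t) g3).
set S := Num.sqrt _ => b2 c2 b0 c0 S_0.
set X := x t in b2 c2 *; set Y := y t in c2 *; set Z := z t in b2 *.
rewrite -b2 -c2; set n := cosnum _ _ _ _ _ _.
set n' := 2 * X ^+ 2 * wx + _ + _ - _.
set b' := X ^+ 2 * wx + Z ^+ 2 * wz + _.
set c' := X ^+ 2 * wx + Y ^+ 2 * wy + _.
set m3 := X * Y * (1 - g3 ^+ 2) + _.
set m2 := X * Z * (1 - g2 ^+ 2) + _.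
(* Clearing denominators leaves a polynomial identity, checked after replacing b^2 and c^2 by
   [lsq]. *)
have key : n * (b' * c ^+ 2 + c' * b ^+ 2) - n' * (b ^+ 2 * c ^+ 2)
  = X * Y * m3 * (wy - wx) * b ^+ 2 + X * Z * m2 * (wz - wx) * c ^+ 2.
  by rewrite b2 c2 /n /n' /b' /c' /m2 /m3 /cosnum /lsq; ring.
have -> : X * Y * m3 / (c ^+ 2 * S) * (wy - wx) + X * Z * m2 / (b ^+ 2 * S) * (wz - wx)
  = (X * Y * m3 * (wy - wx) * b ^+ 2 + X * Z * m2 * (wz - wx) * c ^+ 2)
    / (b ^+ 2 * c ^+ 2 * S).
  by field; rewrite ?gt_eqF.
rewrite -key; field.
by rewrite !gt_eqF.
Qed.

End Triangle.

(** * Gradients and locally Lipschitz functions *)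

Section EpsilonDerivative.
Variable R : realType.
Implicit Types (f g : R -> R) (t s a b d e : R).
Local Notation der t f d := (is_derive (t : R) (1 : R) (f : R -> R) (d : R)).

Lemma der_epsP t f d : der t f d <-> forall e, 0 < e ->
  exists2 r : R, 0 < r & forall s, `|s - t| < r ->
    `|f s - f t - d * (s - t)| <= e * `|s - t|.
Proof.
have quot (h : R) e : h != 0 ->
   (`|d - h^-1 *: ((f \o shift t) (h *: 1) - f t)| <= e) =
   (`|f (h + t) - f t - d * h| <= e * `|h|).
  move=> h0; rewrite /= /GRing.scale/= mulr1.
  rewrite -[in RHS]normrN opprB.
  have -> : d * h - (f (h + t) - f t) = (d - h^-1 * (f (h + t) - f t)) * h.
    by field.
  by rewrite normrM ler_pM2r// normr_gt0.
split=> [[dv dE] e e0|H].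
  move: dv => /cvg_ex[l lE].
  have {lE} : h^-1 *: ((f \o shift t) (h *: 1) - f t) @[h --> 0^'] --> d.
    by rewrite -dE /derive (cvg_lim _ lE).
  move/cvgrPdist_le => /(_ _ e0).
  move=> /nbhs_ballP[r /= r0 H]; exists r => // s sr.
  have [->|st] := eqVneq s t; first by rewrite !subrr mulr0 subr0 normr0 mulr0.
  have h0 : s - t != 0 by rewrite subr_eq0.
  have := H (s - t).
  rewrite /ball/= sub0r normrN => /(_ sr h0).
  have := quot _ e h0; rewrite /= => ->.
  by rewrite subrK.
have cv : h^-1 *: ((f \o shift t) (h *: 1) - f t) @[h --> 0^'] --> d.
  apply/cvgrPdist_le => e e0; have [r r0 Hr] := H _ e0.
  apply/nbhs_ballP; exists r => //= h; rewrite /ball/= sub0r normrN => hr h0.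
  have := quot _ e h0; rewrite /= => ->.
  by have := Hr (h + t); rewrite addrK; apply.
by split; [apply/cvg_ex; exists d|exact/cvg_lim].
Qed.

Lemma der_locally_lipschitz t f d : der t f d ->
  exists r C : R, [/\ 0 < r, 0 <= C & forall s, `|s - t| < r -> `|f s - f t| <= C * `|s - t|].
Proof.
move=> /der_epsP /(_ _ ltr01)[r r0 H]; exists r, (1 + `|d|).
split; [by []|by rewrite addr_ge0|move=> s /H].
rewrite mul1r mulrDl mul1r -normrM => H1.
apply: le_trans (lerD H1 (lexx _)).
by rewrite -[X in `|X| <= _](subrK (d * (s - t))) ler_normD.
Qed.

Lemma der_quadratic t f r (C : R) : 0 < r ->
  (forall s, `|s - t| < r -> `|f s - f t| <= C * `|s - t| ^+ 2) -> der t f 0.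
Proof.
move=> r0 H; apply/der_epsP => e e0.
exists (Num.min r (e / (1 + `|C|))).
  by rewrite lt_min r0 divr_gt0// ltr_pwDl.
move=> s; rewrite lt_min => /andP[sr sC]; rewrite mul0r subr0.
apply: (le_trans (H _ sr)); rewrite expr2 mulrA ler_wpM2r//.
apply: (@le_trans _ _ ((1 + `|C|) * `|s - t|)).
  by rewrite ler_wpM2r// (le_trans (ler_norm _))// lerDr.
by rewrite mulrC -ler_pdivlMr ?ltr_pwDl// ltW.
Qed.

End EpsilonDerivative.

Section RowVectors.
Variables (R : realType) (N : nat).
Local Notation rV := 'rV[R]_N.
Local Notation der t f d := (is_derive (t : R) (1 : R) (f : R -> R) (d : R)).
Implicit Types (u v w : rV) (f g : rV -> R) (i j : 'I_N).

Lemma coord_le_norm u i : `|u 0 i| <= `|u|.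
Proof.
rewrite [leRHS]/Num.Def.normr/= mx_normrE.
by apply/bigmax_geP; right; exists (0, i).
Qed.

Lemma norm_leP u (c : R) : 0 <= c -> (`|u| <= c) <-> (forall i, `|u 0 i| <= c).
Proof.
move=> c0; split=> [h i|h]; first exact: le_trans (coord_le_norm u i) h.
rewrite [leLHS]/Num.Def.normr/= mx_normrE.
by apply/bigmax_leP; split=> // -[i j] _; rewrite ord1 /=.
Qed.

Lemma sum_coord_le (g : 'I_N -> R) u (G : R) : (forall j, `|g j| <= G) ->
  `|\sum_j g j * u 0 j| <= N%:R * G * `|u|.
Proof.
move=> hg; apply: (le_trans (ler_norm_sum _ _ _)).
apply: (@le_trans _ _ (\sum_(j < N) G * `|u|)).
  apply: ler_sum => j _; rewrite normrM ler_pM//.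
  exact: coord_le_norm.
by rewrite sumr_const card_ord -mulrA mulr_natl.
Qed.

Lemma cvg_rowP (T : Type) (F : set_system T) (FF : Filter F) (x : T -> rV) u :
  x t @[t --> F] --> u <-> forall i, x t 0 i @[t --> F] --> u 0 i.
Proof.
split=> [h i|h].
  by apply: (@cvg_comp _ _ _ x (fun v : rV => v 0 i) _ _ _ h); exact: coord_continuous.
apply/cvgrPdist_le => e e0.
have : \forall t \near F, forall i, `|u 0 i - x t 0 i| <= e.
  apply: filter_forall => i.
  by have /cvgrPdist_le := h i; apply.
apply: filterS => t H; apply/norm_leP; first exact: ltW.
by move=> i; rewrite !mxE.
Qed.

Lemma compact_box_inter (B : R) (A : set rV) : closed A ->
  compact ([set u | `|u| <= B] `&` A).
Proof.
move=> cA; apply: bounded_closed_compact.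
  exists B; split; first exact: num_real.
  by move=> C BC u [/= uB _]; exact: le_trans uB (ltW BC).
apply: closedI => //.
rewrite (_ : [set u | _] = (fun u : rV => `|u|) @^-1` [set y | y <= B])//.
apply: preimage_closed; last exact: closed_le.
by move=> u _; exact: norm_continuous.
Qed.

(** Lipschitz on every ball rather than near every point: closed under the algebraic operations, and
    it directly supplies the constants for Taylor remainders and for the Picard iteration. *)
Definition loclip f := forall B : R, exists2 C : R, 0 <= C &
  forall u v, `|u| <= B -> `|v| <= B -> `|f u - f v| <= C * `|u - v|.

Lemma loclip_continuous f : loclip f -> continuous f.
Proof.
move=> lf u; apply/(@cvgrPdist_le _ _ _ (nbhs u)) => e e0.
have [C C0 H] := lf (`|u| + 1).
have r0 : 0 < Num.min 1 (e / (1 + C)) by rewrite lt_min ltr01 divr_gt0// ltr_pwDl.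
have := nbhsx_ballx u _ r0; apply: filterS => v; rewrite mx_norm_ball /ball_/= => uv.
move: uv; rewrite lt_min => /andP[uv1 uv2].
have vB : `|v| <= `|u| + 1.
  rewrite -[v](subrK u) (le_trans (ler_normD _ _))// addrC lerD2l ltW//.
  by rewrite distrC.
apply: le_trans (H u v _ vB) _; first by rewrite lerDl.
apply: (@le_trans _ _ ((1 + C) * `|u - v|)); first by rewrite ler_wpM2r// lerDr.
by rewrite mulrC -ler_pdivlMr ?ltr_pwDl// ltW.
Qed.

Lemma loclip_bounded f : loclip f -> forall B : R, exists2 C : R, 0 <= C &
  forall u, `|u| <= B -> `|f u| <= C.
Proof.
move=> lf B; have [C C0 H] := lf (Num.max B 0).
have m0 : 0 <= Num.max B 0 by rewrite le_max lexx orbT.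
exists (`|f 0| + C * Num.max B 0); first by rewrite addr_ge0// mulr_ge0.
move=> u uB; have uB' : `|u| <= Num.max B 0 by rewrite le_max uB.
rewrite -[f u](subrK (f 0)) (le_trans (ler_normD _ _))// addrC lerD2l.
have /H := uB'; move=> /(_ 0); rewrite normr0 subr0 => /(_ m0)/le_trans; apply.
by rewrite ler_wpM2l.
Qed.

Lemma loclip_pos f : loclip f -> (forall u, 0 < f u) -> forall B : R,
  exists2 m : R, 0 < m & forall u, `|u| <= B -> m <= f u.
Proof.
move=> lf f0 B.
pose A : set rV := [set u | `|u| <= B] `&` setT.
have [B0|Bn] := leP 0 B; last first.
  by exists 1 => // u uB; have := normr_ge0 u; rewrite leNgt (le_lt_trans uB Bn).
have [|||c cA H] := @EVT_min_rV R N f A.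
- by exists 0; split => //=; rewrite normr0.
- exact: compact_box_inter closedT.
- by apply: continuous_subspaceT; exact: loclip_continuous.
by exists (f c) => // u uB; apply: H; rewrite inE.
Qed.

Lemma loclip_cst (c : R) : loclip (fun=> c).
Proof. by move=> B; exists 0 => // u v _ _; rewrite subrr normr0 mul0r. Qed.

Lemma loclip_coord i : loclip (fun u => u 0 i).
Proof.
move=> B; exists 1 => // u v _ _; rewrite mul1r.
by have := coord_le_norm (u - v) i; rewrite !mxE.
Qed.

Lemma loclipD f g : loclip f -> loclip g -> loclip (fun u => f u + g u).
Proof.
move=> lf lg B; have [C C0 Hf] := lf B; have [D D0 Hg] := lg B.
exists (C + D); first exact: addr_ge0.
move=> u v uB vB; rewrite mulrDl opprD addrACA.
by rewrite (le_trans (ler_normD _ _))// lerD ?Hf ?Hg.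
Qed.

Lemma loclipN f : loclip f -> loclip (fun u => - f u).
Proof.
move=> lf B; have [C C0 Hf] := lf B; exists C => // u v uB vB.
by rewrite -opprD normrN Hf.
Qed.

Lemma loclipB f g : loclip f -> loclip g -> loclip (fun u => f u - g u).
Proof. by move=> lf lg; apply: loclipD => //; exact: loclipN. Qed.

Lemma loclipM f g : loclip f -> loclip g -> loclip (fun u => f u * g u).
Proof.
move=> lf lg B; have [C C0 Hf] := lf B; have [D D0 Hg] := lg B.
have [F F0 bf] := loclip_bounded lf B; have [G G0 bg] := loclip_bounded lg B.
exists (C * G + F * D); first by rewrite addr_ge0// mulr_ge0.
move=> u v uB vB.
have -> : f u * g u - f v * g v = (f u - f v) * g u + f v * (g u - g v) by ring.
rewrite (le_trans (ler_normD _ _))// !normrM mulrDl.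
apply: lerD.
  by rewrite mulrAC ler_pM// ?Hf ?bg.
by rewrite -mulrA ler_pM// ?Hg ?bf.
Qed.

Lemma loclip_sum (I : Type) (r : seq I) (P : pred I) (F : I -> rV -> R) :
  (forall k, P k -> loclip (F k)) -> loclip (fun u => \sum_(k <- r | P k) F k u).
Proof.
move=> lF; elim: r => [|k r IH].
  rewrite (_ : (fun u => _) = (fun=> 0)); first exact: loclip_cst.
  by apply/funext => s; rewrite big_nil.
have -> : (fun u => \sum_(j <- k :: r | P j) F j u)
  = (fun u => (if P k then F k u else 0) + \sum_(j <- r | P j) F j u).
  by apply/funext => s; rewrite big_cons; case: ifP; rewrite ?add0r.
apply: loclipD => //; case Pk: (P k); [exact: lF|exact: loclip_cst].
Qed.

Lemma loclip_comp f (h : R -> R) : loclip f ->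
  (forall B : R, exists2 C : R, 0 <= C & forall u v, `|u| <= B -> `|v| <= B ->
      `|h (f u) - h (f v)| <= C * `|f u - f v|) ->
  loclip (fun u => h (f u)).
Proof.
move=> lf lh B; have [C C0 Hf] := lf B; have [D D0 Hh] := lh B.
exists (D * C); first exact: mulr_ge0.
by move=> u v uB vB; rewrite (le_trans (Hh _ _ uB vB))// -mulrA ler_wpM2l// Hf.
Qed.

Lemma loclip_expR f : loclip f -> loclip (fun u => expR (f u)).
Proof.
move=> lf; apply: loclip_comp => // B.
have [M M0 bf] := loclip_bounded lf B.
exists (expR M); first exact: expR_ge0.
have H (a b : R) : a <= b -> b <= M -> `|expR b - expR a| <= expR M * (b - a).
  move=> ab bM; apply: (@der_lipschitz R expR expR) => //.
    by move=> t /andP[_ tb]; rewrite ger0_norm ?expR_ge0// ler_expR (le_trans tb).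
move=> u v uB vB.
have uM := le_trans (ler_norm _) (bf _ uB); have vM := le_trans (ler_norm _) (bf _ vB).
have [uv|/ltW vu] := leP (f u) (f v).
  by rewrite distrC (distrC (f u)) (@ger0_norm _ (f v - f u)) ?subr_ge0// H.
by rewrite (@ger0_norm _ (f u - f v)) ?subr_ge0// H.
Qed.

Lemma loclipV f : loclip f -> (forall u, 0 < f u) -> loclip (fun u => (f u)^-1).
Proof.
move=> lf f0; apply: loclip_comp => // B.
have [m m0 Hm] := loclip_pos lf f0 B.
exists (m ^- 2); first by rewrite invr_ge0 exprn_ge0// ltW.
move=> u v uB vB.
have -> : (f u)^-1 - (f v)^-1 = - (f u - f v) / (f u * f v).
  by field; rewrite !gt_eqF.
rewrite normrM normrN mulrC ler_wpM2r// normrV ?unitfE ?gt_eqF ?mulr_gt0//.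
rewrite ger0_norm ?mulr_ge0 ?(ltW (f0 _))//.
by rewrite lef_pV2 ?posrE ?exprn_gt0 ?mulr_gt0// expr2 ler_pM ?Hm ?(ltW m0).
Qed.

Lemma loclip_div f g : loclip f -> loclip g -> (forall u, 0 < g u) ->
  loclip (fun u => f u / g u).
Proof. by move=> lf lg g0; apply: loclipM => //; exact: loclipV. Qed.

Lemma loclip_sqrt f : loclip f -> (forall u, 0 < f u) -> loclip (fun u => Num.sqrt (f u)).
Proof.
move=> lf f0; apply: (@loclip_comp f (@Num.sqrt R)) => // B.
have [m m0 Hm] := loclip_pos lf f0 B.
exists (Num.sqrt m)^-1; first by rewrite invr_ge0 sqrtr_ge0.
move=> u v uB vB; have mu := Hm _ uB; have mv := Hm _ vB.
have sm0 : 0 < Num.sqrt m by rewrite sqrtr_gt0.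
rewrite -{2}(sqr_sqrtr (ltW (f0 u))) -{2}(sqr_sqrtr (ltW (f0 v))).
rewrite subr_sqr normrM mulrCA ler_peMr// ler_pdivlMl// mulr1.
rewrite ger0_norm ?addr_ge0 ?sqrtr_ge0//.
by rewrite (le_trans (ler_wsqrtr mu))// lerDl sqrtr_ge0.
Qed.

(** Derivatives along straight lines only; with [loclip] components they imply a uniform quadratic
    remainder and thereby differentiability along curves. *)
Definition has_grad f (g : rV -> 'I_N -> R) := forall u w (t : R),
  der t (fun s => f (u + s *: w)) (\sum_j g (u + t *: w) j * w 0 j).

(** On the segment from u to v the gradient moves by at most a constant times |v - u|, so f minus
    its linear part at u has derivative of order |v - u|^2. *)
Lemma grad_quadratic f (g : rV -> 'I_N -> R) : has_grad f g -> (forall j, loclip (g ^~ j)) ->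
  forall B : R, exists2 C : R, 0 <= C & forall u v, `|u| <= B -> `|v| <= B ->
    `|f v - f u - \sum_j g u j * (v 0 j - u 0 j)| <= C * `|v - u| ^+ 2.
Proof.
move=> fg lg B.
have /boolp.choice[c Hc] : forall j, exists C : R, 0 <= C /\
   forall u v, `|u| <= B -> `|v| <= B -> `|g u j - g v j| <= C * `|u - v|.
  by move=> j; have [C C0 H] := lg j B; exists C.
pose D := \sum_j c j.
have D0 : 0 <= D by apply: sumr_ge0 => j _; case: (Hc j).
have cD j : c j <= D.
  by rewrite /D (bigD1 j)//= lerDl sumr_ge0// => k _; case: (Hc k).
exists (N%:R * D); first by rewrite mulr_ge0.
move=> u v uB vB; set w := v - u.
pose h (s : R) := f (u + s *: w) - \sum_j g u j * (s * w 0 j).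
have dh (s : R) : der s h (\sum_j (g (u + s *: w) j - g u j) * w 0 j).
  have dl : der s (fun s => \sum_j g u j * (s * w 0 j)) (\sum_j g u j * w 0 j).
    apply: der_sum => j _; apply: derMl.
    by apply: is_derive_eq (derM (der_id s) (der_cst s (w 0 j))) _; rewrite mul1r mulr0 addr0.
  apply: is_derive_eq (derB (fg u w s) dl) _.
  by rewrite -sumrB; apply: eq_bigr => j _; rewrite mulrBl.
have -> : f v - f u - \sum_j g u j * (v 0 j - u 0 j) = h 1 - h 0.
  have uw : u + w = v by rewrite addrC subrK.
  rewrite /h scale1r scale0r addr0 uw /w.
  rewrite (eq_bigr (fun j => g u j * (1 * (v - u) 0 j))); last first.
    by move=> j _; rewrite !mxE mul1r.
  rewrite [X in _ = _ - (_ - X)]big1 ?subr0; last by move=> j _; rewrite mul0r mulr0.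
  by rewrite addrAC.
have box (s : R) : 0 <= s <= 1 -> `|u + s *: w| <= B.
  move=> /andP[s0 s1]; have -> : u + s *: w = (1 - s) *: u + s *: v.
    by rewrite /w scalerBl scale1r scalerBr addrA addrAC.
  apply: (le_trans (ler_normD _ _)); rewrite !normrZ !ger0_norm ?subr_ge0//.
  have -> : B = (1 - s) * B + s * B by ring.
  by rewrite lerD// ler_wpM2l// subr_ge0.
have -> : N%:R * D * `|w| ^+ 2 = N%:R * D * `|w| ^+ 2 * (1 - 0) by rewrite subr0 mulr1.
apply: (der_lipschitz ler01 (fun s _ => dh s)) => s hs.
rewrite expr2 mulrA -(mulrA N%:R).
apply: sum_coord_le => j.
case: (Hc j) => cj0 H; apply: (le_trans (H _ _ (box _ hs) uB)).
rewrite addrAC subrr add0r normrZ; apply: ler_pM => //.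
by case/andP: hs => s0 s1; rewrite ler_piMl// ger0_norm.
Qed.

(** The remainder of f at [x t] is quadratic in [x s - x t], hence in s - t, and has derivative 0;
    the linear part is differentiated coordinatewise. *)
Lemma grad_chain f (g : rV -> 'I_N -> R) (x : R -> rV) (t : R) (X : 'I_N -> R) :
  has_grad f g -> (forall j, loclip (g ^~ j)) ->
  (forall i, der t (fun s => x s 0 i) (X i)) ->
  der t (fun s => f (x s)) (\sum_j g (x t) j * X j).
Proof.
move=> fg lg dx.
have /boolp.choice[p Hp] : forall i, exists p : R * R, [/\ 0 < p.1, 0 <= p.2 &
   forall s, `|s - t| < p.1 -> `|x s 0 i - x t 0 i| <= p.2 * `|s - t|].
  by move=> i; have [r [C H]] := der_locally_lipschitz (dx i); exists (r, C).
pose D := \sum_i (p i).2.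
have D0 : 0 <= D by apply: sumr_ge0 => j _; case: (Hp j).
have cD j : (p j).2 <= D.
  by rewrite /D (bigD1 j)//= lerDl sumr_ge0// => k _; case: (Hp k).
(* The cap at 1 keeps [x s] in the ball of radius |x t| + D on which the remainder is estimated. *)
pose r := \big[Num.min/1]_i (p i).1.
have r0 : 0 < r by apply: lt_bigmin => // i _; case: (Hp i).
have rp i : r <= (p i).1 by exact: bigmin_le.
have r1 : r <= 1 by exact: bigmin_le_id.
have lx s : `|s - t| < r -> `|x s - x t| <= D * `|s - t|.
  move=> st; apply/norm_leP; first by rewrite mulr_ge0.
  move=> i; rewrite !mxE; have [_ _ H] := Hp i.
  apply: (le_trans (H s (lt_le_trans st (rp i)))).
  by rewrite ler_wpM2r.
have [C C0 HC] := grad_quadratic fg lg (`|x t| + D).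
have dl : der t (fun s => \sum_j g (x t) j * x s 0 j) (\sum_j g (x t) j * X j).
  by apply: der_sum => j _; apply: derMl.
have dq : der t (fun s => f (x s) - \sum_j g (x t) j * x s 0 j) 0.
  apply: (@der_quadratic _ _ _ r (C * D ^+ 2)) => // s st.
  have -> : f (x s) - \sum_j g (x t) j * x s 0 j
     - (f (x t) - \sum_j g (x t) j * x t 0 j)
     = f (x s) - f (x t) - \sum_j g (x t) j * (x s 0 j - x t 0 j).
    rewrite [in RHS](eq_bigr (fun j => g (x t) j * x s 0 j - g (x t) j * x t 0 j)).
      by rewrite sumrB; ring.
    by move=> j _; rewrite mulrBr.
  apply: (le_trans (HC _ _ _ _)).
  - by rewrite lerDl.
  - rewrite -[x s](subrK (x t)) addrC (le_trans (ler_normD _ _))// lerD2l.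
    by rewrite (le_trans (lx _ st))// ler_piMr// ltW// (lt_le_trans st).
  - by rewrite -mulrA -exprMn ler_wpM2l// lerXn2r ?nnegrE ?lx// mulr_ge0.
have -> : (fun s => f (x s)) = (fun s => (f (x s) - \sum_j g (x t) j * x s 0 j)
   + \sum_j g (x t) j * x s 0 j).
  by apply/funext => s; rewrite subrK.
by apply: is_derive_eq (derD dq dl) _; rewrite add0r.
Qed.

Lemma grad_loclip f (g : rV -> 'I_N -> R) : has_grad f g -> (forall j, loclip (g ^~ j)) -> loclip f.
Proof.
move=> fg lg B; have [C C0 HC] := grad_quadratic fg lg B.
have /boolp.choice[c Hc] : forall j, exists C : R, 0 <= C /\
   forall u, `|u| <= B -> `|g u j| <= C.
  by move=> j; have [D D0 H] := loclip_bounded (lg j) B; exists D.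
pose D := \sum_j c j.
have D0 : 0 <= D by apply: sumr_ge0 => j _; case: (Hc j).
have cD j : c j <= D.
  by rewrite /D (bigD1 j)//= lerDl sumr_ge0// => k _; case: (Hc k).
exists (C * (`|B| + `|B|) + N%:R * D); first by rewrite addr_ge0 ?mulr_ge0 ?addr_ge0.
move=> u v uB vB.
rewrite -[f u - f v](subrK (\sum_j g v j * (u 0 j - v 0 j))) mulrDl.
apply: (le_trans (ler_normD _ _)); apply: lerD.
  apply: (le_trans (HC _ _ vB uB)); rewrite expr2 mulrA ler_wpM2r// ler_wpM2l//.
  apply: (le_trans (ler_normB _ _)); apply: lerD.
    by rewrite (le_trans uB)// ler_norm.
  by rewrite (le_trans vB)// ler_norm.
rewrite (eq_bigr (fun j => g v j * (u - v) 0 j)); last by move=> j _; rewrite !mxE.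
apply: sum_coord_le => j; case: (Hc j) => _ /(_ _ vB) /le_trans; exact.
Qed.

End RowVectors.

(** * Potentials and solutions of differential equations *)

Section Antiderivative.
Variable R : realType.
Local Notation der t f d := (is_derive (t : R) (1 : R) (f : R -> R) (d : R)).

(** Integration starts at -1 to have a two-sided derivative at time 0. *)
Lemma antiderivative_exists (f : R -> R) : continuous f ->
  exists F : R -> R, F 0 = 0 /\ forall t, -1 < t -> der t F (f t).
Proof.
move=> cf.
pose G (x : R) := (\int[lebesgue_measure]_(t in `[(-1 : R), x]) f t)%R.
exists (fun x => G x - G 0); split; first by rewrite subrr.
move=> t t1.
have [dG GE] : derivable G t 1 /\ derive1 G t = f t.
  apply: (@continuous_FTC1_closed R f (-1) t (t + 1)) => //; first by rewrite ltrDl.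
    apply: continuous_compact_integrable; first exact: segment_compact.
    exact: continuous_subspaceT.
  exact: cf.
have dG' : der t G (f t).
  by split; [exact: dG|rewrite -derive1E].
by apply: is_derive_eq (derB dG' (der_cst t (G 0))) _; rewrite subr0.
Qed.

Lemma lipschitz_continuous (f : R -> R) (K : R) :
  (forall s t, `|f s - f t| <= K * `|s - t|) -> continuous f.
Proof.
move=> lf t; apply/(@cvgrPdist_le _ _ _ (nbhs t)) => e e0.
have K0 : 0 < 1 + `|K| by rewrite ltr_pwDl.
have r0 : 0 < e / (1 + `|K|) by rewrite divr_gt0.
have := nbhsx_ballx t _ r0; apply: filterS => s; rewrite /ball/= => ts.
apply: (le_trans (lf _ _)); apply: (@le_trans _ _ ((1 + `|K|) * `|t - s|)).
  by rewrite ler_wpM2r// (le_trans (ler_norm _))// lerDr.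
by rewrite mulrC -ler_pdivlMr// ltW.
Qed.

Lemma le_of_half_pow (a b c : R) : 0 <= c ->
  (forall n, a <= b + c * 2^-1 ^+ n) -> a <= b.
Proof.
move=> c0 H; apply/ler_addgt0Pr => e e0.
have cv : (fun n => c * 2^-1 ^+ n) @ \oo --> c * (0 : R).
  apply: cvgM; first exact: cvg_cst.
  by apply: cvg_expr; rewrite ger0_norm// invf_lt1// ltr1n.
rewrite mulr0 in cv.
have /cvgrPdist_le /(_ _ e0)[n _ Hn] := cv.
apply: le_trans (H n) _; rewrite lerD2l.
by have := Hn n (leqnn n); rewrite /= sub0r normrN => /(le_trans (ler_norm _)).
Qed.

(** The intervals [y n - d n, y n + d n] are nested, and the limit is the supremum of their left
    ends. Steps bounded by d n - d n.+1 give the error bound together with the limit. *)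
Lemma limit_of_telescoping (y d : nat -> R) : (forall n, 0 <= d n) ->
  (forall n, `|y n.+1 - y n| <= d n - d n.+1) ->
  exists x, forall n, `|x - y n| <= d n.
Proof.
move=> d0 H.
have incr n m : (n <= m)%N -> y n - d n <= y m - d m.
  elim: m => [|m IH]; first by rewrite leqn0 => /eqP->.
  rewrite leq_eqVlt => /predU1P[->//|]; rewrite ltnS => /IH /le_trans; apply.
  by have := H m; rewrite ler_norml => /andP[]; lra.
have decr n m : (n <= m)%N -> y m + d m <= y n + d n.
  elim: m => [|m IH]; first by rewrite leqn0 => /eqP->.
  rewrite leq_eqVlt => /predU1P[->//|]; rewrite ltnS => /IH; apply: le_trans.
  by have := H m; rewrite ler_norml => /andP[]; lra.
have ub n m : y m - d m <= y n + d n.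
  have [nm|/ltnW mn] := leqP n m.
    by apply: le_trans (decr _ _ nm); have := d0 m; lra.
  by apply: le_trans (incr _ _ mn) _; have := d0 n; lra.
pose A : set R := [set z | exists m, z = y m - d m].
have hA : has_sup A.
  split; first by exists (y 0%N - d 0%N), 0%N.
  by exists (y 0%N + d 0%N) => _ [m ->].
exists (sup A) => n; rewrite ler_norml; apply/andP; split.
  have : y n - d n <= sup A by apply: sup_upper_bound => //; exists n.
  by lra.
have : sup A <= y n + d n by apply: ge_sup; [case: hA|move=> _ [m ->]].
by lra.
Qed.

End Antiderivative.

Section Clamp.
Variable R : realType.
Implicit Types a b c : R.

Lemma max_lip c a b : `|Num.max c a - Num.max c b| <= `|a - b|.
Proof.
have := ler_norm (a - b); have := ler_norm (b - a).
rewrite (distrC b) ler_norml; case: (leP c a); case: (leP c b) => *.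
all: by apply/andP; split; lra.
Qed.

Lemma min_lip c a b : `|Num.min c a - Num.min c b| <= `|a - b|.
Proof.
have := ler_norm (a - b); have := ler_norm (b - a).
rewrite (distrC b) ler_norml; case: (leP c a); case: (leP c b) => *.
all: by apply/andP; split; lra.
Qed.

End Clamp.

Section Families.
Variables (R : realType) (N : nat).
Local Notation rV := 'rV[R]_N.
Local Notation der t f d := (is_derive (t : R) (1 : R) (f : R -> R) (d : R)).

Lemma finite_bound (I : finType) (c : I -> R) : exists2 D : R, 0 <= D & forall i, c i <= D.
Proof.
exists (\sum_i `|c i|); first by apply: sumr_ge0.
by move=> i; rewrite (bigD1 i)//= (le_trans (ler_norm _))// lerDl sumr_ge0.
Qed.

Lemma loclip_family (I : finType) (f : I -> rV -> R) : (forall i, loclip (f i)) ->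
  forall B : R, exists2 C : R, 0 <= C & forall i (u v : rV), `|u| <= B -> `|v| <= B ->
    `|f i u - f i v| <= C * `|u - v|.
Proof.
move=> lf B.
have /boolp.choice[c Hc] : forall i, exists C : R, forall u v : rV,
    `|u| <= B -> `|v| <= B -> `|f i u - f i v| <= C * `|u - v|.
  by move=> i; have [C C0 H] := lf i B; exists C.
have [D D0 cD] := finite_bound c; exists D => // i u v uB vB.
by rewrite (le_trans (Hc i u v uB vB))// ler_wpM2r.
Qed.

(** Converse of [grad_quadratic]; it identifies the gradient of a potential defined by integrals. *)
Lemma quadratic_has_grad (f : rV -> R) (g : rV -> 'I_N -> R) :
  (forall B : R, exists C : R, forall u v, `|u| <= B -> `|v| <= B ->
    `|f v - f u - \sum_j g u j * (v 0 j - u 0 j)| <= C * `|v - u| ^+ 2) ->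
  has_grad f g.
Proof.
move=> H u w t; have [C HC] := H (`|u| + (`|t| + 1) * `|w|).
set d := \sum_j _.
have dl : der t (fun s => d * s) d.
  by apply: is_derive_eq (derMl d (der_id t)) _; rewrite mulr1.
have box (s : R) : `|s| <= `|t| + 1 -> `|u + s *: w| <= `|u| + (`|t| + 1) * `|w|.
  by move=> hs; rewrite (le_trans (ler_normD _ _))// lerD2l normrZ ler_wpM2r.
suff dq : der t (fun s => f (u + s *: w) - d * s) 0.
  have -> : (fun s => f (u + s *: w)) = (fun s => (f (u + s *: w) - d * s) + d * s).
    by apply/funext => s; rewrite subrK.
  by apply: is_derive_eq (derD dq dl) _; rewrite add0r.
apply: (@der_quadratic _ _ _ 1 (C * `|w| ^+ 2)) => // s st.
have -> : f (u + s *: w) - d * s - (f (u + t *: w) - d * t) =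
  f (u + s *: w) - f (u + t *: w)
   - \sum_j g (u + t *: w) j * ((u + s *: w) 0 j - (u + t *: w) 0 j).
  rewrite [X in _ = _ - X](eq_bigr (fun j => g (u + t *: w) j * w 0 j * (s - t))).
    by rewrite -mulr_suml -/d; ring.
  by move=> j _; rewrite !mxE; ring.
have -> : C * `|w| ^+ 2 * `|s - t| ^+ 2 = C * `|u + s *: w - (u + t *: w)| ^+ 2.
  by rewrite opprD addrACA subrr add0r -scalerBl normrZ exprMn; ring.
apply: HC; apply: box; first by rewrite lerDl.
rewrite -[s](subrK t) addrC (le_trans (ler_normD _ _))// lerD2l ltW//.
Qed.

(* Poincare lemma: [F u] integrates [phi] along the segment from 0 to [u]. *)
Lemma potential_exists (phi : 'I_N -> rV -> R) (g : 'I_N -> rV -> 'I_N -> R) :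
  (forall i, has_grad (phi i) (g i)) -> (forall i j, loclip (fun u => g i u j)) ->
  (forall i j u, g i u j = g j u i) ->
  exists F : rV -> R, has_grad F (fun u i => phi i u).
Proof.
move=> gphi lg sg.
have lphi i : loclip (phi i) by exact: grad_loclip (gphi i) (lg i).
have dray i (u : rV) (s : R) : der s (fun s => phi i (s *: u)) (\sum_j g i (s *: u) j * u 0 j).
  have := gphi i 0 u s; rewrite add0r.
  by rewrite (_ : (fun s => phi i (0 + _)) = (fun s => phi i (s *: u)))//; apply/funext => r; rewrite add0r.
pose h u s := \sum_i phi i (s *: u) * u 0 i.
have dh u (s : R) : der s (h u) (\sum_i (\sum_j g i (s *: u) j * u 0 j) * u 0 i).
  apply: der_sum => i _.
  by apply: is_derive_eq (derM (dray i u s) (der_cst s (u 0 i))) _; rewrite mulr0 addr0.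
have /boolp.choice[A HA] : forall u, exists F : R -> R, F 0 = 0 /\
    forall t, -1 < t -> der t F (h u t).
  move=> u; apply: antiderivative_exists => s; exact: der_continuous (dh u s).
exists (fun u => A u 1); apply: quadratic_has_grad => B0.
pose B := Num.max B0 0.
have B_0 : 0 <= B by rewrite le_max lexx orbT.
have [C1 C10 H1] := loclip_family lphi B.
have /boolp.choice[c Hc] : forall i, exists C : R, forall u v : rV,
    `|u| <= B -> `|v| <= B ->
    `|phi i v - phi i u - \sum_j g i u j * (v 0 j - u 0 j)| <= C * `|v - u| ^+ 2.
  by move=> i; have [C C0 H] := grad_quadratic (gphi i) (lg i) B; exists C.
have [C2 C20 cC2] := finite_bound c.
exists (N%:R * C2 * B + N%:R * C1) => u v uB0 vB0.
have uB : `|u| <= B by rewrite le_max uB0.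
have vB : `|v| <= B by rewrite le_max vB0.
pose w := v - u.
(* At s = 1 this is the Taylor remainder of the potential, and it vanishes at s = 0. Its derivative
   contains only second order terms: Taylor remainders of the [phi i], and increments of the [phi i]
   times w. *)
pose psi (s : R) := A v s - A u s - s * (\sum_i phi i (s *: u) * w 0 i).
have dpsi (s : R) : 0 <= s <= 1 -> der s psi
   (\sum_i (phi i (s *: v) - phi i (s *: u) - \sum_j g i (s *: u) j * (s * w 0 j)) * u 0 i
    + \sum_i (phi i (s *: v) - phi i (s *: u)) * w 0 i).
  move=> /andP[s0 _].
  have s1 : -1 < s by rewrite (lt_le_trans _ s0)// ltrN10.
  have dw : der s (fun s => \sum_i phi i (s *: u) * w 0 i)
      (\sum_i (\sum_j g i (s *: u) j * u 0 j) * w 0 i).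
    apply: der_sum => i _.
    by apply: is_derive_eq (derM (dray i u s) (der_cst s (w 0 i))) _; rewrite mulr0 addr0.
  apply: is_derive_eq (derB (derB ((HA v).2 s s1) ((HA u).2 s s1)) (derM (der_id s) dw)) _.
  rewrite mul1r /h.
  (* The symmetry of g exchanges the roles of u and w. *)
  have -> : s * (\sum_i (\sum_j g i (s *: u) j * u 0 j) * w 0 i)
      = \sum_i (\sum_j g i (s *: u) j * (s * w 0 j)) * u 0 i.
    under eq_bigr do rewrite mulr_suml.
    rewrite exchange_big mulr_sumr /=; apply: eq_bigr => j _.
    rewrite mulr_sumr mulr_suml; apply: eq_bigr => i _.
    by rewrite (sg j i); ring.
  have -> : \sum_i (phi i (s *: v) - phi i (s *: u) - \sum_j g i (s *: u) j * (s * w 0 j)) * u 0 i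
    = \sum_i (phi i (s *: v) - phi i (s *: u)) * u 0 i
      - \sum_i (\sum_j g i (s *: u) j * (s * w 0 j)) * u 0 i.
    by rewrite -sumrB; apply: eq_bigr => i _; rewrite mulrBl.
  have -> : \sum_i phi i (s *: v) * v 0 i
     = \sum_i phi i (s *: v) * u 0 i + \sum_i phi i (s *: v) * w 0 i.
    by rewrite -big_split; apply: eq_bigr => i _ /=; rewrite !mxE; ring.
  under [X in _ = X - _ + _]eq_bigr do rewrite mulrBl.
  under [X in _ = _ + X]eq_bigr do rewrite mulrBl.
  by rewrite !sumrB; ring.
have -> : A v 1 - A u 1 - \sum_j phi j u * (v 0 j - u 0 j) = psi 1 - psi 0.
  rewrite /psi !(HA _).1 mul0r mul1r scale1r !subr0; congr (_ - _).
  by apply: eq_bigr => j _; rewrite !mxE.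
rewrite -[leRHS]mulr1 -[X in _ * X](subr0 1).
apply: der_lipschitz ler01 dpsi _ => s /andP[s0 s1].
have su : `|s *: u| <= B by rewrite normrZ ger0_norm// (le_trans _ uB)// ler_piMl.
have sv : `|s *: v| <= B by rewrite normrZ ger0_norm// (le_trans _ vB)// ler_piMl.
have swE : s *: v - s *: u = s *: w by rewrite scalerBr.
have sw : `|s *: w| <= `|w| by rewrite normrZ ger0_norm// ler_piMl.
apply: (le_trans (ler_normD _ _)); rewrite mulrDl; apply: lerD.
  apply: (@le_trans _ _ (N%:R * (C2 * `|w| ^+ 2) * `|u|)).
    apply: sum_coord_le => i.
    rewrite (eq_bigr (fun j => g i (s *: u) j * ((s *: v) 0 j - (s *: u) 0 j))); last first.
      by move=> j _; rewrite !mxE; ring.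
    apply: le_trans (Hc i _ _ su sv) _; rewrite swE.
    apply: (@le_trans _ _ (C2 * `|s *: w| ^+ 2)); first by rewrite ler_wpM2r ?exprn_ge0.
    by rewrite ler_wpM2l// lerXn2r ?nnegrE.
  have -> : N%:R * C2 * B * `|v - u| ^+ 2 = N%:R * (C2 * `|w| ^+ 2) * B.
    by rewrite -/w; ring.
  by rewrite ler_wpM2l// !mulr_ge0// ?exprn_ge0.
apply: (@le_trans _ _ (N%:R * (C1 * `|w|) * `|w|)).
  apply: sum_coord_le => i; apply: (le_trans (H1 i _ _ sv su)).
  by rewrite swE ler_wpM2l.
by rewrite expr2 !mulrA.
Qed.

End Families.

(** * Picard iteration for bounded, globally Lipschitz fields *)

Section Picard.
Variables (R : realType) (N : nat).
Local Notation rV := 'rV[R]_N.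
Local Notation der t f d := (is_derive (t : R) (1 : R) (f : R -> R) (d : R)).
Variables (X : rV -> rV) (L M : R).
Hypotheses (L0 : 0 < L) (M0 : 0 <= M).
Hypothesis lipX : forall u v, `|X u - X v| <= L * `|u - v|.
Hypothesis bndX : forall u, `|X u| <= M.

(** Extends curves constantly to negative times: iterates are controlled for t >= 0 only, whereas a
    two-sided derivative at 0 needs an integrand on both sides. *)
Let clock (t : R) := Num.max t 0.

Lemma clock_lip (s t : R) : `|clock s - clock t| <= `|s - t|.
Proof. by rewrite /clock !(maxC _ 0); exact: max_lip. Qed.

Lemma picard_step (y : R -> rV) u0 :
  (forall s t, 0 <= s -> 0 <= t -> `|y t - y s| <= M * `|t - s|) ->
  exists z : R -> rV, [/\ z 0 = u0,
    forall t, -1 < t -> forall i, der t (fun s => z s 0 i) (X (y (clock t)) 0 i) &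
    forall s t, 0 <= s -> 0 <= t -> `|z t - z s| <= M * `|t - s|].
Proof.
move=> ly.
have cy i : continuous (fun t => X (y (clock t)) 0 i).
  apply: (@lipschitz_continuous _ _ (L * M)) => s t.
  have := coord_le_norm (X (y (clock s)) - X (y (clock t))) i; rewrite !mxE.
  move=> /le_trans; apply; apply: (le_trans (lipX _ _)); rewrite -mulrA.
  rewrite ler_pM2l//; apply: (le_trans (ly _ _ _ _)); rewrite ?le_max ?lexx ?orbT//.
  by rewrite ler_wpM2l// clock_lip.
have /boolp.choice[F HF] : forall i, exists F : R -> R, F 0 = 0 /\
    forall t, -1 < t -> der t F (X (y (clock t)) 0 i).
  by move=> i; exact: antiderivative_exists.
pose z t : rV := \row_i (u0 0 i + F i t).
have dz t : -1 < t -> forall i, der t (fun s => z s 0 i) (X (y (clock t)) 0 i).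
  move=> t1 i; rewrite (_ : (fun s => _) = (fun s => u0 0 i + F i s)).
    by apply: is_derive_eq (derD (der_cst t (u0 0 i)) ((HF i).2 t t1)) _; rewrite add0r.
  by apply/funext => s; rewrite mxE.
exists z; split=> //; first by apply/rowP => i; rewrite mxE (HF i).1 addr0.
have W s t : 0 <= s -> s <= t -> `|z t - z s| <= M * `|t - s|.
  move=> s0 st; apply/norm_leP; first by rewrite mulr_ge0.
  move=> i; rewrite [X in `|X|]mxE [X in _ + X]mxE (@ger0_norm _ (t - s)) ?subr_ge0//.
  apply: (@der_lipschitz R (fun r => z r 0 i) (fun r => X (y (clock r)) 0 i)) => //.
    by move=> r /andP[sr _]; apply: dz; rewrite (lt_le_trans _ sr)// (lt_le_trans _ s0)// ltrN10.
  by move=> r _; rewrite (le_trans (coord_le_norm _ _)).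
move=> s t s0 t0; have [st|/ltW ts] := leP s t; first exact: W.
by rewrite distrC (distrC t); exact: W.
Qed.

Lemma picard (u0 : rV) : exists x : R -> rV, x 0 = u0 /\
  forall t, 0 <= t -> forall i, der t (fun s => x s 0 i) (X (x t) 0 i).
Proof.
pose good (y : R -> rV) := forall s t : R, 0 <= s -> 0 <= t -> `|y t - y s| <= M * `|t - s| :> R.
(* P is the Picard map as a total function, specified on [good] curves only. *)
have /boolp.choice[P HP] : forall y : R -> rV, exists z : R -> rV, good y ->
    [/\ z 0 = u0, forall t, -1 < t -> forall i, der t (fun s => z s 0 i) (X (y (clock t)) 0 i) & good z].
  move=> y; have [gy|ngy] := pselect (good y); last by exists y.
  by have [z Hz] := picard_step u0 gy; exists z.
pose y n := iter n P (fun=> u0).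
have gy n : good (y n).
  elim: n => [|n IH]; last by have [] := HP _ IH.
  by move=> s t _ _; rewrite subrr normr0 mulr_ge0.
have y0 n : y n 0 = u0 by case: n => // n; have [] := HP _ (gy n).
have dy n t : -1 < t -> forall i, der t (fun s => y n.+1 s 0 i) (X (y n (clock t)) 0 i).
  by have [_ H _] := HP _ (gy n); exact: H.
have clockE t : 0 <= t -> clock t = t by move=> t0; rewrite /clock max_l.
have gt1 (t : R) : 0 <= t -> -1 < t by move=> t0; rewrite (lt_le_trans _ t0)// ltrN10.
(* M t <= (M / L) e^(2Lt) bounds the distance of the first two iterates. *)
pose K := M / L.
have K0 : 0 <= K by rewrite divr_ge0// ltW.
(* In the norm weighted by e^(-2Lt) the Picard map contracts by 1/2 on the whole half-line, so the
   solution is global at once. *)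
pose E (t : R) := expR (2 * L * t).
have E0 t : 0 <= E t by exact: expR_ge0.
have dE (c t : R) : der t (fun s => c * E s) (c * (2 * L) * E t).
  apply: is_derive_eq (derMl c (der_expR (derMl (2 * L) (der_id t)))) _.
  by rewrite /E; ring.
(* Gronwall-type step: a bound c e^(2Lt) on the distance of two inputs improves
   to (c/2) e^(2Lt) on the outputs *)
have contr (a b p q : R -> rV) (c : R) : 0 <= c -> p 0 = q 0 ->
    (forall t, 0 <= t -> forall i, der t (fun s => p s 0 i) (X (a t) 0 i)) ->
    (forall t, 0 <= t -> forall i, der t (fun s => q s 0 i) (X (b t) 0 i)) ->
    (forall t, 0 <= t -> `|a t - b t| <= c * E t) ->
    forall t, 0 <= t -> `|p t - q t| <= c / 2 * E t.
  move=> c0 pq dp dq ab t t0; apply/norm_leP; first by rewrite mulr_ge0// divr_ge0.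
  move=> i; rewrite [X in `|X|]mxE [X in _ + X]mxE.
  have := @der_bound R (fun s => p s 0 i - q s 0 i)
     (fun s => X (a s) 0 i - X (b s) 0 i) (fun s => c / 2 * E s)
     (fun s => c / 2 * (2 * L) * E s) 0 t t0.
  rewrite pq subrr subr0 => /(_ _ _ _)/le_trans; apply.
  - by move=> s /andP[s0 _]; apply: derB; [exact: dp|exact: dq].
  - move=> s /andP[s0 _].
    have := coord_le_norm (X (a s) - X (b s)) i; rewrite !mxE => /le_trans; apply.
    apply: (le_trans (lipX _ _)).
    have -> : c / 2 * (2 * L) * E s = L * (c * E s) by field.
    by rewrite ler_pM2l// ab.
  - by rewrite gerBl mulr_ge0// divr_ge0.
have dist n t : 0 <= t -> `|y n.+1 t - y n t| <= K * 2^-1 ^+ n * E t.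
  elim: n t => [|n IH] t t0.
    have := gy 1%N 0 t (lexx _) t0; rewrite (y0 1%N) -(y0 0%N) => /le_trans; apply.
    rewrite expr0 mulr1 subr0 ger0_norm// /K -mulrA ler_wpM2l//.
    rewrite ler_pdivlMl//; apply: le_trans (expR_ge1Dx _).
    have : 0 <= L * t by rewrite mulr_ge0// ltW.
    by rewrite -mulrA; lra.
  have -> : K * 2^-1 ^+ n.+1 = K * 2^-1 ^+ n / 2 by rewrite exprSr; ring.
  apply: (contr (y n.+1) (y n)) => //.
  - by rewrite mulr_ge0// exprn_ge0.
  - by rewrite !y0.
  - by move=> s s0 i; have := dy n.+1 s (gt1 _ s0) i; rewrite clockE.
  - by move=> s s0 i; have := dy n s (gt1 _ s0) i; rewrite clockE.
(* The tail, from n on, of the geometric series that bounds the distances of successive iterates. *)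
pose d n t := 2 * K * 2^-1 ^+ n * E t.
have p0 n : 0 <= 2 * K * 2^-1 ^+ n by apply: mulr_ge0; [exact: mulr_ge0|apply: exprn_ge0; rewrite invr_ge0].
have d0 n t : 0 <= d n t by exact: mulr_ge0.
have KE t : 0 <= 2 * K * E t by apply: mulr_ge0 => //; exact: mulr_ge0.
have /boolp.choice[x Hx] : forall t, exists x : rV, 0 <= t -> forall n, `|x - y n t| <= d n t.
  move=> t; have [t0|tn] := pselect (0 <= t); last by exists 0.
  have /boolp.choice[c Hc] : forall i, exists c : R, forall n, `|c - y n t 0 i| <= d n t.
    move=> i; apply: limit_of_telescoping => n; first exact: d0.
    have := coord_le_norm (y n.+1 t - y n t) i; rewrite !mxE => /le_trans; apply.
    apply: (le_trans (dist _ _ t0)); rewrite le_eqVlt; apply/orP; left; apply/eqP.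
    by rewrite /d exprS; field.
  exists (\row_i c i) => _ n; apply/norm_leP; first exact: d0.
  by move=> i; rewrite !mxE.
have gx : good x.
  move=> s t s0 t0; apply: (@le_of_half_pow _ _ _ (2 * K * E t + 2 * K * E s)).
    exact: addr_ge0.
  move=> n.
  have -> : x t - x s = (x t - y n t) + (y n t - y n s) + (y n s - x s).
    by apply/rowP => i; rewrite !mxE; ring.
  apply: (le_trans (ler_normD _ _)); apply: (le_trans (lerD (ler_normD _ _) (lexx _))).
  have := Hx t t0 n; have := Hx s s0 n; have := gy n s t s0 t0.
  by rewrite (distrC (y n s)) /d; lra.
have [z0 dz gz] := HP x gx.
have zx t : 0 <= t -> P x t = x t.
  move=> t0; apply/eqP; rewrite -subr_eq0 -normr_le0; apply/eqP.
  apply/eqP; apply: (@le_of_half_pow _ _ _ (2 * K * E t)); first exact: KE.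
  move=> n; rewrite add0r.
  have -> : P x t - x t = (P x t - y n.+1 t) + (y n.+1 t - x t) by rewrite addrA subrK.
  apply: (le_trans (ler_normD _ _)).
  have := Hx t t0 n.+1; rewrite (distrC (x t)).
  have : `|P x t - y n.+1 t| <= 2 * K * 2^-1 ^+ n / 2 * E t.
    apply: (contr x (y n)) => //.
    - by rewrite y0.
    - by move=> s s0 i; have := dz s (gt1 _ s0) i; rewrite clockE.
    - by move=> s s0 i; have := dy n s (gt1 _ s0) i; rewrite clockE.
    - by move=> s s0; exact: Hx.
  rewrite /d exprS.
  set k := 2^-1 ^+ n; move=> h1 h2; apply: (le_trans (lerD h1 h2)).
  by rewrite le_eqVlt; apply/orP; left; apply/eqP; field.
exists (P x); split=> // t t0 i; have := dz t (gt1 _ t0) i.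
by rewrite clockE// zx.
Qed.

End Picard.

(** * Flows dissipating a convex potential *)

Section ConvexPotential.
Variables (R : realType) (N : nat).
Local Notation rV := 'rV[R]_N.
Local Notation der t f d := (is_derive (t : R) (1 : R) (f : R -> R) (d : R)).
Local Notation ones := (const_mx 1 : 'rV[R]_N).
Implicit Types u v w : rV.

Variables (phi : 'I_N -> rV -> R) (g : 'I_N -> rV -> 'I_N -> R).
Hypothesis gphi : forall i, has_grad (phi i) (g i).
Hypothesis lg : forall i j, loclip (fun u => g i u j).
Hypothesis g_psd : forall u (w : rV), 0 <= \sum_i (\sum_j g i u j * w 0 j) * w 0 i.
Hypothesis g_ker : forall u (w : rV), \sum_i (\sum_j g i u j * w 0 j) * w 0 i = 0 ->
  forall i j, w 0 i = w 0 j.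
Hypothesis phi_sum0 : forall u : rV, \sum_i phi i u = 0.

Variable F : rV -> R.
Hypothesis gF : has_grad F (fun u i => phi i u).

Lemma phi_loclip i : loclip (phi i).
Proof. exact: grad_loclip (gphi i) (lg i). Qed.

Lemma F_loclip : loclip F.
Proof. by apply: grad_loclip gF _ => i; exact: phi_loclip. Qed.

Lemma F_continuous : continuous F.
Proof. exact: loclip_continuous F_loclip. Qed.

Lemma der_phi_line u (w : rV) (t : R) :
  der t (fun s => \sum_i phi i (u + s *: w) * w 0 i)
    (\sum_i (\sum_j g i (u + t *: w) j * w 0 j) * w 0 i).
Proof.
apply: der_sum => i _.
by apply: is_derive_eq (derM (gphi i u w t) (der_cst t (w 0 i))) _; rewrite mulr0 addr0.
Qed.

Lemma F_shift u (c : R) : F (u + c *: ones) = F u.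
Proof.
have [d dE E] : exists2 d : R, d = 0 & F (u + 1 *: (c *: ones)) - F (u + 0 *: (c *: ones)) = d.
  have [s _ E] := MVT_der ler01 (fun t _ => gF u (c *: ones) t).
  eexists; last exact: E.
  rewrite subr0 mulr1 (eq_bigr (fun i => phi i (u + s *: (c *: ones)) * c)); last first.
    by move=> i _; rewrite !mxE mulr1.
  by rewrite -mulr_suml phi_sum0 mul0r.
by move: E; rewrite dE scale1r scale0r addr0 => /eqP; rewrite subr_eq0 => /eqP.
Qed.

Lemma F_convex u v : F u + \sum_i phi i u * (v 0 i - u 0 i) <= F v.
Proof.
pose w := v - u.
have [s /andP[s0 _] E] := MVT_der ler01 (fun t _ => gF u w t).
have uw : u + w = v by rewrite addrC subrK.
move: E; rewrite scale1r scale0r addr0 subr0 mulr1 uw => E.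
have := @der_nondecreasing R _ _ 0 s s0 (fun t _ => der_phi_line u w t).
move=> /(_ (fun t _ => g_psd _ _)); rewrite scale0r addr0 => H.
have -> : \sum_i phi i u * (v 0 i - u 0 i) = \sum_i phi i u * w 0 i.
  by apply: eq_bigr => i _; rewrite !mxE.
by rewrite -lerBrDl E.
Qed.

Lemma zero_phi_min u : (forall i, phi i u = 0) -> forall v : rV, F u <= F v.
Proof.
move=> u0 v; apply: le_trans (F_convex u v).
by rewrite big1 ?addr0// => i _; rewrite u0 mul0r.
Qed.

Lemma min_zero_phi u : (forall v : rV, F u <= F v) -> forall i, phi i u = 0.
Proof.
move=> hmin i; pose w : rV := delta_mx 0 i.
have d := gF u w 0.
have dE : \sum_j phi j (u + 0 *: w) * w 0 j = phi i u.
  rewrite scale0r addr0 (bigD1 i)//= big1 ?addr0; last first.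
    by move=> j ji; rewrite !mxE (negbTE ji) andbF mulr0.
  by rewrite !mxE !eqxx mulr1.
rewrite dE in d.
have d0 : der 0 (fun s => F (u + s *: w)) 0.
  apply: (@derive1_at_min R (fun s => F (u + s *: w)) (-1) 1 0).
  - by rewrite (le_trans _ ler01)// lerN10.
  - by move=> t _; have [] := gF u w t.
  - by rewrite in_itv/= ltrN10 ltr01.
  - by move=> t _; rewrite scale0r addr0.
by have [_ <-] := d; have [_ ->] := d0.
Qed.

(** On the segment, phi paired with v - u vanishes at both ends, so its derivative, the quadratic
    form of g at v - u, vanishes in between, and [g_ker] applies. *)
Lemma zero_phi_unique u v : (forall i, phi i u = 0) -> (forall i, phi i v = 0) ->
  forall i j, v 0 i - u 0 i = v 0 j - u 0 j.
Proof.
move=> u0 v0; pose w := v - u.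
have uw : u + w = v by rewrite addrC subrK.
have [s _] := MVT_der ler01 (fun t _ => der_phi_line u w t).
rewrite scale1r scale0r addr0 uw subr0 mulr1 big1; last by move=> i _; rewrite v0 mul0r.
rewrite big1 ?subr0; last by move=> i _; rewrite u0 mul0r.
by move=> /esym/g_ker H i j; have := H i j; rewrite !mxE.
Qed.

Hypothesis N0 : (0 < N)%N.
Let i0 : 'I_N := Ordinal N0.

Lemma extremal_exists (u : rV) : exists i j, forall k, u 0 j <= u 0 k <= u 0 i.
Proof.
have [i _ Hi] := @Order.TotalTheory.arg_maxP _ R _ i0 xpredT (fun i => u 0 i) isT.
have [j _ Hj] := @Order.TotalTheory.arg_minP _ R _ i0 xpredT (fun i => u 0 i) isT.
by exists i, j => k; apply/andP; split; [exact: Hj|exact: Hi].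
Qed.

Variables (c C : R).
Hypotheses (c0 : 0 < c).
Hypothesis coercive : forall (u : rV) i j,
  c * (u 0 i - u 0 j) - C <= \sum_k phi k u * u 0 k.

(** Once the spread reaches T, coercivity bounds phi(v) paired with v below by 1. Convexity then
    makes F grow linearly along the ray, from a value bounded below. *)
Lemma F_sublevel_spread (a : R) : exists2 S : R, 0 <= S & forall u : rV, F u <= a ->
  forall i j, u 0 i - u 0 j <= S.
Proof.
(* Chosen so that c T - C >= 1. *)
pose T := (`|C| + 1) / c.
have T0 : 0 < T by rewrite divr_gt0// ltr_wpDl.
have [K K0 HK] := loclip_bounded F_loclip T.
exists (T * (1 + `|a| + K)); first by rewrite mulr_ge0 ?(ltW T0)// !addr_ge0.
move=> u ua i' j'; have [i [j ext]] := extremal_exists u.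
set S := u 0 i - u 0 j.
have SS : u 0 i' - u 0 j' <= S by have /andP[_ ?] := ext i'; have /andP[? _] := ext j'; rewrite lerB.
apply: (le_trans SS).
have [ST|TS] := leP S T.
  by rewrite (le_trans ST)// ler_peMr ?(ltW T0)// -addrA lerDl addr_ge0.
have S0 : 0 < S by exact: lt_trans TS.
(* s u is the point of spread T on the ray through u. *)
pose s := T / S; have s0 : 0 < s by rewrite divr_gt0.
have s1 : s < 1 by rewrite ltr_pdivrMr// mul1r.
pose v := s *: u.
have cv := coercive v i j.
have vS : v 0 i - v 0 j = T by rewrite !mxE -mulrBr -/S /s divfK// gt_eqF.
have cT : c * T = `|C| + 1 by rewrite /T mulrC divfK// gt_eqF.
have pos : 1 <= \sum_k phi k v * v 0 k.
  by apply: le_trans cv; rewrite vS cT; have := ler_norm C; lra.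
have Fu := F_convex v u.
have E : \sum_k phi k v * (u 0 k - v 0 k) = (s^-1 - 1) * \sum_k phi k v * v 0 k.
  rewrite mulr_sumr; apply: eq_bigr => k _; rewrite !mxE; field.
  by rewrite gt_eqF.
(* A scaling brings v into the ball of radius T, where |F| is at most K, without changing F. *)
have Fv : - K <= F v.
  rewrite -(F_shift v (- v 0 j)).
  have := HK (v + - v 0 j *: ones); rewrite ler_norml => H.
  have /H/andP[] // : `|v + - v 0 j *: ones| <= T.
  apply/norm_leP; first exact: ltW.
  move=> k; have /andP[h1 h2] := ext k.
  have -> : (v + - v 0 j *: ones) 0 k = s * (u 0 k - u 0 j) by rewrite !mxE; ring.
  rewrite normrM (gtr0_norm s0) ger0_norm ?subr_ge0//.
  rewrite /s mulrAC ler_pdivrMr// ler_pM2l//.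
  by rewrite /S lerB.
have : s^-1 - 1 <= a + K.
  have : s^-1 - 1 <= (s^-1 - 1) * \sum_k phi k v * v 0 k.
    by rewrite ler_peMr// subr_ge0 invf_ge1// ltW.
  by rewrite E in Fu; lra.
rewrite /s invf_div => H.
have : S / T <= 1 + `|a| + K by have := ler_norm a; lra.
by rewrite ler_pdivrMr// mulrC.
Qed.

Lemma zero_phi_exists : exists u : rV, forall i, phi i u = 0.
Proof.
have [S S0 HS] := F_sublevel_spread (F 0).
pose A : set rV := [set u | `|u| <= S] `&` setT.
have [|||us _ H] := @EVT_min_rV R N F A.
- by exists 0; split => //=; rewrite normr0.
- exact: compact_box_inter closedT.
- by apply: continuous_subspaceT; exact: F_continuous.
exists us; apply: min_zero_phi => v.
pose v' := v + - v 0 i0 *: ones.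
have -> : F v = F v' by rewrite F_shift.
have F0 : F us <= F 0 by apply: H; rewrite inE; split => //=; rewrite normr0.
have [vs|/ltW/(le_trans F0)//] := leP (F v') (F 0).
apply: H; rewrite inE; split=> //=; apply/norm_leP => // k.
have v'0 : v' 0 i0 = 0 by rewrite !mxE; ring.
have := HS _ vs k i0; have := HS _ vs i0 k; rewrite v'0 => h1 h2.
by rewrite ler_norml; apply/andP; split; lra.
Qed.

(** * Existence and convergence of dissipative flows with a conserved sum *)

Section Flow.
Variables (X : 'I_N -> rV -> R) (beta : R).
Hypothesis lX : forall i, loclip (X i).
Hypothesis dissipative : forall u : rV, \sum_i phi i u * X i u <= 0.
Hypothesis dissipative_eq0 : forall u : rV, \sum_i phi i u * X i u = 0 -> forall i, phi i u = 0.
Hypothesis conserved : forall u : rV, \sum_i expR (beta * u 0 i) * X i u = 0.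

(* An increasing antiderivative of [exp (beta s)], so that [conserved] says that
   [invariant_sum] is constant along the flow. *)
Definition density (s : R) : R := if beta == 0 then s else expR (beta * s) / beta.
Definition invariant_sum (u : rV) : R := \sum_i density (u 0 i).

Lemma der_density (s : R) : der s density (expR (beta * s)).
Proof.
rewrite /density; have [->|b0] := eqVneq beta 0.
  by rewrite mul0r expR0; exact: der_id.
apply: is_derive_eq (derM (der_expR (derMl beta (der_id s))) (der_cst s beta^-1)) _.
by field.
Qed.

Lemma density_lt (s t : R) : s < t -> density s < density t.
Proof.
move=> st; have [r _ E] := MVT_der (ltW st) (fun r _ => der_density r).
by rewrite -subr_gt0 E mulr_gt0 ?expR_gt0// subr_gt0.
Qed.

Lemma density_le (s t : R) : s <= t -> density s <= density t.
Proof. by rewrite le_eqVlt => /predU1P[->//|/density_lt/ltW]. Qed.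

Lemma invariant_sum_continuous : continuous invariant_sum.
Proof.
apply: loclip_continuous; apply: loclip_sum => i _; rewrite /density.
case: eqVneq => _; first exact: loclip_coord.
apply: loclipM; last exact: loclip_cst.
by apply: loclip_expR; apply: loclipM; [exact: loclip_cst|exact: loclip_coord].
Qed.

Lemma invariant_sum_le u v : (forall i, u 0 i <= v 0 i) -> invariant_sum u <= invariant_sum v.
Proof. by move=> h; apply: ler_sum => i _; exact: density_le. Qed.

Lemma invariant_sum_lt u v : (forall i, u 0 i < v 0 i) -> invariant_sum u < invariant_sum v.
Proof.
move=> h; rewrite /invariant_sum (bigD1 i0)//= [ltRHS](bigD1 i0)//= ltr_leD ?density_lt//.
by apply: ler_sum => i _; apply: density_le; exact: ltW.
Qed.

(** The spread of u is at most S. A coordinate beyond |u0| + S in absolute value would put all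
    coordinates of u strictly on one side of those of u0, and [invariant_sum] would differ. *)
Lemma trapped (u0 : rV) : exists2 B : R, 0 <= B &
  forall u : rV, F u <= F u0 -> invariant_sum u = invariant_sum u0 -> `|u| <= B.
Proof.
have [S S0 HS] := F_sublevel_spread (F u0).
exists (`|u0| + S); first by rewrite addr_ge0.
move=> u /HS uS uG; apply/norm_leP; first by rewrite addr_ge0.
move=> k; rewrite ler_norml; apply/andP; split; rewrite leNgt; apply/negP => h.
- suff : invariant_sum u < invariant_sum u0 by rewrite uG ltxx.
  apply: invariant_sum_lt => i; have := uS i k; have := coord_le_norm u0 i.
  by rewrite ler_norml => /andP[]; lra.
- suff : invariant_sum u0 < invariant_sum u by rewrite uG ltxx.
  apply: invariant_sum_lt => i; have := uS k i; have := coord_le_norm u0 i.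
  by rewrite ler_norml => /andP[]; lra.
Qed.

(** The projection onto a box, 1-Lipschitz: precomposing the field with it makes the field bounded
    and globally Lipschitz. *)
Definition clamp (B : R) (u : rV) : rV := \row_i Num.max (- B) (Num.min B (u 0 i)).

Lemma clamp_norm (B : R) u : 0 <= B -> `|clamp B u| <= B.
Proof.
move=> B0; apply/norm_leP => // i; rewrite mxE ler_norml.
by rewrite le_max lexx/= ge_max ge_min lexx andbT; lra.
Qed.

Lemma clamp_id (B : R) u : `|u| <= B -> clamp B u = u.
Proof.
move=> uB; apply/rowP => i; rewrite mxE.
have := le_trans (coord_le_norm u i) uB; rewrite ler_norml => /andP[h1 h2].
by rewrite min_r// max_r.
Qed.

Lemma clamp_lip (B : R) u v : `|clamp B u - clamp B v| <= `|u - v|.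
Proof.
apply/norm_leP => // i; have := coord_le_norm (u - v) i; rewrite !mxE.
move=> uv; apply: le_trans (max_lip _ _ _) _.
exact: le_trans (min_lip _ _ _) uv.
Qed.

Lemma flow_exists (u0 : rV) : exists x : R -> rV, exists2 B : R, 0 <= B & [/\ x 0 = u0,
  forall t, 0 <= t -> forall i, der t (fun s => x s 0 i) (X i (x t)),
  forall t, 0 <= t -> `|x t| <= B,
  forall t, 0 <= t -> invariant_sum (x t) = invariant_sum u0 &
  forall s t, 0 <= s -> s <= t -> F (x t) <= F (x s)].
Proof.
have [B B0 trap] := trapped u0.
(* One unit of room around the a priori ball; up to radius B1 the truncated field is the true
   one. *)
pose B1 := B + 1; have B10 : 0 <= B1 by rewrite addr_ge0.
pose Y (u : rV) : rV := \row_i X i (clamp B1 u).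
have [L L0 HL] := loclip_family lX B1.
have [M M0 HM] : exists2 M : R, 0 <= M & forall i (u : rV), `|u| <= B1 -> `|X i u| <= M.
  have /boolp.choice[m Hm] : forall i, exists M : R, forall u : rV, `|u| <= B1 -> `|X i u| <= M.
    by move=> i; have [m m0 H] := loclip_bounded (lX i) B1; exists m.
  have [M M0 HM] := finite_bound m; exists M => // i u uB.
  exact: le_trans (Hm i u uB) (HM i).
have [|u v|u|x [x0 dx]] := @picard R N Y (L + 1) M _ M0 _ _ u0.
- by rewrite ltr_wpDl.
- apply/norm_leP; first by rewrite mulr_ge0// addr_ge0.
  move=> i; rewrite !mxE; apply: le_trans (HL i _ _ (clamp_norm _ B10) (clamp_norm _ B10)) _.
  apply: (@le_trans _ _ (L * `|u - v|)); first by rewrite ler_wpM2l// clamp_lip.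
  by rewrite ler_wpM2r// lerDl.
- apply/norm_leP => // i; rewrite mxE; apply: HM; exact: clamp_norm.
have lx s t : 0 <= s -> s <= t -> `|x t - x s| <= M * (t - s).
  move=> s0 st; apply/norm_leP; first by rewrite mulr_ge0// subr_ge0.
  move=> i; rewrite [X in `|X|]mxE [X in _ + X]mxE.
  apply: (@der_lipschitz R (fun r => x r 0 i) (fun r => Y (x r) 0 i)) => //.
    by move=> r /andP[sr _]; apply: dx; exact: le_trans sr.
  by move=> r _; rewrite mxE; apply: HM; exact: clamp_norm.
have dX t i : 0 <= t -> `|x t| <= B1 -> der t (fun s => x s 0 i) (X i (x t)).
  by move=> t0 xB; have := dx t t0 i; rewrite mxE clamp_id.
have Gx t : 0 <= t -> (forall s, 0 <= s <= t -> `|x s| <= B1) -> invariant_sum (x t) = invariant_sum u0.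
  move=> t0 xB; rewrite -x0; apply/esym.
  apply: (@der_cst_eq R (fun s => invariant_sum (x s)) (fun s => \sum_i expR (beta * x s 0 i) * X i (x s))) => //.
  move=> s /andP[s0 st]; apply: der_sum => i _.
  by apply: der_comp (der_density _) _; apply: dX => //; apply: xB; rewrite s0.
have Fx s t : 0 <= s -> s <= t -> (forall r, s <= r <= t -> `|x r| <= B1) -> F (x t) <= F (x s).
  move=> s0 st xB; rewrite -lerN2.
  apply: (@der_nondecreasing R (fun s => - F (x s)) (fun s => - \sum_i phi i (x s) * X i (x s))) => //.
    move=> r /andP[sr rt]; apply: derN.
    apply: (grad_chain gF); first exact: phi_loclip.
    by move=> i; apply: dX; [exact: le_trans sr|apply: xB; rewrite sr].
  by move=> r _; rewrite oppr_ge0.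
have step t : 0 <= t -> (forall s, 0 <= s <= t -> `|x s| <= B1) -> `|x t| <= B.
  move=> t0 xB; apply: trap; last exact: Gx.
  by rewrite -[in leRHS]x0; apply: Fx.
(* In a time h the solution moves by at most 1: from radius B it stays within B1, and [step]
   improves this bound to B again. *)
pose h := (M + 1)^-1; have h0 : 0 < h by rewrite invr_gt0 ltr_wpDl.
have Mh : M * h <= 1 by rewrite /h ler_pdivrMr ?ltr_wpDl// mul1r lerDl.
have xB1 n : forall s, 0 <= s <= n%:R * h -> `|x s| <= B1.
  elim: n => [|n IH] s.
    rewrite mul0r => hs; have -> : s = 0 by apply/eqP; rewrite eq_le andbC.
    rewrite x0 (@le_trans _ _ B) ?lerDl//; exact: trap.
  move=> /andP[s0 sn]; have [sn'|ns] := leP s (n%:R * h); first by apply: IH; rewrite s0.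
  have nh0 : 0 <= n%:R * h by rewrite mulr_ge0// ltW.
  have xn := step _ nh0 IH.
  rewrite -[x s](subrK (x (n%:R * h))) (le_trans (ler_normD _ _))// addrC lerD//.
  apply: (le_trans (lx _ _ nh0 (ltW ns))); apply: le_trans Mh.
  by rewrite ler_wpM2l//; move: sn; rewrite -natr1 mulrDl mul1r; lra.
have xB s : 0 <= s -> `|x s| <= B1.
  move=> s0; apply: (xB1 (Num.truncn (s / h)).+1); rewrite s0 /=.
  by rewrite -ler_pdivrMr// ltW// truncnS_gt.
exists x, B => //; split=> //.
- by move=> t t0 i; apply: dX => //; exact: xB.
- by move=> t t0; apply: step => // s /andP[s0 _]; exact: xB.
- by move=> t t0; apply: Gx => // s /andP[s0 _]; exact: xB.
- move=> s t s0 st; apply: Fx => // r /andP[sr _]; apply: xB; exact: le_trans sr.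
Qed.

(** Translates of a zero along [ones] are zeros, and the intermediate value theorem finds the one
    with the required sum. *)
Lemma zero_in_slice (a : rV) : exists us, (forall i, phi i us = 0) /\ invariant_sum us = invariant_sum a.
Proof.
have [v v0] := zero_phi_exists.
pose f (s : R) := invariant_sum (v + s *: ones).
pose b := `|v| + `|a|.
have cf : {within `[- b, b], continuous f}.
  apply: (@der_within_continuous R f (fun s => \sum_i expR (beta * (v + s *: ones) 0 i) * 1)).
  move=> s _; apply: der_sum => i _; apply: der_comp (der_density _) _.
  rewrite (_ : (fun s => _) = (fun s => v 0 i + s)); last first.
    by apply/funext => r; rewrite !mxE mulr1.
  by apply: is_derive_eq (derD (der_cst s (v 0 i)) (der_id s)) _; rewrite add0r.
have b0 : 0 <= b by rewrite addr_ge0.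
have nb : - b <= b by lra.
have [|s _ Hs] := IVT nb cf (v := invariant_sum a).
  have lo : f (- b) <= invariant_sum a.
    apply: invariant_sum_le => i; rewrite !mxE mulr1; have := coord_le_norm v i; have := coord_le_norm a i.
    by rewrite /b !ler_norml => /andP[? ?] /andP[? ?]; lra.
  have hi : invariant_sum a <= f b.
    apply: invariant_sum_le => i; rewrite !mxE mulr1; have := coord_le_norm v i; have := coord_le_norm a i.
    by rewrite /b !ler_norml => /andP[? ?] /andP[? ?]; lra.
  by rewrite ge_min lo le_max hi orbT.
exists (v + s *: ones); split=> //; apply: min_zero_phi => w.
by rewrite F_shift; exact: zero_phi_min.
Qed.

Lemma flow_converges (u0 : rV) : exists x : R -> rV, exists us : rV, [/\ x 0 = u0,
  forall t, 0 <= t -> forall i, der t (fun s => x s 0 i) (X i (x t)) &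
  x t @[t --> +oo] --> us].
Proof.
have [x [B B0 [x0 dx xB xG xF]]] := flow_exists u0.
have [us [us0 usG]] := zero_in_slice u0.
exists x, us; split=> //.
have Fus := zero_phi_min us0.
pose D (u : rV) := - \sum_i phi i u * X i u.
have cD : continuous D.
  apply: loclip_continuous; apply: loclipN; apply: loclip_sum => i _.
  by apply: loclipM => //; exact: phi_loclip.
have D0 u : 0 <= D u by rewrite oppr_ge0.
have min_zero u : F u <= F us -> forall i, phi i u = 0.
  by move=> h; apply: min_zero_phi => v; exact: le_trans (Fus v).
have closedF (a : R) : closed [set u | a <= F u].
  rewrite (_ : [set u | _] = F @^-1` [set y | a <= y])//.
  by apply: preimage_closed; [move=> u _; exact: F_continuous|exact: closed_ge].
(* Otherwise the solution stays in a compact set without zeros of phi, where the dissipation is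
   bounded below by a positive constant, and F falls below its minimum. *)
have low (e : R) : 0 < e -> exists2 t, 0 <= t & F (x t) < F us + e.
  move=> e0; apply/not_exists2P => H.
  have {}H t : 0 <= t -> F us + e <= F (x t).
    by move=> t0; rewrite leNgt; apply/negP => h; have [|] := H t.
  pose A : set rV := [set u | `|u| <= B] `&` [set u | F us + e <= F u].
  have [|||w wA Hw] := @EVT_min_rV R N D A.
  - by exists (x 0); split=> /=; [exact: xB|exact: H].
  - exact: compact_box_inter.
  - exact: continuous_subspaceT.
  have Dw : 0 < D w.
    rewrite lt_def D0 andbT; apply/eqP => /eqP; rewrite oppr_eq0 => /eqP /dissipative_eq0 w0.
    move: wA; rewrite inE => -[_ /=]; have := zero_phi_min w0 us; lra.
  (* A dissipation of at least D w lowers F by F (x 0) - F us + 1 up to time T. *)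
  pose T := (F (x 0) - F us + 1) / D w.
  have T0 : 0 <= T.
    by rewrite divr_ge0 ?(ltW Dw)// addr_ge0// subr_ge0.
  have dF (s : R) : 0 <= s <= T -> der s (fun s => - F (x s)) (D (x s)).
    move=> /andP[s0 _]; apply: derN.
    by apply: (grad_chain gF); [exact: phi_loclip|exact: dx].
  have [s /andP[s0 _] E] := MVT_der T0 dF.
  have : D w * T <= D (x s) * (T - 0).
    rewrite subr0 ler_wpM2r//; apply: Hw; rewrite inE; split=> /=; [exact: xB|exact: H].
  rewrite -E /T mulrC divfK ?gt_eqF//; have := H T T0; lra.
apply/(@cvgrPdist_le _ _ _ (nbhs +oo)) => e e0.
suff [T T0 HT] : exists2 T, 0 <= T & forall t, T <= t -> `|us - x t| < e.
  by exists T; split; [exact: num_real|move=> t Tt /=; rewrite ltW// HT// ltW].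
(* The points at distance at least e from us that the solution could visit. On this compact set the
   minimum of F exceeds F us, by uniqueness in the slice; once F is below that minimum along the
   solution, A is out of reach. *)
pose A : set rV := [set u | `|u| <= B] `&` ([set u | invariant_sum u = invariant_sum u0] `&` [set u | e <= `|us - u|]).
have [[a aA]|An] := pselect (A !=set0); last first.
  exists 0 => // t t0; rewrite ltNge; apply/negP => h; apply: An.
  by exists (x t); split; [exact: xB|split; [exact: xG|]].
have [|||w wA Hw] := @EVT_min_rV R N F A.
- by exists a.
- apply: compact_box_inter; apply: closedI.
    rewrite (_ : [set u | _] = invariant_sum @^-1` [set y | y = invariant_sum u0])//.
    by apply: preimage_closed; [move=> u _; exact: invariant_sum_continuous|exact: closed_eq].
  rewrite (_ : [set u | _] = (fun u : rV => `|us - u|) @^-1` [set y | e <= y])//.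
  apply: preimage_closed; last exact: closed_ge.
  move=> u _; apply: loclip_continuous => B'; exists 1 => // v w _ _.
  have -> : v - w = (us - w) - (us - v) by apply/rowP => i; rewrite !mxE; ring.
  by rewrite mul1r distrC ler_dist_dist.
- by apply: continuous_subspaceT; exact: F_continuous.
have Fw : F us < F w.
  rewrite ltNge; apply/negP => /min_zero w0.
  move: wA; rewrite inE => -[_ /= [wG /= we]].
  have cw := zero_phi_unique us0 w0.
  have shift i : w 0 i = us 0 i + (w 0 i0 - us 0 i0) by rewrite -(cw i i0) addrC subrK.
  have d0 : w 0 i0 - us 0 i0 = 0.
    have [h|h|//] := ltgtP (w 0 i0 - us 0 i0) 0.
    - suff : invariant_sum w < invariant_sum us by rewrite wG usG ltxx.
      by apply: invariant_sum_lt => i; rewrite (shift i); lra.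
    - suff : invariant_sum us < invariant_sum w by rewrite wG usG ltxx.
      by apply: invariant_sum_lt => i; rewrite (shift i); lra.
  move: we; rewrite (_ : us - w = 0) ?normr0 ?leNgt ?e0//.
  by apply/rowP => i; rewrite !mxE (shift i) d0; ring.
have [|t t0 Ht] := low (F w - F us); first by rewrite subr_gt0.
exists t => // s ts; rewrite ltNge; apply/negP => h.
have s0 : 0 <= s by exact: le_trans ts.
have : F w <= F (x s) by apply: Hw; rewrite inE; split; [exact: xB|split; [exact: xG|]].
have := xF t s t0 ts; move: Ht; lra.
Qed.

End Flow.
End ConvexPotential.

(** * Combinatorics of the triangulation *)

Section Faces.
Variables (N : nat) (T : triangulated_surface N).
Implicit Types (i j k : 'I_N).

Definition is_face i j k : bool := [set i; j; k]%SET \in faces T.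

Lemma is_faceC12 i j k : is_face i j k = is_face j i k.
Proof. by rewrite /is_face [[set i; j]%SET]finset.setUC. Qed.

Lemma is_faceC23 i j k : is_face i j k = is_face i k j.
Proof. by rewrite /is_face finset.setUAC. Qed.

Lemma is_face_uniq i j k : is_face i j k -> [/\ i != j, i != k & j != k].
Proof.
move=> /(card_face (t:=T)) c3; split; apply/eqP => E; move: c3; rewrite E.
- by rewrite finset.setUid cards2; case: (j != k).
- by rewrite finset.setUAC finset.setUid cards2; case: (k != j).
- by rewrite -finset.setUA finset.setUid cards2; case: (i != k).
Qed.

Lemma is_face_adjacent i j k : is_face i j k -> Defs.adjacent T i j.
Proof.
move=> h; have [ij _ _] := is_face_uniq h.
apply: (face_edges h); first by rewrite finset.subsetUl.
by rewrite cards2 ij.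
Qed.

Lemma next_neq_prev (c : seq 'I_N) j : (2 < size c)%N -> uniq c -> j \in c ->
  next c j != prev c j.
Proof.
move=> c2 uc jc; have [n s E] := rot_to jc.
apply/eqP => /(congr1 (next c)); rewrite next_prev//.
rewrite -!(next_rot n uc) E.
have := uc; rewrite -(rot_uniq n) E.
have : (2 < size (rot n c))%N by rewrite size_rot.
rewrite E; case: s E => [|x [|y s]] //= E _; rewrite !inE !negb_or eqxx.
move=> /andP[/and3P[jx jy _] _]; rewrite eq_sym (negbTE jx) eqxx => yj.
by rewrite yj eqxx in jy.
Qed.

(** The third vertices of the faces at an edge ij are the two neighbours of j in the link cycle of
    i, distinct because the cycle has at least three vertices. *)
Lemma card_face_edge i j : (\sum_k is_face i j k = 2 * Defs.adjacent T i j)%N.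
Proof.
have [c [c2 uc ec fc]] := vertex_link T i.
rewrite /Defs.adjacent ec; case: (boolP (j \in c)) => jc; last first.
  by rewrite big1 ?muln0// => k _; rewrite /is_face fc (negbTE jc).
have E k : is_face i j k = (k == next c j) || (k == prev c j).
  rewrite /is_face fc jc /=; apply/andP/orP => [[kc /orP[|/eqP E]]|[]/eqP->].
  - by left.
  - by right; rewrite E prev_next.
  - by rewrite mem_next jc eqxx.
  - by rewrite mem_prev jc next_prev// eqxx orbT.
rewrite muln1 (bigD1 (next c j))//= (bigD1 (prev c j))/=; last first.
  by rewrite eq_sym next_neq_prev.
rewrite big1 ?addn0 ?E ?eqxx ?orbT//.
by move=> k /andP[/negbTE k1 /negbTE k2]; rewrite E k1 k2.
Qed.

Lemma adjacent_face i j : Defs.adjacent T i j -> exists k, is_face i j k.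
Proof.
move=> ij; apply: contrapT => H.
have := card_face_edge i j; rewrite ij big1// => k _.
by case: (boolP (is_face i j k)) => // fk; case: H; exists k.
Qed.

Lemma separating_edge (I : {set 'I_N}) : I != finset.set0 -> I != [set: 'I_N]%SET ->
  exists i j, [/\ i \in I, j \notin I & Defs.adjacent T i j].
Proof.
move=> /set0Pn[a aI] nI.
have [b bI] : exists b, b \notin I.
  apply: contrapT => H; case/eqP: nI; apply/finset.setP => x; rewrite inE.
  by apply/negPn/negP => xI; apply: H; exists x.
have /connectP[p] := surface_connected T a b.
elim: p a aI => [|x p IH] a aI /=; first by move=> _ E; rewrite -E (negbTE bI) in aI.
move=> /andP[ax px] bE; have [xI|xI] := boolP (x \in I).
  exact: (IH x).
by exists a, x.
Qed.

Lemma constant_on_surface (V : Type) (w : 'I_N -> V) :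
  (forall i j, Defs.adjacent T i j -> w i = w j) -> forall i j, w i = w j.
Proof.
move=> H i j; have /connectP[p] := surface_connected T i j.
elim: p i => [|x p IH] i /=; first by move=> _ ->.
by move=> /andP[/H -> px]; exact: IH.
Qed.

End Faces.

(** * Sums over edges and faces as sums over ordered vertices *)

Section Counting.
Variables (R : realType) (N : nat).
Implicit Types (i j k : 'I_N) (S : {set {set 'I_N}}) (h : {set 'I_N} -> R).

Lemma card_ordered_pairs (e : {set 'I_N}) : #|e| = 2 ->
  \sum_i \sum_j ([set i; j]%SET == e)%:R = 2 :> R.
Proof.
move=> /eqP/cards2P[a [b [ab ->]]].
have E i j : ([set i; j]%SET == [set a; b]%SET)
   = ((i == a) && (j == b)) || ((i == b) && (j == a)).
  apply/eqP/orP => [/finset.setP E|[]/andP[/eqP-> /eqP->]//]; last exact: finset.setUC.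
  have {}E x : (x == i) || (x == j) = (x == a) || (x == b) by have := E x; rewrite !inE.
  have := E i; rewrite eqxx /= => /esym/orP[/eqP ia|/eqP ib].
    have := E b; rewrite ia eqxx orbT (eq_sym b a) (negbTE ab) /= => /eqP->.
    by left; rewrite !eqxx.
  have := E a; rewrite ib eqxx (negbTE ab) /= => /eqP->.
  by right; rewrite !eqxx.
have d1 (c : 'I_N) : \sum_j (j == c)%:R = 1 :> R.
  by rewrite (bigD1 c)//= eqxx big1 ?addr0// => j /negbTE->.
transitivity (\sum_i \sum_j ((i == a)%:R * (j == b)%:R + (i == b)%:R * (j == a)%:R) : R).
  apply: eq_bigr => i _; apply: eq_bigr => j _; rewrite E.
  have [->|_] := eqVneq i a; first by rewrite (negbTE ab) orbF /= mul1r mul0r addr0.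
  by rewrite /= mul0r add0r -natrM mulnb.
under eq_bigr do rewrite big_split/= -!mulr_sumr !d1 !mulr1.
by rewrite big_split/= !d1.
Qed.

Lemma card_ordered_triples (f : {set 'I_N}) : #|f| = 3 ->
  \sum_i \sum_j \sum_k ([set i; j; k]%SET == f)%:R = 6 :> R.
Proof.
move=> f3; rewrite (bigID (mem f))/= [X in _ + X]big1 ?addr0; last first.
  move=> i nif; apply: big1 => j _; apply: big1 => k _.
  by case: eqP => // E; move: nif; rewrite -E !inE eqxx.
transitivity (\sum_(i in f) (2 : R)); last by rewrite sumr_const f3 -mulrnA.
apply: eq_bigr => i fi; have c2 : #|(f :\ i)%SET| = 2.
  by have := cardsD1 i f; rewrite fi f3 => -[].
rewrite -(card_ordered_pairs c2); apply: eq_bigr => j _; apply: eq_bigr => k _.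
congr (_%:R); congr nat_of_bool; apply/eqP/eqP => [E|E]; last first.
  by rewrite -finset.setUA E finset.setD1K.
apply/eqP; rewrite eq_sym eqEcard c2 cards2; apply/andP; split; last by case: (j != k).
apply/fintype.subsetP => x; rewrite -E !inE => /andP[/negbTE->]/=.
by [].
Qed.

Lemma sum_edges S h : (forall e, e \in S -> #|e| = 2) ->
  \sum_(e in S) h e = 2^-1 * \sum_i \sum_j ([set i; j]%SET \in S)%:R * h [set i; j]%SET.
Proof.
move=> S2.
have -> : \sum_i \sum_j ([set i; j]%SET \in S)%:R * h [set i; j]%SET
  = \sum_(e in S) \sum_i \sum_j ([set i; j]%SET == e)%:R * h e.
  rewrite [RHS]exchange_big; apply: eq_bigr => i _ /=.
  rewrite [RHS]exchange_big; apply: eq_bigr => j _ /=.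
  have [ijS|ijS] := boolP (_ \in S).
    rewrite (bigD1 [set i; j]%SET)//= eqxx big1 ?addr0// => e /andP[_ /negbTE ne].
    by rewrite eq_sym ne mul0r.
  rewrite mul0r big1// => e eS; case: eqP => [E|]; last by rewrite mul0r.
  by rewrite -E (negbTE ijS) in eS.
rewrite mulr_sumr; apply: eq_bigr => e eS.
under eq_bigr do rewrite -mulr_suml.
by rewrite -mulr_suml card_ordered_pairs ?S2// mulrA mulVf ?mul1r.
Qed.

Lemma card_triangles S : (forall f, f \in S -> #|f| = 3) ->
  #|S|%:R = 6^-1 * \sum_i \sum_j \sum_k ([set i; j; k]%SET \in S)%:R :> R.
Proof.
move=> S3.
have -> : \sum_i \sum_j \sum_k ([set i; j; k]%SET \in S)%:R
  = \sum_(f in S) \sum_i \sum_j \sum_k ([set i; j; k]%SET == f)%:R :> R.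
  rewrite [RHS]exchange_big; apply: eq_bigr => i _ /=.
  rewrite [RHS]exchange_big; apply: eq_bigr => j _ /=.
  rewrite [RHS]exchange_big; apply: eq_bigr => k _ /=.
  have [ijS|ijS] := boolP (_ \in S).
    rewrite (bigD1 [set i; j; k]%SET)//= eqxx big1 ?addr0// => e /andP[_ /negbTE ne].
    by rewrite eq_sym ne.
  rewrite big1// => e eS; case: eqP => [E|//].
  by rewrite -E (negbTE ijS) in eS.
rewrite (eq_bigr (fun=> 6)); last by move=> f /S3 /card_ordered_triples.
by rewrite sumr_const -[6 *+ #|S|]mulr_natr mulrA mulVf ?mul1r.
Qed.

End Counting.

(** * Sums of curvatures over sets of vertices *)

Section Thurston.
Variables (R : realType) (N : nat) (T : triangulated_surface N).
Variable Phi : {set 'I_N} -> R.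
Hypothesis hPhi : is_weight T Phi.
Implicit Types (i j k : 'I_N) (r : 'rV[R]_N) (I : {set 'I_N}).

Definition cosPhi i j : R := cos (Phi [set i; j]%SET).

Lemma cosPhiC i j : cosPhi i j = cosPhi j i.
Proof. by rewrite /cosPhi finset.setUC. Qed.

Lemma Phi_itv i j : Defs.adjacent T i j -> 0 <= Phi [set i; j]%SET <= pi / 2.
Proof. exact: hPhi. Qed.

Lemma cosPhi_itv i j : Defs.adjacent T i j -> 0 <= cosPhi i j <= 1.
Proof.
move=> /Phi_itv/andP[h1 h2]; rewrite /cosPhi cos_le1 andbT cos_ge0_pihalf//.
by rewrite h2 andbT (le_trans _ h1)// oppr_le0 divr_ge0// pi_ge0.
Qed.

Lemma face_cosPhi i j k : is_face T i j k ->
  [/\ 0 <= cosPhi j k <= 1, 0 <= cosPhi i k <= 1 & 0 <= cosPhi i j <= 1].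
Proof.
move=> f; split; apply: cosPhi_itv; apply: is_face_adjacent.
- by rewrite is_faceC23 is_faceC12 is_faceC23; rewrite is_faceC12 in f; rewrite is_faceC12 is_faceC23 in f; exact: f.
- by rewrite is_faceC23 in f; exact: f.
- exact: f.
Qed.

Lemma angleE r i j k : angle Phi r i j k =
  triangle_angle (r 0 i) (r 0 j) (r 0 k) (cosPhi j k) (cosPhi i k) (cosPhi i j).
Proof. by []. Qed.

Lemma angleC r i j k : angle Phi r i j k = angle Phi r i k j.
Proof. by rewrite !angleE triangle_angleC (cosPhiC k j). Qed.

Lemma angle_sum r i j k : circle_packing_metric r -> is_face T i j k ->
  angle Phi r i j k + angle Phi r j i k + angle Phi r k i j = pi.
Proof.
move=> r0 /face_cosPhi[G1 G2 G3].
rewrite !angleE (cosPhiC j i) (cosPhiC k j) (cosPhiC k i).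
exact: triangle_angle_sum.
Qed.

Lemma angle_gt0 r i j k : circle_packing_metric r -> is_face T i j k ->
  0 < angle Phi r i j k.
Proof.
move=> r0 /face_cosPhi[G1 G2 G3]; rewrite angleE.
by have /andP[] := triangle_angle_itv (r0 i) (r0 j) (r0 k) G1 G2 G3.
Qed.

Lemma angle_lt_supplement r i j k : circle_packing_metric r -> is_face T i j k ->
  angle Phi r i j k < pi - Phi [set j; k]%SET.
Proof.
move=> r0 f; have [G1 G2 G3] := face_cosPhi f; rewrite angleE.
apply: triangle_angle_lt => //.
have /Phi_itv/andP[h1 h2] : Defs.adjacent T j k.
  by apply: (@is_face_adjacent _ _ _ _ i); rewrite is_faceC23 is_faceC12.
by rewrite h1 (le_trans h2)// ler_piMr ?pi_ge0// invf_le1// ler1n.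
Qed.

(* Each face contributes six times, once for each order of its vertices. *)
Definition face_sum (g : 'I_N -> 'I_N -> 'I_N -> R) : R :=
  \sum_i \sum_j \sum_k (is_face T i j k)%:R * g i j k.

Lemma face_sumC12 g : face_sum g = face_sum (fun i j k => g j i k).
Proof.
rewrite /face_sum exchange_big; apply: eq_bigr => i _; apply: eq_bigr => j _ /=.
by apply: eq_bigr => k _; rewrite is_faceC12.
Qed.

Lemma face_sumC23 g : face_sum g = face_sum (fun i j k => g i k j).
Proof.
rewrite /face_sum; apply: eq_bigr => i _; rewrite exchange_big.
apply: eq_bigr => j _ /=.
by apply: eq_bigr => k _; rewrite is_faceC23.
Qed.

Lemma face_sumC13 g : face_sum g = face_sum (fun i j k => g k j i).
Proof. by rewrite face_sumC12 face_sumC23 face_sumC12. Qed.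

Lemma face_sum_eq g h : (forall i j k, is_face T i j k -> g i j k = h i j k) ->
  face_sum g = face_sum h.
Proof.
move=> gh; apply: eq_bigr => i _; apply: eq_bigr => j _; apply: eq_bigr => k _.
by have [/gh->|_] := boolP (is_face T i j k); rewrite ?mul0r.
Qed.

Lemma face_sumD g h :
  face_sum (fun i j k => g i j k + h i j k) = face_sum g + face_sum h.
Proof.
rewrite /face_sum -big_split; apply: eq_bigr => i _ /=.
rewrite -big_split; apply: eq_bigr => j _ /=.
by rewrite -big_split; apply: eq_bigr => k _ /=; rewrite mulrDr.
Qed.

Lemma face_sumZ (c : R) g :
  face_sum (fun i j k => c * g i j k) = c * face_sum g.
Proof.
rewrite /face_sum mulr_sumr; apply: eq_bigr => i _; rewrite mulr_sumr.
apply: eq_bigr => j _; rewrite mulr_sumr; apply: eq_bigr => k _.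
by rewrite mulrCA.
Qed.

Lemma face_sum_ge0 g : (forall i j k, is_face T i j k -> 0 <= g i j k) -> 0 <= face_sum g.
Proof.
move=> g0; apply: sumr_ge0 => i _; apply: sumr_ge0 => j _; apply: sumr_ge0 => k _.
by have [/g0|_] := boolP (is_face T i j k); rewrite ?mul1r ?mul0r.
Qed.

Lemma face_sum_gt0 g i j k : (forall i j k, is_face T i j k -> 0 <= g i j k) ->
  is_face T i j k -> 0 < g i j k -> 0 < face_sum g.
Proof.
move=> g0 f gp.
have H a b c : 0 <= (is_face T a b c)%:R * g a b c.
  by have [/g0|_] := boolP (is_face T a b c); rewrite ?mul1r ?mul0r.
rewrite /face_sum (bigD1 i)//= ltr_pwDl//; last first.
  by apply: sumr_ge0 => a _; apply: sumr_ge0 => b _; apply: sumr_ge0.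
rewrite (bigD1 j)//= ltr_pwDl//; last first.
  by apply: sumr_ge0 => b _; apply: sumr_ge0.
rewrite (bigD1 k)//= ltr_pwDl//; last by apply: sumr_ge0.
by rewrite f mul1r.
Qed.

(** The sum over j < k is half the symmetric sum; the diagonal drops out because a face has three
    distinct vertices. *)
Lemma curvatureE r i : curvature T Phi r i =
  2 * pi - 2^-1 * \sum_j \sum_k (is_face T i j k)%:R * angle Phi r i j k.
Proof.
rewrite /curvature; congr (_ - _).
pose t j k := (is_face T i j k)%:R * angle Phi r i j k.
have tC j k : t j k = t k j by rewrite /t is_faceC23 angleC.
have E : \sum_(j < N) \sum_(k < N | (j < k)%N && ([set i; j; k]%SET \in faces T)) angle Phi r i j k
  = \sum_(j < N) \sum_(k < N) (j < k)%N%:R * t j k.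
  apply: eq_bigr => j _; rewrite big_mkcond/=; apply: eq_bigr => k _.
  rewrite -/(is_face T i j k) /t.
  by case: (j < k)%N; case: (is_face T i j k) => /=; ring.
have E' : \sum_(j < N) \sum_(k < N) (j < k)%N%:R * t j k
   = \sum_(j < N) \sum_(k < N) (k < j)%N%:R * t j k.
  by rewrite exchange_big; apply: eq_bigr => j _; apply: eq_bigr => k _ /=; rewrite tC.
have -> : \sum_j \sum_k (is_face T i j k)%:R * angle Phi r i j k =
   \sum_(j < N) \sum_(k < N) (j < k)%N%:R * t j k
   + \sum_(j < N) \sum_(k < N) (k < j)%N%:R * t j k.
  rewrite -big_split; apply: eq_bigr => j _ /=.
  rewrite -big_split; apply: eq_bigr => k _ /=.
  rewrite -mulrDl /t; case: ltngtP => [_|_|/val_inj ->] /=.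
  - by rewrite addr0 mul1r.
  - by rewrite add0r mul1r.
  - rewrite addr0 mul0r; case: (boolP (is_face T i k k)); last by rewrite mul0r.
    by move=> /is_face_uniq[_ _]; rewrite eqxx.
by rewrite -E' -E; field.
Qed.

Definition ind I i : R := (i \in I)%:R.
Definition out I i : R := (i \notin I)%:R.

Lemma ind_out I i : ind I i + out I i = 1.
Proof. by rewrite /ind /out; case: (i \in I); rewrite ?addr0 ?add0r. Qed.

Lemma ind_ge0 I i : 0 <= ind I i. Proof. by rewrite /ind. Qed.
Lemma out_ge0 I i : 0 <= out I i. Proof. by rewrite /out. Qed.

Lemma card_ind I : #|I|%:R = \sum_i ind I i.
Proof.
rewrite /ind -sum1_card natr_sum big_mkcond /=; apply: eq_bigr => i _.
by case: (i \in I).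
Qed.

(** The factor 4: an edge has two orders and lies in two faces, each giving a third vertex. *)
Lemma card_edges_in I : #|[set e in edges T | e \subset I]%SET|%:R
  = 4^-1 * face_sum (fun i j _ => ind I i * ind I j).
Proof.
set S := [set e in edges T | e \subset I]%SET.
have -> : #|S|%:R = \sum_(e in S) (1 : R) by rewrite sumr_const.
rewrite sum_edges; last by move=> e; rewrite inE => /andP[/card_edge].
have -> : face_sum (fun i j _ => ind I i * ind I j)
    = 2 * \sum_i \sum_j ([set i; j]%SET \in S)%:R * 1.
  rewrite mulr_sumr; apply: eq_bigr => i _; rewrite mulr_sumr; apply: eq_bigr => j _.
  rewrite -mulr_suml -natr_sum card_face_edge natrM -mulrA mulr1; congr (_ * _).
  by rewrite inE finset.subUset !finset.sub1set /ind /Defs.adjacent -!natrM !mulnb.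
by field.
Qed.

Lemma card_faces_in I : #|[set f in faces T | f \subset I]%SET|%:R
  = 6^-1 * face_sum (fun i j k => ind I i * ind I j * ind I k).
Proof.
rewrite (@card_triangles R); last by move=> f; rewrite inE => /andP[/card_face].
congr (_ * _); apply: eq_bigr => i _; apply: eq_bigr => j _; apply: eq_bigr => k _.
by rewrite inE !finset.subUset !finset.sub1set /ind /is_face -!natrM !mulnb.
Qed.

Lemma sum_Lk I : \sum_(p in Lk T I) (pi - Phi p.1)
  = 2^-1 * face_sum (fun i j k => ind I i * out I j * out I k * (pi - Phi [set j; k]%SET)).
Proof.
have -> : \sum_(p in Lk T I) (pi - Phi p.1) = \sum_i \sum_(e in
    [set e in edges T | [&& [disjoint e & I], i \in I & (i |: e)%SET \in faces T]]%SET) (pi - Phi e).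
  rewrite [RHS](exchange_big_dep xpredT)//= pair_big_dep/=.
  by apply: eq_bigl => -[e i]; rewrite !inE.
rewrite /face_sum mulr_sumr; apply: eq_bigr => i _.
rewrite sum_edges; last by move=> e; rewrite inE => /andP[/card_edge].
congr (_ * _); apply: eq_bigr => j _; apply: eq_bigr => k _.
rewrite mulrA; congr (_ * _).
rewrite inE -/(Defs.adjacent T j k) finset.setUA -/(is_face T i j k).
rewrite finset.disjoints_subset finset.subUset !finset.sub1set !inE.
rewrite /ind /out -!natrM !mulnb; congr (_%:R).
have [f|nf] := boolP (is_face T i j k); last by rewrite !andbF.
have -> : Defs.adjacent T j k.
  by apply: (@is_face_adjacent _ _ _ _ i); rewrite is_faceC23 is_faceC12.
by rewrite /= andbT andbC andbA.
Qed.

(* Contributions of the faces with two, resp. one, of their vertices in [I]. *)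
Definition boundary_defect r I : R :=
  face_sum (fun i j k => ind I i * ind I j * out I k * angle Phi r k i j)
  + face_sum (fun i j k => ind I i * out I j * out I k
                           * (pi - Phi [set j; k]%SET - angle Phi r i j k)).

(** Faces are sorted by their number of vertices in I. Three vertices contribute pi, two contribute
    pi minus the outer angle, one contributes the supplement of the opposite weight minus a defect.
    Counting edges through their faces turns the multiples of pi into the Euler characteristic. *)
Lemma sum_curvature r I : circle_packing_metric r ->
  \sum_(i in I) curvature T Phi r i = link_bound T Phi I + 2^-1 * boundary_defect r I.
Proof.
move=> r0.
pose th i j k := angle Phi r i j k.
pose a := ind I; pose b := out I.
have -> : \sum_(i in I) curvature T Phi r i
   = 2 * pi * \sum_i a i - 2^-1 * face_sum (fun i j k => a i * th i j k).
  rewrite mulr_sumr /face_sum mulr_sumr -sumrB big_mkcond/=; apply: eq_bigr => i _.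
  rewrite curvatureE /a /ind; case: (i \in I).
    rewrite mulr1; congr (_ - _ * _); apply: eq_bigr => j _; apply: eq_bigr => k _.
    by rewrite mul1r.
  rewrite mulr0 big1 ?mulr0 ?subr0// => j _; apply: big1 => k _.
  by rewrite mul0r mulr0.
have S1 : face_sum (fun i j k => a i * th i j k)
   = face_sum (fun i j k => a i * a j * a k * th i j k)
   + face_sum (fun i j k => a i * a j * b k * th i j k)
   + face_sum (fun i j k => a i * b j * a k * th i j k)
   + face_sum (fun i j k => a i * b j * b k * th i j k).
  rewrite -!face_sumD; apply: face_sum_eq => i j k _.
  rewrite -[a i * th i j k]mul1r -[X in X * _](mulr1 1) -{1}(ind_out I j) -(ind_out I k).
  by rewrite -/(a _) -/(a _) -/(b _) -/(b _); ring.
have S2 : face_sum (fun i j k => a i * b j * a k * th i j k)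
   = face_sum (fun i j k => a i * a j * b k * th i j k).
  by rewrite face_sumC23; apply: face_sum_eq => i j k _; rewrite /th angleC; ring.
(* Symmetrising over the three vertices turns the angle at one of them into a third of pi. *)
have S3 : 3 * face_sum (fun i j k => a i * a j * a k * th i j k)
   = pi * face_sum (fun i j k => a i * a j * a k).
  have -> : 3 * face_sum (fun i j k => a i * a j * a k * th i j k)
    = face_sum (fun i j k => a i * a j * a k * th i j k)
    + face_sum (fun i j k => a i * a j * a k * th j i k)
    + face_sum (fun i j k => a i * a j * a k * th k i j).
    rewrite [in RHS](face_sumC12 (fun i j k => a i * a j * a k * th j i k)).
    rewrite [in RHS](face_sumC13 (fun i j k => a i * a j * a k * th k i j)).
    rewrite (face_sum_eq (g := fun i j k => a j * a i * a k * th i j k) (h := fun i j k => a i * a j * a k * th i j k)).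
      rewrite (face_sum_eq (g := fun i j k => a k * a j * a i * th i k j) (h := fun i j k => a i * a j * a k * th i j k)).
        by ring.
      by move=> i j k _; rewrite /th angleC; ring.
    by move=> i j k _; ring.
  rewrite -!face_sumD -face_sumZ; apply: face_sum_eq => i j k f.
  by rewrite -!mulrDr /th (angle_sum r0 f); ring.
have S4 : 2 * face_sum (fun i j k => a i * a j * b k * th i j k)
   = pi * face_sum (fun i j k => a i * a j * b k)
     - face_sum (fun i j k => a i * a j * b k * th k i j).
  have -> : 2 * face_sum (fun i j k => a i * a j * b k * th i j k)
    = face_sum (fun i j k => a i * a j * b k * th i j k)
    + face_sum (fun i j k => a i * a j * b k * th j i k).
    rewrite [in RHS](face_sumC12 (fun i j k => a i * a j * b k * th j i k)).
    rewrite (face_sum_eq (g := fun i j k => a j * a i * b k * th i j k) (h := fun i j k => a i * a j * b k * th i j k)).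
      by ring.
    by move=> i j k _; ring.
  rewrite -!face_sumD -face_sumZ -[in RHS]mulN1r -face_sumZ -face_sumD.
  apply: face_sum_eq => i j k f.
  by have := angle_sum r0 f; rewrite -!/(th _ _ _) => <-; ring.
have S5 : face_sum (fun i j k => a i * b j * b k * th i j k)
   = face_sum (fun i j k => a i * b j * b k * (pi - Phi [set j; k]%SET))
   - face_sum (fun i j k => a i * b j * b k * (pi - Phi [set j; k]%SET - th i j k)).
  rewrite -[in RHS]mulN1r -face_sumZ -face_sumD.
  by apply: face_sum_eq => i j k f; ring.
(* An edge inside I is seen through its faces, whose third vertex is in I or not. *)
have S6 : face_sum (fun i j _ => a i * a j)
   = face_sum (fun i j k => a i * a j * a k) + face_sum (fun i j k => a i * a j * b k).
  rewrite -!face_sumD; apply: face_sum_eq => i j k _.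
  by rewrite -mulrDr ind_out mulr1.
have chi : (euler_char_sub T I)%:~R = \sum_i a i - 4^-1 * face_sum (fun i j _ => a i * a j)
    + 6^-1 * face_sum (fun i j k => a i * a j * a k) :> R.
  rewrite /euler_char_sub rmorphD rmorphB/= -!pmulrn.
  by rewrite card_ind card_edges_in card_faces_in.
rewrite /link_bound sum_Lk chi S6 S1 S2 S5 /boundary_defect -/a -/b -/th.
by lra.
Qed.

(** With I the whole vertex set no vertex lies outside, so the defect vanishes and the link is
    empty. *)
Lemma Gauss_Bonnet r : circle_packing_metric r ->
  \sum_i curvature T Phi r i = total_curvature R T.
Proof.
move=> r0; have := sum_curvature [set: 'I_N]%SET r0.
have E : \sum_(i in [set: 'I_N]%SET) curvature T Phi r i = \sum_i curvature T Phi r i.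
  by apply: eq_bigl => i; rewrite inE.
have out0 i : out [set: 'I_N]%SET i = 0 by rewrite /out inE.
rewrite E => ->.
have -> : boundary_defect r [set: 'I_N]%SET = 0.
  rewrite /boundary_defect /face_sum !big1 ?addr0// => i _; apply: big1 => j _;
    apply: big1 => k _; by rewrite ?out0; ring.
rewrite mulr0 addr0 /link_bound big_pred0 ?oppr0 ?add0r; last first.
  move=> p; rewrite inE; apply/negP => /and4P[e d _ _].
  move: d; rewrite finset.disjoints_subset finset.setCT => /fintype.subsetP d.
  have /eqP/cards2P[x [y [_ pE]]] := card_edge e.
  by have := d x; rewrite pE !inE eqxx => /(_ isT).
rewrite /total_curvature; congr (_ * _%:~R).
rewrite /euler_char_sub /euler_char cardsT card_ord.
have S (A : {set {set 'I_N}}) : [set e in A | e \subset [set: 'I_N]%SET]%SET = A.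
  by apply/finset.setP => e; rewrite !inE finset.subsetT andbT.
by rewrite !S.
Qed.

Lemma boundary_defect_ge0 r I i j k : circle_packing_metric r -> is_face T i j k ->
  0 <= ind I i * ind I j * out I k * angle Phi r k i j /\
  0 <= ind I i * out I j * out I k * (pi - Phi [set j; k]%SET - angle Phi r i j k).
Proof.
move=> r0 f; have f' : is_face T k i j by rewrite is_faceC12 is_faceC23.
split; apply: mulr_ge0; rewrite ?mulr_ge0 ?ind_ge0 ?out_ge0//.
  exact: ltW (angle_gt0 _ _).
by rewrite subr_ge0 ltW// angle_lt_supplement.
Qed.

(** By connectedness an edge leaves I; a face containing it contributes to one of the two parts of
    the defect, according to the position of its third vertex. *)
Lemma Thurston_inequality r I : circle_packing_metric r ->
  I != finset.set0 -> I != [set: 'I_N]%SET ->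
  link_bound T Phi I < \sum_(i in I) curvature T Phi r i.
Proof.
move=> r0 I0 I1; rewrite sum_curvature// ltrDl mulr_gt0// /boundary_defect.
have [i [j [iI jI /adjacent_face[k f]]]] := separating_edge T I0 I1.
have [kI|kI] := boolP (k \in I).
  apply: ltr_pwDl; last by apply: face_sum_ge0 => a b c /(boundary_defect_ge0 I r0)[].
  apply: (@face_sum_gt0 _ i k j).
  - by move=> a b c /(boundary_defect_ge0 I r0)[].
  - by rewrite is_faceC23.
  - rewrite /ind /out iI kI jI !mul1r; apply: angle_gt0 => //.
    by rewrite is_faceC12.
apply: ltr_pwDr; last by apply: face_sum_ge0 => a b c /(boundary_defect_ge0 I r0)[].
apply: (@face_sum_gt0 _ i j k) => //.
- by move=> a b c /(boundary_defect_ge0 I r0)[].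
- rewrite /ind /out iI kI jI !mul1r subr_gt0; exact: angle_lt_supplement.
Qed.

End Thurston.

(** * The curvature map in logarithmic coordinates *)

Section GraphLaplacian.
Variables (R : realType) (N : nat) (Q : 'I_N -> 'I_N -> R).
Hypothesis Q_sym : forall i j, Q i j = Q j i.

Lemma dirichlet_form (a b : 'I_N -> R) :
  \sum_i (\sum_j Q i j * (a i - a j)) * b i
  = 2^-1 * \sum_i \sum_j Q i j * (a i - a j) * (b i - b j).
Proof.
have E : \sum_i (\sum_j Q i j * (a i - a j)) * b i = \sum_i \sum_j Q i j * (a i - a j) * b i.
  by apply: eq_bigr => i _; rewrite mulr_suml.
have E' : \sum_i \sum_j Q i j * (a i - a j) * b i = - \sum_i \sum_j Q i j * (a i - a j) * b j.
  rewrite exchange_big -sumrN; apply: eq_bigr => i _ /=.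
  by rewrite -sumrN; apply: eq_bigr => j _; rewrite (Q_sym j i); ring.
have -> : \sum_i \sum_j Q i j * (a i - a j) * (b i - b j)
   = \sum_i \sum_j Q i j * (a i - a j) * b i - \sum_i \sum_j Q i j * (a i - a j) * b j.
  rewrite -sumrB; apply: eq_bigr => i _; rewrite -sumrB; apply: eq_bigr => j _.
  by rewrite mulrBr.
by rewrite E; move: E'; lra.
Qed.

Lemma laplacian_sum0 (a : 'I_N -> R) : \sum_i \sum_j Q i j * (a i - a j) = 0.
Proof.
have := dirichlet_form a (fun=> 1).
under eq_bigr do rewrite mulr1.
move=> ->; rewrite big1 ?mulr0// => i _; apply: big1 => j _.
by rewrite subrr mulr0.
Qed.

Hypothesis Q_ge0 : forall i j, 0 <= Q i j.

Lemma dirichlet_ge0 (a : 'I_N -> R) : 0 <= \sum_i (\sum_j Q i j * (a i - a j)) * a i.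
Proof.
rewrite dirichlet_form mulr_ge0// sumr_ge0// => i _; apply: sumr_ge0 => j _.
by rewrite -mulrA mulr_ge0// -expr2 sqr_ge0.
Qed.

Lemma dirichlet_eq0 (a : 'I_N -> R) : \sum_i (\sum_j Q i j * (a i - a j)) * a i = 0 ->
  forall i j, 0 < Q i j -> a i = a j.
Proof.
rewrite dirichlet_form => /eqP; rewrite mulf_eq0 invr_eq0 pnatr_eq0/= => /eqP E i j Qij.
have T i' j' : 0 <= Q i' j' * (a i' - a j') * (a i' - a j').
  by rewrite -mulrA mulr_ge0// -expr2 sqr_ge0.
have S i' : 0 <= \sum_j Q i' j * (a i' - a j) * (a i' - a j) by apply: sumr_ge0.
have /eqP := E; rewrite psumr_eq0// => /allP/(_ i (mem_index_enum _))/=.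
rewrite psumr_eq0// => /allP/(_ j (mem_index_enum _))/=.
by rewrite -mulrA mulf_eq0 gt_eqF//= mulf_eq0 orbb subr_eq0 => /eqP.
Qed.

End GraphLaplacian.

Section CurvatureMap.
Variables (R : realType) (N : nat) (T : triangulated_surface N).
Variables (Phi : {set 'I_N} -> R) (alpha : R).
Hypothesis hPhi : is_weight T Phi.
Hypothesis halpha : alpha * (euler_char T)%:~R <= 0.
Local Notation rV := 'rV[R]_N.
Local Notation der t f d := (is_derive (t : R) (1 : R) (f : R -> R) (d : R)).
Implicit Types (u v w : rV) (i j k : 'I_N).
Local Notation cosP := (cosPhi Phi).
Local Notation chi2pi := (total_curvature R T).

Lemma expvE u i : expv u 0 i = expR (u 0 i).
Proof. by rewrite mxE. Qed.

Lemma expv_metric u : circle_packing_metric (expv u).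
Proof. by move=> i; rewrite expvE expR_gt0. Qed.

Lemma expv_lnv (r : rV) : circle_packing_metric r -> expv (lnv r) = r.
Proof. by move=> r0; apply/rowP => i; rewrite !mxE lnK// posrE. Qed.

Lemma lnv_expv u : lnv (expv u) = u.
Proof. by apply/rowP => i; rewrite !mxE expRK. Qed.

Definition face_weight u i j k : R :=
  angle_weight (expR (u 0 i)) (expR (u 0 j)) (expR (u 0 k)) (cosP j k) (cosP i k) (cosP i j).

(** For i distinct from j this is minus the derivative of K_i with respect to u_j. *)
Definition edge_weight i j u : R := \sum_k (is_face T i j k)%:R * face_weight u i j k.

Lemma face_weightC u i j k : face_weight u i j k = face_weight u j i k.
Proof. by rewrite /face_weight angle_weightC (cosPhiC _ i j). Qed.

Lemma edge_weightC i j u : edge_weight i j u = edge_weight j i u.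
Proof. by apply: eq_bigr => k _; rewrite is_faceC12 face_weightC. Qed.

Lemma face_weight_ge0 u i j k : is_face T i j k -> 0 <= face_weight u i j k.
Proof.
by move=> f; have [? ? ?] := face_cosPhi hPhi f; apply: angle_weight_ge0; rewrite ?expR_gt0.
Qed.

Lemma edge_weight_ge0 i j u : 0 <= edge_weight i j u.
Proof.
apply: sumr_ge0 => k _; have [f|_] := boolP (is_face T i j k); last by rewrite mul0r.
by rewrite mul1r face_weight_ge0.
Qed.

Lemma edge_weight_gt0 i j k u : is_face T i j k -> 0 < face_weight u i j k ->
  0 < edge_weight i j u.
Proof.
move=> f h; rewrite /edge_weight (bigD1 k)//= f mul1r ltr_pwDl// sumr_ge0// => l _.
have [f'|_] := boolP (is_face T i j l); last by rewrite mul0r.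
by rewrite mul1r face_weight_ge0.
Qed.

Lemma edge_weight_nonadjacent i j u : ~~ Defs.adjacent T i j -> edge_weight i j u = 0.
Proof.
move=> nij; apply: big1 => k _; have [/is_face_adjacent ij|_] := boolP (is_face T i j k).
  by rewrite ij in nij.
by rewrite mul0r.
Qed.

(** If the face ijk does not give ij a positive weight, the cosines of ik and jk vanish; these two
    edges then have positive weight and lead from i to j through k. *)
Lemma edge_weight_connected u (V : Type) (w : 'I_N -> V) :
  (forall i j, 0 < edge_weight i j u -> w i = w j) -> forall i j, w i = w j.
Proof.
move=> H; apply: (@constant_on_surface _ T) => i j /adjacent_face[k f].
have [g1 g2 g3] := face_cosPhi hPhi f.
have P a b c : is_face T a b c -> [|| cosP a b < 1, 0 < cosP b c | 0 < cosP a c] -> w a = w b.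
  move=> f' h; have [? ? ?] := face_cosPhi hPhi f'; apply: H.
  by apply: (edge_weight_gt0 f'); apply: angle_weight_gt0; rewrite ?expR_gt0.
have [h|] := boolP [|| cosP i j < 1, 0 < cosP j k | 0 < cosP i k]; first exact: P f h.
rewrite !negb_or -!leNgt => /and3P[_ jk ik].
have -> : w i = w k.
  by apply: (P i k j); rewrite ?(le_lt_trans ik)// is_faceC23.
have f' : is_face T j k i by rewrite is_faceC23 is_faceC12.
by apply/esym; apply: (P j k i); rewrite ?(le_lt_trans jk).
Qed.

Lemma loclip_expcoord i : loclip (fun u => expR (u 0 i)).
Proof. by apply: loclip_expR; exact: loclip_coord. Qed.

Lemma face_weight_loclip i j k : is_face T i j k -> loclip (fun u => face_weight u i j k).
Proof.
move=> f; have [g1 g2 g3] := face_cosPhi hPhi f.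
have li := loclip_expcoord i; have lj := loclip_expcoord j; have lk := loclip_expcoord k.
have lc := @loclip_cst R N.
have ls : loclip (fun u => lsq (expR (u 0 i)) (expR (u 0 j)) (cosP i j)).
  rewrite /lsq; do !(apply: loclipM || apply: loclipD || apply: lc || exact: li || exact: lj).
have la : loclip (fun u => area_sq (expR (u 0 i)) (expR (u 0 j)) (expR (u 0 k))
    (cosP j k) (cosP i k) (cosP i j)).
  rewrite /area_sq.
  by do !(apply: loclipM || apply: loclipD || exact: lc || exact: li || exact: lj || exact: lk).
have a0 u : 0 < area_sq (expR (u 0 i)) (expR (u 0 j)) (expR (u 0 k))
    (cosP j k) (cosP i k) (cosP i j) by rewrite area_sq_gt0 ?expR_gt0.
rewrite /face_weight /angle_weight; apply: loclip_div.
- by do !(apply: loclipM || apply: loclipD || exact: lc || exact: li || exact: lj || exact: lk).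
- by apply: loclipM => //; exact: loclip_sqrt.
- move=> u; apply: mulr_gt0; last by rewrite sqrtr_gt0.
  by have /andP[? _] := g3; rewrite lsq_gt0 ?expR_gt0.
Qed.

Lemma edge_weight_loclip i j : loclip (edge_weight i j).
Proof.
apply: loclip_sum => k _; have [f|_] := boolP (is_face T i j k).
  by apply: loclipM; [exact: loclip_cst|exact: face_weight_loclip].
rewrite (_ : (fun u => _) = (fun=> 0)); first exact: loclip_cst.
by apply/funext => u; rewrite mul0r.
Qed.

Lemma der_curvature u w i (t : R) :
  der t (fun s => curvature_u T Phi (u + s *: w) i)
    (\sum_j edge_weight i j (u + t *: w) * (w 0 i - w 0 j)).
Proof.
pose x l (s : R) := expR ((u + s *: w) 0 l).
have dx l : der t (x l) (x l t * w 0 l).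
  rewrite /x; apply: der_expR.
  rewrite (_ : (fun s => _) = (fun s => u 0 l + s * w 0 l)); last first.
    by apply/funext => s; rewrite !mxE.
  apply: is_derive_eq (derD (der_cst t (u 0 l)) (derM (der_id t) (der_cst t (w 0 l)))) _.
  by rewrite mul1r mulr0 addr0 add0r.
have x0 l s : 0 < x l s by exact: expR_gt0.
have dth j k : is_face T i j k -> der t (fun s => angle Phi (expv (u + s *: w)) i j k)
    (face_weight (u + t *: w) i j k * (w 0 j - w 0 i)
     + face_weight (u + t *: w) i k j * (w 0 k - w 0 i)).
  move=> f; have [g1 g2 g3] := face_cosPhi hPhi f.
  rewrite (_ : (fun s => _) = (fun s => triangle_angle (x i s) (x j s) (x k s) (cosP j k) (cosP i k) (cosP i j))).
    apply: is_derive_eq (der_triangle_angle (x0 i) (x0 j) (x0 k) g1 g2 g3 (dx i) (dx j) (dx k)) _.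
    by rewrite /face_weight (cosPhiC _ k j).
  by apply/funext => s; rewrite angleE !expvE.
have dt : der t (fun s => 2^-1 * \sum_j \sum_k (is_face T i j k)%:R * angle Phi (expv (u + s *: w)) i j k)
  (2^-1 * \sum_j \sum_k (is_face T i j k)%:R *
     (face_weight (u + t *: w) i j k * (w 0 j - w 0 i)
     + face_weight (u + t *: w) i k j * (w 0 k - w 0 i))).
  apply: derMl; apply: der_sum => j _; apply: der_sum => k _.
  have [f|_] := boolP (is_face T i j k); first by apply: derMl; exact: dth.
  rewrite mul0r (_ : (fun s => _) = (fun=> 0)); first exact: der_cst.
  by apply/funext => s; rewrite mul0r.
rewrite (_ : (fun s => _) = (fun s => 2 * pi - 2^-1 * \sum_j \sum_k (is_face T i j k)%:R * angle Phi (expv (u + s *: w)) i j k)).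
  apply: is_derive_eq (derB (der_cst t (2 * pi)) dt) _; rewrite sub0r.
  (* Exchanging j and k identifies the two halves, which absorbs the factor 1/2. *)
  have -> : \sum_j \sum_k (is_face T i j k)%:R *
     (face_weight (u + t *: w) i j k * (w 0 j - w 0 i)
     + face_weight (u + t *: w) i k j * (w 0 k - w 0 i))
   = \sum_j edge_weight i j (u + t *: w) * (w 0 j - w 0 i)
     + \sum_k edge_weight i k (u + t *: w) * (w 0 k - w 0 i).
    under eq_bigr do under eq_bigr do rewrite mulrDr.
    under eq_bigr do rewrite big_split/=.
    rewrite big_split/=; congr (_ + _).
      by apply: eq_bigr => j _; rewrite mulr_suml; apply: eq_bigr => k _; rewrite mulrA.
    rewrite exchange_big; apply: eq_bigr => k _ /=; rewrite mulr_suml.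
    by apply: eq_bigr => j _; rewrite is_faceC23 mulrA.
  have -> : \sum_j edge_weight i j (u + t *: w) * (w 0 i - w 0 j)
    = - \sum_j edge_weight i j (u + t *: w) * (w 0 j - w 0 i).
    by rewrite -sumrN; apply: eq_bigr => j _; ring.
  by field.
by apply/funext => s; rewrite /curvature_u (curvatureE T Phi).
Qed.

(* [share i u] is r_i^alpha / ||r||_alpha^alpha at r = exp u. *)
Definition mass u : R := \sum_l expR (alpha * u 0 l).
Definition share i u : R := expR (alpha * u 0 i) / mass u.

Lemma mass_gt0 u : 0 < mass u.
Proof.
have N0 := vertices_gt0 T; rewrite /mass (bigD1 (Ordinal N0))//= ltr_pwDl ?expR_gt0//.
by apply: sumr_ge0 => l _; exact: expR_ge0.
Qed.

Lemma share_gt0 i u : 0 < share i u.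
Proof. by rewrite divr_gt0 ?expR_gt0 ?mass_gt0. Qed.

Lemma share_ge0 i u : 0 <= share i u.
Proof. exact: ltW (share_gt0 i u). Qed.

Lemma sum_share u : \sum_i share i u = 1.
Proof. by rewrite -mulr_suml mulfV// gt_eqF// mass_gt0. Qed.

Lemma share_loclip i : loclip (share i).
Proof.
have le l : loclip (fun u => expR (alpha * u 0 l)).
  by apply: loclip_expR; apply: loclipM; [exact: loclip_cst|exact: loclip_coord].
apply: loclip_div => //; last exact: mass_gt0.
by apply: loclip_sum => l _; exact: le.
Qed.

Lemma der_share u w i (t : R) :
  der t (fun s => share i (u + s *: w))
    (alpha * share i (u + t *: w) * \sum_j share j (u + t *: w) * (w 0 i - w 0 j)).
Proof.
have de l : der t (fun s => expR (alpha * (u + s *: w) 0 l))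
    (expR (alpha * (u + t *: w) 0 l) * (alpha * w 0 l)).
  apply: der_expR; apply: derMl.
  rewrite (_ : (fun s => _) = (fun s => u 0 l + s * w 0 l)); last first.
    by apply/funext => s; rewrite !mxE.
  apply: is_derive_eq (derD (der_cst t (u 0 l)) (derM (der_id t) (der_cst t (w 0 l)))) _.
  by rewrite mul1r mulr0 addr0 add0r.
have Z0 := mass_gt0 (u + t *: w).
have dZ : der t (fun s => mass (u + s *: w)) (\sum_l expR (alpha * (u + t *: w) 0 l) * (alpha * w 0 l)).
  by apply: der_sum => l _.
have Zn : mass (u + t *: w) != 0 by rewrite gt_eqF.
apply: is_derive_eq (derM (de i) (@derV _ t (fun s => mass (u + s *: w)) _ Zn dZ)) _.
have -> : \sum_j share j (u + t *: w) * (w 0 i - w 0 j)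
   = w 0 i - (\sum_l expR (alpha * (u + t *: w) 0 l) * w 0 l) / mass (u + t *: w).
  under eq_bigr do rewrite mulrBr.
  rewrite sumrB -mulr_suml sum_share mul1r; congr (_ - _).
  by rewrite mulr_suml; apply: eq_bigr => l _; rewrite mulrAC.
have -> : \sum_l expR (alpha * (u + t *: w) 0 l) * (alpha * w 0 l)
  = alpha * \sum_l expR (alpha * (u + t *: w) 0 l) * w 0 l.
  by rewrite mulr_sumr; apply: eq_bigr => l _; ring.
by rewrite /share; field.
Qed.

(** The scale of the conductances that the moving target adds to the graph; the hypothesis on alpha
    and chi enters as its sign. *)
Definition kappa : R := - chi2pi * alpha.

Lemma kappa_ge0 : 0 <= kappa.
Proof.
have -> : kappa = - (2 * pi * (alpha * (euler_char T)%:~R)).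
  by rewrite /kappa /total_curvature; ring.
by rewrite oppr_ge0 pmulr_rle0// mulr_gt0 ?pi_gt0.
Qed.

Definition curv_gap i u : R := curvature_u T Phi u i - chi2pi * share i u.
Definition cond i j u : R := edge_weight i j u + kappa * share i u * share j u.
(** The Laplacian matrix of the weights [cond], whose diagonal values cancel. *)
Definition grad_gap i u j : R := (j == i)%:R * (\sum_l cond i l u) - cond i j u.

Lemma condC i j u : cond i j u = cond j i u.
Proof. by rewrite /cond edge_weightC mulrAC. Qed.

Lemma share_share_ge0 i j u : 0 <= kappa * share i u * share j u.
Proof.
apply: mulr_ge0; last exact: share_ge0.
by apply: mulr_ge0; [exact: kappa_ge0|exact: share_ge0].
Qed.

Lemma cond_ge0 i j u : 0 <= cond i j u.
Proof.
by apply: addr_ge0; [exact: edge_weight_ge0|exact: share_share_ge0].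
Qed.

Lemma cond_loclip i j : loclip (cond i j).
Proof.
apply: loclipD; first exact: edge_weight_loclip.
apply: loclipM; last exact: share_loclip.
by apply: loclipM; [exact: loclip_cst|exact: share_loclip].
Qed.

Lemma grad_gap_loclip i j : loclip (fun u => grad_gap i u j).
Proof.
apply: loclipB; last exact: cond_loclip.
by apply: loclipM; [exact: loclip_cst|apply: loclip_sum => l _; exact: cond_loclip].
Qed.

Lemma grad_gapC i j u : grad_gap i u j = grad_gap j u i.
Proof.
rewrite /grad_gap condC eq_sym; congr (_ - _).
by case: eqP => [->//|_]; rewrite !mul0r.
Qed.

Lemma grad_gapE i u w : \sum_j grad_gap i u j * w 0 j = \sum_j cond i j u * (w 0 i - w 0 j).
Proof.
under [in RHS]eq_bigr do rewrite mulrBr.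
rewrite sumrB -mulr_suml /grad_gap.
under eq_bigr do rewrite mulrBl.
rewrite sumrB; congr (_ - _).
rewrite (bigD1 i)//= eqxx mul1r [X in _ + X]big1 ?addr0// => j /negbTE->.
by rewrite !mul0r.
Qed.

Lemma curv_gap_has_grad i : has_grad (curv_gap i) (grad_gap i).
Proof.
move=> u w t; rewrite grad_gapE.
apply: is_derive_eq (derB (der_curvature u w i t) (derMl chi2pi (der_share u w i t))) _.
rewrite /cond mulrA mulrA mulr_sumr -sumrB; apply: eq_bigr => j _.
by rewrite /kappa; ring.
Qed.

Lemma curv_gap_loclip i : loclip (curv_gap i).
Proof.
apply: (grad_loclip (curv_gap_has_grad i)) => j; exact: grad_gap_loclip.
Qed.

Lemma grad_gap_psd u w : 0 <= \sum_i (\sum_j grad_gap i u j * w 0 j) * w 0 i.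
Proof.
under eq_bigr do rewrite grad_gapE.
apply: (@dirichlet_ge0 _ _ (fun i j => cond i j u)) => i j; [exact: condC|exact: cond_ge0].
Qed.

Lemma cond_connected u (V : Type) (w : 'I_N -> V) :
  (forall i j, 0 < cond i j u -> w i = w j) -> forall i j, w i = w j.
Proof.
move=> H; apply: (@edge_weight_connected u) => i j h; apply: H.
by rewrite ltr_pwDl// share_share_ge0.
Qed.

Lemma grad_gap_ker u w : \sum_i (\sum_j grad_gap i u j * w 0 j) * w 0 i = 0 ->
  forall i j, w 0 i = w 0 j.
Proof.
under eq_bigr do rewrite grad_gapE.
move=> /(@dirichlet_eq0 _ _ (fun i j => cond i j u)) H.
apply: (@cond_connected u) => i j; apply: H => a b; [exact: condC|exact: cond_ge0].
Qed.

Lemma sum_curv_gap u : \sum_i curv_gap i u = 0.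
Proof.
rewrite sumrB -mulr_sumr sum_share mulr1.
by rewrite (Gauss_Bonnet hPhi (expv_metric u)) subrr.
Qed.

Lemma curv_gap_potential : exists F : rV -> R, has_grad F (fun u i => curv_gap i u).
Proof.
apply: potential_exists; [exact: curv_gap_has_grad|exact: grad_gap_loclip|exact: grad_gapC].
Qed.

Lemma expR_powR (x : R) : expR x `^ alpha = expR (alpha * x).
Proof. by rewrite /powR gt_eqF ?expR_gt0// expRK. Qed.

Lemma alpha_norm_expv u : alpha_norm alpha (expv u) = mass u.
Proof. by apply: eq_bigr => i _; rewrite expvE expR_powR. Qed.

(** Gauss-Bonnet forces the constant to be [chi2pi / mass u]. *)
Lemma constant_curvature_gap u :
  constant_alpha_curvature T Phi alpha (expv u) <-> forall i, curv_gap i u = 0.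
Proof.
have E i : curv_gap i u = 0 -> alpha_curvature T Phi alpha (expv u) 0 i = chi2pi / mass u.
  move=> /eqP; rewrite subr_eq0 => /eqP Ki.
  rewrite mxE -/(curvature_u T Phi u i) Ki expvE expR_powR /share; field.
  by rewrite !gt_eqF ?expR_gt0 ?mass_gt0.
split=> [[_ [c Hc]] i|H]; last first.
  by split; [exact: expv_metric|exists (chi2pi / mass u) => i; exact: E].
have Ki j : curvature_u T Phi u j = c * expR (alpha * u 0 j).
  by rewrite -(Hc j) mxE -/(curvature_u T Phi u j) expvE expR_powR divfK// gt_eqF// expR_gt0.
have : chi2pi = c * mass u.
  rewrite -(Gauss_Bonnet hPhi (expv_metric u)) mulr_sumr.
  by apply: eq_bigr => j _; exact: Ki.
by rewrite /curv_gap Ki => ->; rewrite /share; field; rewrite gt_eqF// mass_gt0.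
Qed.

End CurvatureMap.

(** * Coercivity *)

Lemma sum_cst_ord (R : realType) (n : nat) (c : R) : \sum_(i < n) c = n%:R * c.
Proof. by rewrite sumr_const card_ord mulr_natl. Qed.

Section Layers.
Variables (R : realType) (N : nat).
Hypothesis N0 : (0 < N)%N.
Let i0 : 'I_N := Ordinal N0.

Lemma sum_lt_nat (M n : nat) : (n <= M)%N -> \sum_(s < M) (s < n)%N%:R = n%:R :> R.
Proof.
elim: M n => [|M IH] n; first by rewrite leqn0 => /eqP->; rewrite big_ord0.
rewrite leq_eqVlt => /predU1P[->|]; last first.
  by rewrite ltnS => nM; rewrite big_ord_recr/= IH// ltnNge nM addr0.
rewrite (eq_bigr (fun=> 1)) ?sumr_const ?card_ord// => s _.
by rewrite ltn_ord.
Qed.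

Lemma sum_eq_nat (M n : nat) : \sum_(s < M) (n == s :> nat)%:R <= 1 :> R.
Proof.
have [nM|nM] := ltnP n M; last first.
  rewrite big1 ?ler01// => s _; case: eqP => // E.
  by have := ltn_ord s; rewrite -E ltnNge nM.
rewrite (bigD1 (Ordinal nM))//= eqxx big1 ?addr0// => s sn.
by case: eqP => // E; case/eqP: sn; apply: val_inj.
Qed.

(* Round [u - min u] down to multiples [t n] of [t]: summation by parts over the
   levels [s] expresses the sum through the sublevel sets [n <= s], and at the
   levels not taken by [n] (all but at most [N]) the sublevel set is separated
   from its complement by a gap of at least [t]. *)
Lemma gap_sum (y u : 'I_N -> R) (t d A : R) : 0 < t -> 0 <= d -> 0 <= A ->
  \sum_k y k = 0 -> \sum_k `|y k| <= A ->
  (forall I : {set 'I_N}, I != finset.set0 -> I != [set: 'I_N]%SET ->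
     (forall i j, i \in I -> j \notin I -> u i + t <= u j) -> \sum_(i in I) y i <= - d) ->
  forall i j, d * (u i - u j) - t * (d + (d + A) * N%:R + A) <= \sum_k y k * u k.
Proof.
move=> t0 d0 A0 y0 yA H i' j'.
have [i _ Hi] := @Order.TotalTheory.arg_maxP _ R _ i0 xpredT u isT.
have [j _ Hj] := @Order.TotalTheory.arg_minP _ R _ i0 xpredT u isT.
have ui k : u k <= u i by exact: Hi.
have uj k : u j <= u k by exact: Hj.
pose n k := Num.truncn ((u k - u j) / t).
have v0 k : 0 <= (u k - u j) / t by rewrite divr_ge0 ?subr_ge0 ?(ltW t0).
have n_le k : t * (n k)%:R <= u k - u j.
  by rewrite mulrC -ler_pdivlMr// truncn_le.
have n_gt k : u k - u j < t * (n k)%:R + t.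
  have := truncnS_gt ((u k - u j) / t); rewrite ltr_pdivrMr// -/(n k) -natr1.
  by rewrite mulrDl mul1r (mulrC _ t).
pose M := n i.
have nM k : (n k <= M)%N by apply: le_truncn; rewrite ler_pM2r ?invr_gt0// lerB.
have nj : n j = 0%N by rewrite /n subrr mul0r truncn0.
pose L (s : nat) : {set 'I_N} := [set k | (n k <= s)%N]%SET.
have sumL (s : nat) : \sum_k y k * (s < n k)%N%:R = - \sum_(k in L s) y k.
  have : \sum_k y k * (s < n k)%N%:R + \sum_(k in L s) y k = 0.
    rewrite -[RHS]y0 [X in _ + X]big_mkcond -big_split/=; apply: eq_bigr => k _.
    have -> : (k \in L s) = ~~ (s < n k)%N by rewrite /L inE -leqNgt.
    by case: (s < n k)%N; rewrite /= ?mulr1 ?addr0 ?mulr0 ?add0r.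
  by move/eqP; rewrite addr_eq0 => /eqP.
have yI (I : {set 'I_N}) : \sum_(k in I) y k <= A.
  apply: le_trans yA; rewrite big_mkcond; apply: ler_sum => k _.
  by case: (k \in I); rewrite // ler_norm.
(* At a level taken by some n k only the bound A is available. The subtracted term compensates for
   it, and over all levels these terms add up to at most (d + A) N. *)
have level (s : 'I_M) : d - (d + A) * \sum_k (n k == s :> nat)%:R <= - \sum_(k in L s) y k.
  have [[k nk]|nocc] := pselect (exists k, n k = s).
    have : 1 <= \sum_k (n k == s :> nat)%:R :> R.
      by rewrite (bigD1 k)//= nk eqxx lerDl sumr_ge0.
    move=> h; have : d + A <= (d + A) * \sum_k (n k == s :> nat)%:R.
      by rewrite ler_peMr// addr_ge0.
    by have := yI (L s); lra.
  rewrite big1 ?mulr0 ?subr0; last first.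
    by move=> k _; case: eqP => // nk; case: nocc; exists k.
  rewrite lerNr; apply: H.
  - by apply/set0Pn; exists j; rewrite inE nj.
  - apply/eqP => /finset.setP/(_ i); rewrite !inE => /esym.
    by rewrite leqNgt ltn_ord.
  - move=> a b; rewrite !inE -ltnNge => an bn.
    have {}an : (n a < s)%N.
      by rewrite ltn_neqAle an andbT; apply/eqP => na; apply: nocc; exists a.
    have := n_gt a; have := n_le b.
    have h1 : t * (n a)%:R + t + t <= t * (n b)%:R.
      have : t * ((n a)%:R + 2) <= t * (n b)%:R.
        rewrite ler_pM2l// -natrD ler_nat; apply: leq_trans bn.
        by rewrite addn2 ltnS.
      by lra.
    by lra.
have key : d * M%:R - (d + A) * N%:R <= \sum_k y k * (n k)%:R.
  have -> : \sum_k y k * (n k)%:R = \sum_(s < M) - \sum_(k in L s) y k.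
    under [RHS]eq_bigr do rewrite -sumL.
    rewrite exchange_big; apply: eq_bigr => k _ /=.
    by rewrite -mulr_sumr sum_lt_nat.
  apply: (@le_trans _ _ (\sum_(s < M) (d - (d + A) * \sum_k (n k == s :> nat)%:R)));
    last by apply: ler_sum => s _; exact: level.
  rewrite sumrB sum_cst_ord (mulrC M%:R) lerD2l lerN2 -mulr_sumr.
  apply: ler_wpM2l; first by rewrite addr_ge0.
  rewrite exchange_big/=; apply: (@le_trans _ _ (\sum_(k < N) 1)).
    by apply: ler_sum => k _; exact: sum_eq_nat.
  by rewrite sumr_const card_ord.
have E : \sum_k y k * u k = t * (\sum_k y k * (n k)%:R)
    + \sum_k y k * (u k - u j - t * (n k)%:R).
  rewrite mulr_sumr -big_split/=.
  have -> : \sum_k y k * u k = \sum_k y k * (u k - u j).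
    under [RHS]eq_bigr do rewrite mulrBr.
    by rewrite sumrB -mulr_suml y0 mul0r subr0.
  by apply: eq_bigr => k _; ring.
have rem : - (t * A) <= \sum_k y k * (u k - u j - t * (n k)%:R).
  rewrite lerNl; apply: (le_trans (ler_norm _)); rewrite normrN.
  apply: (le_trans (ler_norm_sum _ _ _)); apply: (@le_trans _ _ (t * \sum_k `|y k|)).
    rewrite mulr_sumr; apply: ler_sum => k _; rewrite normrM mulrC ler_wpM2r//.
    have := n_le k; have := n_gt k => *; rewrite ger0_norm; lra.
  by rewrite ler_pM2l.
have spread : d * (u i' - u j') <= d * (t * M%:R + t).
  rewrite ler_wpM2l//; have := n_gt i; have := ui i'; have := uj j'; rewrite /M; lra.
have tkey : t * (d * M%:R - (d + A) * N%:R) <= t * \sum_k y k * (n k)%:R.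
  by rewrite ler_pM2l.
rewrite E; lra.
Qed.

End Layers.

Section Coercivity.
Variables (R : realType) (N : nat) (T : triangulated_surface N).
Variables (Phi : {set 'I_N} -> R) (alpha : R).
Hypothesis hPhi : is_weight T Phi.
Hypothesis halpha : alpha * (euler_char T)%:~R <= 0.
Local Notation rV := 'rV[R]_N.
Implicit Types (u v w : rV) (i j k : 'I_N).
Local Notation chi2pi := (total_curvature R T).
Local Notation K u i := (curvature_u T Phi u i).

Lemma curvature_bounded : exists A : R, forall u i, `|K u i| <= A.
Proof.
have pi0 : 0 <= pi :> R by exact: pi_ge0.
exists (2 * pi + 2^-1 * \sum_(j < N) \sum_(k < N) pi) => u i.
rewrite /curvature_u (curvatureE T Phi).
apply: (le_trans (ler_normB _ _)); apply: lerD; first by rewrite ger0_norm// mulr_ge0.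
rewrite normrM ger0_norm ?invr_ge0// ler_pM2l ?invr_gt0//.
apply: (le_trans (ler_norm_sum _ _ _)); apply: ler_sum => j _.
apply: (le_trans (ler_norm_sum _ _ _)); apply: ler_sum => k _.
have [f|_] := boolP (is_face T i j k); last by rewrite mul0r normr0.
have a0 := angle_gt0 hPhi (expv_metric u) f.
have := angle_sum hPhi (expv_metric u) f.
rewrite mul1r ger0_norm; last exact: ltW.
have := angle_gt0 hPhi (expv_metric u) (i := j) (j := i) (k := k).
rewrite is_faceC12 => /(_ f).
have := angle_gt0 hPhi (expv_metric u) (i := k) (j := i) (k := j).
rewrite is_faceC12 is_faceC23 => /(_ f).
by lra.
Qed.

(* When the radii of [I] are much smaller than the other ones, the curvature of
   [I] is close to the bound of Thurston's inequality. *)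
Lemma degenerate_curvature (e : R) : 0 < e -> exists2 t : R, 0 < t &
  forall u (I : {set 'I_N}), (forall i j, i \in I -> j \notin I -> u 0 i + t <= u 0 j) ->
    \sum_(i in I) K u i <= link_bound T Phi I + e.
Proof.
move=> e0.
(* Each part of the defect is a sum of N^3 terms, each to be made at most e1. *)
pose e1 := e / (N%:R ^+ 3 + 1).
have N3 : 0 <= N%:R ^+ 3 :> R by rewrite exprn_ge0.
have e10 : 0 < e1 by rewrite divr_gt0// ltr_wpDl.
have e1N : e1 * N%:R ^+ 3 <= e.
  by rewrite /e1 mulrAC ler_pdivrMr ?ltr_wpDl// ler_pM2l// lerDl.
have [d d0 Hd] := triangle_angle_large_apex e10.
(* The admissible ratio of radii depends on the weight of the opposite edge; finitely many edges
   allow the common bound D on the logarithms. *)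
have /boolp.choice[c Hc] : forall p : 'I_N * 'I_N, exists d : R, Defs.adjacent T p.1 p.2 ->
    0 < d /\ forall x y z g2 g3 : R, 0 < x -> 0 < y -> 0 < z ->
    0 <= g2 <= 1 -> 0 <= g3 <= 1 -> x <= d * y -> x <= d * z ->
    pi - Phi [set p.1; p.2]%SET - e1 < triangle_angle x y z (cosPhi Phi p.1 p.2) g2 g3.
  move=> [a b]; have [ab|nab] := boolP (Defs.adjacent T a b); last by exists 0.
  have [d' d'0 H] := triangle_angle_small_apex (Phi_itv hPhi ab) e10.
  by exists d' => _; split.
have [D D0 HD] := finite_bound (fun p => - ln (c p)).
(* A difference t of logarithms enforces all the ratios of radii required above. *)
pose t := D + `|ln d| + 1.
have t0 : 0 < t by rewrite ltr_wpDl// addr_ge0.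
have scale (q a b : R) : 0 < q -> - ln q <= t -> a + t <= b -> expR a <= q * expR b.
  move=> q0 qt ab; have qE : expR (ln q) = q by rewrite lnK// posrE.
  by rewrite -qE -expRD ler_expR; lra.
exists t => // u I gap.
have r0 := expv_metric u.
rewrite /curvature_u (sum_curvature hPhi I r0) lerD2l.
have E1 : face_sum T (fun i j k => ind R I i * ind R I j * out R I k * angle Phi (expv u) k i j)
    <= e1 * N%:R ^+ 3.
  have -> : e1 * N%:R ^+ 3 = \sum_(i < N) \sum_(j < N) \sum_(k < N) e1.
    by rewrite !sum_cst_ord; ring.
  apply: ler_sum => i _; apply: ler_sum => j _; apply: ler_sum => k _.
  have [f|_] := boolP (is_face T i j k); last by rewrite mul0r ltW.
  rewrite mul1r /ind /out; case: (boolP (i \in I)) => iI; last by rewrite !mul0r ltW.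
  case: (boolP (j \in I)) => jI; last by rewrite mulr0 !mul0r ltW.
  case: (boolP (k \in I)) => kI; first by rewrite mulr0 mul0r ltW.
  rewrite !mul1r angleE !expvE; apply/ltW.
  have f' : is_face T k i j by rewrite is_faceC12 is_faceC23.
  have [? ? ?] := face_cosPhi hPhi f'.
  apply: Hd; rewrite ?expR_gt0//; apply: scale => //; try exact: gap.
    by have := ler_norm (- ln d); rewrite normrN /t; lra.
  by have := ler_norm (- ln d); rewrite normrN /t; lra.
have E2 : face_sum T (fun i j k => ind R I i * out R I j * out R I k
      * (pi - Phi [set j; k]%SET - angle Phi (expv u) i j k)) <= e1 * N%:R ^+ 3.
  have -> : e1 * N%:R ^+ 3 = \sum_(i < N) \sum_(j < N) \sum_(k < N) e1.
    by rewrite !sum_cst_ord; ring.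
  apply: ler_sum => i _; apply: ler_sum => j _; apply: ler_sum => k _.
  have [f|_] := boolP (is_face T i j k); last by rewrite mul0r ltW.
  rewrite mul1r /ind /out; case: (boolP (i \in I)) => iI; last by rewrite !mul0r ltW.
  case: (boolP (j \in I)) => jI; first by rewrite mulr0 !mul0r ltW.
  case: (boolP (k \in I)) => kI; first by rewrite mulr0 mul0r ltW.
  rewrite !mul1r angleE !expvE.
  have jk : Defs.adjacent T j k.
    by apply: (@is_face_adjacent _ _ _ _ i); rewrite is_faceC23 is_faceC12.
  have [c0 H] := Hc (j, k) jk.
  have [? ? ?] := face_cosPhi hPhi f.
  have cD : - ln (c (j, k)) <= t.
    by apply: (le_trans (HD (j, k))); rewrite /t -addrA lerDl addr_ge0.
  have := H (expR (u 0 i)) (expR (u 0 j)) (expR (u 0 k)) (cosPhi Phi i k) (cosPhi Phi i j).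
  rewrite !expR_gt0 => /(_ isT isT isT) H'.
  have /= := H' _ _ (scale _ _ _ c0 cD (gap _ _ iI jI)) (scale _ _ _ c0 cD (gap _ _ iI kI)).
  by move=> /(_ _ _)/ltW; lra.
rewrite /boundary_defect; lra.
Qed.

(** Every weighted mean is at most y m. The softmax mean falls short of y m by at most 1 for each
    index, since x <= e^x. *)
Lemma softmax_spread (a : 'I_N -> R) (y : 'I_N -> R) m :
  (forall k, y k <= y m) -> (forall k, 0 <= a k) -> \sum_k a k = 1 ->
  \sum_k a k * y k - N%:R <= \sum_k expR (y k) / (\sum_l expR (y l)) * y k.
Proof.
move=> ym a0 a1; set Z := \sum_l expR (y l).
have Zm : expR (y m) <= Z.
  by rewrite /Z (bigD1 m)//= lerDl sumr_ge0// => l _; exact: expR_ge0.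
have Z0 : 0 < Z by exact: lt_le_trans (expR_gt0 _) Zm.
have up : \sum_k a k * y k <= y m.
  rewrite -[leRHS]mul1r -a1 mulr_suml; apply: ler_sum => k _.
  by rewrite ler_wpM2l.
have lo : y m - \sum_k expR (y k) / Z * y k <= N%:R.
  have -> : y m - \sum_k expR (y k) / Z * y k = \sum_k expR (y k) / Z * (y m - y k).
    under [RHS]eq_bigr do rewrite mulrBr.
    by rewrite sumrB -mulr_suml -mulr_suml mulfV ?mul1r// gt_eqF.
  apply: (@le_trans _ _ (\sum_(k < N) 1)); last by rewrite sumr_const card_ord.
  apply: ler_sum => k _; rewrite mulrAC ler_pdivrMr// mul1r.
  apply: le_trans Zm.
  have -> : expR (y m) = expR (y k) * expR (y m - y k) by rewrite -expRD addrC subrK.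
  rewrite ler_pM2l ?expR_gt0//.
  by apply: le_trans (expR_ge1Dx _); rewrite lerDr.
by lra.
Qed.

(** Up to the factor kappa / alpha^2 >= 0 the sum is the softmax mean of alpha u minus its q-mean.
    For alpha = 0 the shares are uniform, and the hypothesis on q makes the sum vanish. *)
Lemma share_spread (q : 'I_N -> R) : (forall k, 0 <= q k) -> \sum_k q k = 1 ->
  (alpha = 0 -> forall k, q k = N%:R^-1) ->
  exists C : R, forall u, - C <= \sum_k chi2pi * (q k - share alpha k u) * u 0 k.
Proof.
move=> q0 q1 qa.
have [a0|a0] := eqVneq alpha 0.
  exists 0 => u; rewrite oppr0 big1// => k _.
  have m : mass alpha u = N%:R.
    rewrite /mass (eq_bigr (fun=> 1)) ?sumr_const ?card_ord// => l _.
    by rewrite a0 mul0r expR0.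
  by rewrite /share m a0 mul0r expR0 qa// div1r subrr mulr0 mul0r.
pose k2 := kappa T alpha / alpha ^+ 2.
have k20 : 0 <= k2 by rewrite divr_ge0 ?sqr_ge0// kappa_ge0.
exists (k2 * N%:R) => u.
have [m _ Hm] := @Order.TotalTheory.arg_maxP _ R _ (Ordinal (vertices_gt0 T)) xpredT
   (fun k => alpha * u 0 k) isT.
have := softmax_spread (y := fun k => alpha * u 0 k) (m := m) (fun k => Hm k isT) q0 q1.
rewrite -/(mass alpha u) => H.
have -> : \sum_k chi2pi * (q k - share alpha k u) * u 0 k
   = k2 * (\sum_k share alpha k u * (alpha * u 0 k) - \sum_k q k * (alpha * u 0 k)).
  rewrite -sumrB mulr_sumr; apply: eq_bigr => k _.
  by rewrite /k2 /kappa; field.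
have : - N%:R <= \sum_k share alpha k u * (alpha * u 0 k) - \sum_k q k * (alpha * u 0 k).
  by move: H; rewrite /share; lra.
by move=> /(ler_wpM2l k20); rewrite mulrN.
Qed.

(** [share_spread] replaces the moving target by the fixed [chi2pi * q]. For a set of vertices
    separated from the others by a gap t, the curvature exceeds [link_bound] by at most d while the
    target exceeds it by at least 2 d; the difference - d is what [gap_sum] takes as input. *)
Lemma curv_gap_coercive (q : 'I_N -> R) : (forall k, 0 <= q k) -> \sum_k q k = 1 ->
  (alpha = 0 -> forall k, q k = N%:R^-1) ->
  (forall I : {set 'I_N}, I != finset.set0 -> I != [set: 'I_N]%SET ->
     link_bound T Phi I < chi2pi * \sum_(i in I) q i) ->
  exists c C : R, 0 < c /\ forall u i j,
    c * (u 0 i - u 0 j) - C <= \sum_k curv_gap T Phi alpha k u * u 0 k.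
Proof.
move=> q0 q1 qa H.
have [C1 HC1] := share_spread q0 q1 qa.
have [A HA] := curvature_bounded.
have A0 : 0 <= A.
  by apply: le_trans (HA 0 (Ordinal (vertices_gt0 T))); rewrite normr_ge0.
(* D bounds the reciprocals of finitely many margins, so 2 d = 1 / (D + 1) is below each margin. *)
have [D D0 HD] := finite_bound
  (fun I : {set 'I_N} => (chi2pi * \sum_(i in I) q i - link_bound T Phi I)^-1).
pose d := (D + 1)^-1 / 2.
have d0 : 0 < d by rewrite divr_gt0// invr_gt0 ltr_wpDl.
have gapd (I : {set 'I_N}) : I != finset.set0 -> I != [set: 'I_N]%SET ->
    2 * d <= chi2pi * \sum_(i in I) q i - link_bound T Phi I.
  move=> I0 I1; have := H I I0 I1; rewrite -subr_gt0 => g0.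
  have -> : 2 * d = (D + 1)^-1 by rewrite /d; field; rewrite gt_eqF// ltr_wpDl.
  rewrite -[leRHS]invrK lef_pV2 ?posrE ?invr_gt0//; last exact: ltr_wpDl.
  by apply: (le_trans (HD I)); rewrite lerDl.
have [t t0 Ht] := degenerate_curvature d0.
pose B := N%:R * (A + `|chi2pi|).
exists d, (t * (d + (d + B) * N%:R + B) + C1); split=> // u i j.
pose y k := K u k - chi2pi * q k.
have y0 : \sum_k y k = 0.
  by rewrite sumrB -mulr_sumr q1 mulr1 (Gauss_Bonnet hPhi (expv_metric u)) subrr.
have yB : \sum_k `|y k| <= B.
  apply: (@le_trans _ _ (\sum_(k < N) (A + `|chi2pi|))); last first.
    by rewrite sum_cst_ord.
  apply: ler_sum => k _; apply: (le_trans (ler_normB _ _)); apply: lerD => //.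
  rewrite normrM ler_piMr// ger0_norm// -q1 (bigD1 k)//= lerDl.
  exact: sumr_ge0.
have B0 : 0 <= B by rewrite mulr_ge0// addr_ge0.
have := gap_sum (vertices_gt0 T) (u := fun k => u 0 k) t0 (ltW d0) B0 y0 yB _ i j.
have -> : \sum_k curv_gap T Phi alpha k u * u 0 k = \sum_k y k * u 0 k
    + \sum_k chi2pi * (q k - share alpha k u) * u 0 k.
  by rewrite -big_split/=; apply: eq_bigr => k _; rewrite /curv_gap /y; ring.
have := HC1 u => h /(_ _)/lerD /(_ h) h'.
have -> : d * (u 0 i - u 0 j) - (t * (d + (d + B) * N%:R + B) + C1)
  = d * (u 0 i - u 0 j) - t * (d + (d + B) * N%:R + B) - C1 by ring.
apply: h' => I I0 I1 gap.
rewrite sumrB -mulr_sumr; have := Ht u I gap; have := gapd I I0 I1; lra.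
Qed.

End Coercivity.

(** * The flows and the equivalence *)

Section SolutionsOfFlows.
Variables (R : realType) (N : nat).
Local Notation rV := 'rV[R]_N.
Local Notation der t f d := (is_derive (t : R) (1 : R) (f : R -> R) (d : R)).

Lemma der_derive (G : rV -> R) (u w : rV) (d : R) :
  der 0 (fun s => G (u + s *: w)) d -> 'D_w G u = d.
Proof.
move=> [_ <-]; rewrite /derive; congr (lim (_ @ 0^')).
apply/funext => h.
transitivity (h^-1 *: (G (u + (h * 1 + 0) *: w) - G (u + 0 *: w))); last by [].
by rewrite /= [h *: w + u]addrC mulr1 addr0 scale0r addr0.
Qed.

Lemma flow_solution_der (D : set rV) (X : rV -> rV) x0 (x : R -> rV) :
  x 0 = x0 -> (forall t, 0 <= t -> D (x t)) ->
  (forall t, 0 <= t -> forall i, der t (fun s => x s 0 i) (X (x t) 0 i)) ->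
  flow_solution D X x0 x.
Proof.
move=> xx0 xD dx; split=> // t t0; apply/cvg_rowP => i.
apply/(@cvgrPdist_le _ _ _ (within `[0, +oo[ t^')) => e e0.
have /der_epsP/(_ _ e0)[r r0 H] := dx t t0 i.
rewrite near_withinE; apply/nbhs_ballP; exists r => //= s; rewrite /ball/= distrC => st nst _.
have st0 : s - t != 0 by rewrite subr_eq0.
rewrite !mxE; have := H s st.
have -> : X (x t) 0 i - (s - t)^-1 * (x s 0 i - x t 0 i)
  = - (x s 0 i - x t 0 i - X (x t) 0 i * (s - t)) * (s - t)^-1 by field.
move=> h; rewrite normrM normrN normfV ler_pdivrMr ?normr_gt0//.
Qed.

(** Positive times only: the derivative of a solution at 0 is one-sided. *)
Lemma der_flow_solution (D : set rV) (X : rV -> rV) x0 (x : R -> rV) :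
  flow_solution D X x0 x -> forall t, 0 < t -> forall i,
  der t (fun s => x s 0 i) (X (x t) 0 i).
Proof.
move=> [_ _ dx] t t0 i.
have /cvg_rowP/(_ i) cx := dx t (ltW t0).
apply/der_epsP => e e0.
have /(@cvgrPdist_le _ _ _ (within `[0, +oo[ t^'))/(_ _ e0) := cx.
rewrite near_withinE => /nbhs_ballP[r /= r0 H].
exists (Num.min r t); first by rewrite lt_min r0.
move=> s; rewrite lt_min => /andP[sr st].
have [->|nst] := eqVneq s t; first by rewrite !subrr mulr0 subr0 normr0 mulr0.
have s0 : 0 <= s by move: st; rewrite ltr_norml => /andP[]; lra.
have st0 : s - t != 0 by rewrite subr_eq0.
have := H s; rewrite /ball/= distrC => /(_ sr nst).
rewrite in_itv/= s0 => /(_ isT); rewrite !mxE.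
have -> : X (x t) 0 i - (s - t)^-1 * (x s 0 i - x t 0 i)
  = - (x s 0 i - x t 0 i - X (x t) 0 i * (s - t)) * (s - t)^-1 by field.
by rewrite normrM normrN normfV ler_pdivrMr ?normr_gt0.
Qed.

(** The increment of f over [t, t + 1] tends to 0 and, by the mean value theorem, is a value of
    df. *)
Lemma limit_derivative0 (f df : R -> R) (l y : R) :
  (forall t, 0 < t -> der t f (df t)) ->
  f t @[t --> +oo] --> l -> df t @[t --> +oo] --> y -> y = 0.
Proof.
move=> hf cf cdf; apply/eqP/negPn/negP => y0.
have y0' : 0 < `|y| by rewrite normr_gt0.
(* Three errors of |y| / 8 add up to less than |y|. *)
have e8 : 0 < `|y| / 8 by rewrite divr_gt0.
move/(@cvgrPdist_le _ _ _ (nbhs +oo))/(_ _ e8) : cf => [A [_ HA]].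
move/(@cvgrPdist_le _ _ _ (nbhs +oo))/(_ _ e8) : cdf => [B [_ HB]].
pose t := Num.max (Num.max A B) 0 + 1.
have m : Num.max (Num.max A B) 0 < t by rewrite /t ltrDl.
have tA : A < t by apply: le_lt_trans m; rewrite !le_max lexx.
have tB : B < t by apply: le_lt_trans m; rewrite !le_max lexx orbT.
have t0 : 0 < t by apply: le_lt_trans m; rewrite le_max lexx orbT.
have tt1 : t <= t + 1 by rewrite lerDl.
have ht s : t <= s <= t + 1 -> der s f (df s).
  by move=> /andP[ts _]; apply: hf; exact: lt_le_trans ts.
have [c /andP[tc _]] := MVT_der tt1 ht.
have := HB c (lt_le_trans tB tc); have := HA t tA; have := HA (t + 1) (lt_le_trans tA tt1).
rewrite /= (addrC t) addrK mulr1 => h1 h2 h3 E.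
have : `|y| <= `|y - df c| + (`|l - f t| + `|l - f (1 + t)|).
  have -> : y = (y - df c) + ((l - f t) - (l - f (1 + t))) by rewrite -E; ring.
  apply: (le_trans (ler_normD _ _)); rewrite (_ : y - df c + _ - _ = y - df c) ?lerD2l ?ler_normB//.
  by rewrite -E; ring.
by move: y0'; lra.
Qed.

End SolutionsOfFlows.

Section Main.
Variables (R : realType) (N : nat) (T : triangulated_surface N).
Variables (Phi : {set 'I_N} -> R) (alpha : R).
Hypothesis hPhi : is_weight T Phi.
Hypothesis halpha : alpha * (euler_char T)%:~R <= 0.
Local Notation rV := 'rV[R]_N.
Local Notation der t f d := (is_derive (t : R) (1 : R) (f : R -> R) (d : R)).
Implicit Types (u v w : rV) (i j k : 'I_N) (r : rV).
Local Notation chi2pi := (total_curvature R T).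
Local Notation K u i := (curvature_u T Phi u i).
Local Notation phi := (curv_gap T Phi alpha).
Local Notation cond := (cond T Phi alpha).

Lemma lnvE r i : lnv r 0 i = ln (r 0 i). Proof. by rewrite mxE. Qed.

Lemma cvg_expv (x : R -> rV) us : x t @[t --> +oo] --> us ->
  expv (x t) @[t --> +oo] --> expv us.
Proof.
move=> /cvg_rowP cx; apply/cvg_rowP => i.
rewrite (_ : (fun t => _) = (fun t => expR (x t 0 i))).
  by rewrite expvE; apply: continuous_cvg (cx i); exact: continuous_expR.
by apply/funext => t; rewrite expvE.
Qed.

Lemma cvg_lnv (x : R -> rV) rs : circle_packing_metric rs -> x t @[t --> +oo] --> rs ->
  lnv (x t) @[t --> +oo] --> lnv rs.
Proof.
move=> rs0 /cvg_rowP cx; apply/cvg_rowP => i.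
rewrite (_ : (fun t => _) = (fun t => ln (x t 0 i))).
  by rewrite lnvE; apply: continuous_cvg (cx i); exact: continuous_ln.
by apply/funext => t; rewrite lnvE.
Qed.

(* A flow [r' = Z(r)] with [Z(exp u)_i = X_i(u) exp(u_i)] is [u' = X(u)] in the
   coordinates [u = ln r]. *)
Lemma log_flow_solution (Z : rV -> rV) (X : 'I_N -> rV -> R) r0 (x : R -> rV) :
  (forall u i, Z (expv u) 0 i = X i u * expR (u 0 i)) ->
  circle_packing_metric r0 -> x 0 = lnv r0 ->
  (forall t, 0 <= t -> forall i, der t (fun s => x s 0 i) (X i (x t))) ->
  flow_solution (@circle_packing_metric R N) Z r0 (fun t => expv (x t)).
Proof.
move=> ZX r00 x0 dx; apply: flow_solution_der.
- by rewrite x0 expv_lnv.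
- by move=> t _; exact: expv_metric.
- move=> t t0 i; rewrite ZX (_ : (fun s => _) = (fun s => expR (x s 0 i))).
    by apply: is_derive_eq (der_expR (dx t t0 i)) _; rewrite mulrC.
  by apply/funext => s; rewrite expvE.
Qed.

Lemma log_flow_limit (Z : rV -> rV) (X : 'I_N -> rV -> R) r0 (x : R -> rV) rs :
  (forall u i, Z (expv u) 0 i = X i u * expR (u 0 i)) -> (forall i, loclip (X i)) ->
  flow_solution (@circle_packing_metric R N) Z r0 x ->
  circle_packing_metric rs -> x t @[t --> +oo] --> rs -> forall i, X i (lnv rs) = 0.
Proof.
move=> ZX lX sx rs0 cx i.
have [_ xD _] := sx.
have dx := der_flow_solution sx.
have lY : loclip (fun u => X i u * expR (u 0 i)).
  by apply: loclipM => //; exact: loclip_expcoord.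
have cY := loclip_continuous lY.
(* The absolute value makes the argument a metric at every t, so that the field can be rewritten by
   [funext]; nothing changes for t >= 0. *)
have cZ : Z (x (`|t|)) 0 i @[t --> +oo] --> X i (lnv rs) * expR (lnv rs 0 i).
  rewrite (_ : (fun t => _) = (fun t => X i (lnv (x `|t|)) * expR (lnv (x `|t|) 0 i))).
    apply: (@cvg_comp _ _ _ (fun t => lnv (x `|t|)) (fun u => X i u * expR (u 0 i)) _ (nbhs (lnv rs)));
      last exact: cY.
    apply: cvg_lnv => //; apply: cvg_trans cx; apply: near_eq_cvg.
    by near=> t; rewrite ger0_norm.
  by apply/funext => t; rewrite -ZX expv_lnv//; exact: xD.
have cZ' : Z (x t) 0 i @[t --> +oo] --> X i (lnv rs) * expR (lnv rs 0 i).
  apply: cvg_trans cZ; apply: near_eq_cvg.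
  by near=> t; rewrite ger0_norm.
have /cvg_rowP/(_ i) cxi := cx.
have /eqP := limit_derivative0 (fun t t0 => dx t t0 i) cxi cZ'.
by rewrite mulf_eq0 (gt_eqF (expR_gt0 _)) orbF => /eqP.
Unshelve. all: by end_near. Qed.

(** * The three fields in logarithmic coordinates *)

Definition ricci_log i u : R := - (expR (- (alpha * u 0 i)) * phi i u).
(** The deviation of the alpha-curvature at i from its average. *)
Definition alpha_gap i u : R := expR (- (alpha * u 0 i)) * phi i u.
Definition calabi_log i u : R := - (expR (- (alpha * u 0 i)) *
  \sum_j edge_weight T Phi i j u * (alpha_gap i u - alpha_gap j u)).
Definition modified_log i u : R := - \sum_j cond i j u * (phi i u - phi j u).

Lemma alpha_gapE i u :
  alpha_curvature T Phi alpha (expv u) 0 i = alpha_gap i u + chi2pi / mass alpha u.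
Proof.
rewrite mxE -/(K u i) expvE expR_powR /alpha_gap /curv_gap /share expRN; field.
by rewrite !gt_eqF ?expR_gt0 ?mass_gt0.
Qed.

Lemma alpha_curvature_avE u : alpha_curvature_av T alpha (expv u) = chi2pi / mass alpha u.
Proof. by rewrite /alpha_curvature_av alpha_norm_expv. Qed.

Lemma ricci_fieldE u i : ricci_field T Phi alpha (expv u) 0 i = ricci_log i u * expR (u 0 i).
Proof.
rewrite mxE alpha_curvature_avE alpha_gapE expvE /ricci_log /alpha_gap; ring.
Qed.

Lemma partial_curvature u i j : i != j ->
  partial (curvature_u T Phi ^~ i) u j = - edge_weight T Phi i j u.
Proof.
move=> ij; have := @der_derive R N (fun v => K v i) u (delta_mx 0 j) _
  (der_curvature hPhi u (delta_mx 0 j) i 0).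
rewrite /partial => ->; rewrite scale0r addr0.
rewrite (bigD1 j)//= big1 ?addr0; last first.
  by move=> l lj; rewrite !mxE eqxx/= (negbTE ij) (negbTE lj) subrr mulr0.
by rewrite !mxE !eqxx/= (negbTE ij) sub0r mulrN1.
Qed.

Lemma alpha_laplacianE u (f : rV) i : alpha_laplacian T Phi alpha (expv u) f 0 i =
  expR (- (alpha * u 0 i)) * \sum_j edge_weight T Phi i j u * (f 0 j - f 0 i).
Proof.
rewrite mxE expvE expR_powR expRN lnv_expv; congr (_ * _).
rewrite big_mkcond/=; apply: eq_bigr => j _; case: ifPn => [ij|nij]; last first.
  by rewrite edge_weight_nonadjacent ?mul0r.
rewrite partial_curvature ?opprK//; apply/eqP => E.
by have [k /is_face_uniq[]] := adjacent_face ij; rewrite E eqxx.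
Qed.

Lemma calabi_fieldE u i : calabi_field T Phi alpha (expv u) 0 i = calabi_log i u * expR (u 0 i).
Proof.
rewrite mxE alpha_laplacianE expvE /calabi_log.
have -> : \sum_j edge_weight T Phi i j u * (alpha_curvature T Phi alpha (expv u) 0 j
      - alpha_curvature T Phi alpha (expv u) 0 i)
   = - \sum_j edge_weight T Phi i j u * (alpha_gap i u - alpha_gap j u).
  by rewrite -sumrN; apply: eq_bigr => j _; rewrite !alpha_gapE; ring.
by rewrite mulrN.
Qed.

Lemma calabi_energyE u : calabi_energy T Phi alpha u = \sum_i phi i u ^+ 2.
Proof.
apply: eq_bigr => i _; rewrite alpha_curvature_avE expvE expR_powR.
by rewrite /curv_gap /share mulrAC -mulrA.
Qed.

(** Half the gradient of the sum of the phi_j^2 is the Laplacian of [cond] applied to phi: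
    [dirichlet_form], used in both directions, moves the Laplacian from the coordinate vector w to
    phi. *)
Lemma modified_calabi_fieldE u i : modified_calabi_field T Phi alpha u 0 i = modified_log i u.
Proof.
rewrite !mxE /modified_log; congr (- _).
pose w : rV := delta_mx 0 i.
have d : der 0 (fun s => calabi_energy T Phi alpha (u + s *: w))
    (\sum_j (\sum_l cond j l u * (w 0 j - w 0 l)) * (2 * phi j u)).
  rewrite (_ : (fun s => _) = (fun s => \sum_j phi j (u + s *: w) ^+ 2)).
    apply: der_sum => j _; have := @curv_gap_has_grad R N T Phi alpha hPhi j u w 0.
    rewrite grad_gapE => dj.
    apply: is_derive_eq (derM dj dj) _; rewrite scale0r addr0; ring.
  by apply/funext => s; rewrite calabi_energyE.
rewrite /partial (der_derive d) (dirichlet_form (Q := fun j l => cond j l u)); last first.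
  by move=> a b; exact: condC.
have -> : \sum_a \sum_b cond a b u * (w 0 a - w 0 b) * (2 * phi a u - 2 * phi b u)
  = 2 * \sum_a \sum_b cond a b u * (phi a u - phi b u) * (w 0 a - w 0 b).
  rewrite mulr_sumr; apply: eq_bigr => a _; rewrite mulr_sumr; apply: eq_bigr => b _.
  by ring.
rewrite mulKf ?pnatr_eq0//.
have <- := @dirichlet_form R N (fun j l => cond j l u) (fun a b => condC T Phi alpha a b u)
  (phi^~ u) (fun a => w 0 a).
rewrite (bigD1 i)//= [X in _ + X]big1 ?addr0.
  by rewrite !mxE !eqxx mulr1.
by move=> j ji; rewrite !mxE (negbTE ji) andbF mulr0.
Qed.

Lemma exp_alpha_loclip i : loclip (fun u => expR (- (alpha * u 0 i))).
Proof.
apply: loclip_expR; apply: loclipN.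
by apply: loclipM; [exact: loclip_cst|exact: loclip_coord].
Qed.

Lemma ricci_log_loclip i : loclip (ricci_log i).
Proof.
apply: loclipN; apply: loclipM; [exact: exp_alpha_loclip|exact: curv_gap_loclip].
Qed.

Lemma alpha_gap_loclip i : loclip (alpha_gap i).
Proof. by apply: loclipM; [exact: exp_alpha_loclip|exact: curv_gap_loclip]. Qed.

Lemma calabi_log_loclip i : loclip (calabi_log i).
Proof.
apply: loclipN; apply: loclipM; first exact: exp_alpha_loclip.
apply: loclip_sum => j _; apply: loclipM; first exact: edge_weight_loclip.
by apply: loclipB; exact: alpha_gap_loclip.
Qed.

Lemma modified_log_loclip i : loclip (modified_log i).
Proof.
apply: loclipN; apply: loclip_sum => j _; apply: loclipM; first exact: cond_loclip.
by apply: loclipB; exact: curv_gap_loclip.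
Qed.

Lemma ricci_dissipation u : \sum_i phi i u * ricci_log i u
  = - \sum_i expR (- (alpha * u 0 i)) * phi i u ^+ 2.
Proof. by rewrite -sumrN; apply: eq_bigr => i _; rewrite /ricci_log; ring. Qed.

Lemma ricci_dissipative u : \sum_i phi i u * ricci_log i u <= 0.
Proof.
rewrite ricci_dissipation oppr_le0 sumr_ge0// => i _.
by rewrite mulr_ge0 ?expR_ge0 ?sqr_ge0.
Qed.

Lemma ricci_dissipative_eq0 u : \sum_i phi i u * ricci_log i u = 0 ->
  forall i, phi i u = 0.
Proof.
rewrite ricci_dissipation => /eqP; rewrite oppr_eq0 psumr_eq0; last first.
  by move=> i _; rewrite mulr_ge0 ?expR_ge0 ?sqr_ge0.
move=> /allP H i; have := H i (mem_index_enum _).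
by rewrite /= mulf_eq0 gt_eqF ?expR_gt0//= expf_eq0/= => /eqP.
Qed.

Lemma expR_mulVK (a b : R) : expR a * (expR (- a) * b) = b.
Proof. by rewrite mulrA -expRD subrr expR0 mul1r. Qed.

Lemma ricci_conserved u : \sum_i expR (alpha * u 0 i) * ricci_log i u = 0.
Proof.
under eq_bigr do rewrite /ricci_log mulrN expR_mulVK.
by rewrite sumrN sum_curv_gap// oppr0.
Qed.

Lemma calabi_dissipation u : \sum_i phi i u * calabi_log i u
  = - \sum_i (\sum_j edge_weight T Phi i j u * (alpha_gap i u - alpha_gap j u)) * alpha_gap i u.
Proof.
rewrite -sumrN; apply: eq_bigr => i _; rewrite /calabi_log.
by set s := \sum_j _; rewrite /alpha_gap; ring.
Qed.

Lemma calabi_dissipative u : \sum_i phi i u * calabi_log i u <= 0.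
Proof.
rewrite calabi_dissipation oppr_le0.
apply: (dirichlet_ge0 (Q := fun i j => edge_weight T Phi i j u)) => i j.
  exact: edge_weightC.
exact: edge_weight_ge0.
Qed.

(** A vanishing Dirichlet form makes [alpha_gap] constant, so phi_j is a fixed multiple of e^(alpha
    u_j); as the phi_j sum to 0, the multiple is 0. *)
Lemma calabi_dissipative_eq0 u : \sum_i phi i u * calabi_log i u = 0 ->
  forall i, phi i u = 0.
Proof.
rewrite calabi_dissipation => /eqP; rewrite oppr_eq0 => /eqP.
move=> /(dirichlet_eq0 (Q := fun i j => edge_weight T Phi i j u)) H.
have {}H : forall i j, alpha_gap i u = alpha_gap j u.
  apply: (edge_weight_connected hPhi (u := u)) => i j; apply: H => a b.
    exact: edge_weightC.
  exact: edge_weight_ge0.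
move=> i.
have phiE j : phi j u = alpha_gap i u * expR (alpha * u 0 j).
  by rewrite (H i j) mulrC /alpha_gap expR_mulVK.
have := sum_curv_gap alpha hPhi u; rewrite (eq_bigr _ (fun j _ => phiE j)) -mulr_sumr -/(mass alpha u).
move=> /eqP; rewrite mulf_eq0 (gt_eqF (mass_gt0 T alpha u)) orbF => /eqP E.
by rewrite phiE E mul0r.
Qed.

Lemma calabi_conserved u : \sum_i expR (alpha * u 0 i) * calabi_log i u = 0.
Proof.
under eq_bigr do rewrite /calabi_log mulrN expR_mulVK.
rewrite sumrN (laplacian_sum0 (Q := fun i j => edge_weight T Phi i j u)) ?oppr0// => i j.
exact: edge_weightC.
Qed.

Lemma modified_dissipation u : \sum_i phi i u * modified_log i u
  = - \sum_i (\sum_j cond i j u * (phi i u - phi j u)) * phi i u.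
Proof. by rewrite -sumrN; apply: eq_bigr => i _; rewrite /modified_log; ring. Qed.

Lemma modified_dissipative u : \sum_i phi i u * modified_log i u <= 0.
Proof.
rewrite modified_dissipation oppr_le0.
by apply: (dirichlet_ge0 (Q := fun i j => cond i j u)) => i j; [exact: condC|exact: cond_ge0].
Qed.

Lemma modified_dissipative_eq0 u : \sum_i phi i u * modified_log i u = 0 ->
  forall i, phi i u = 0.
Proof.
rewrite modified_dissipation => /eqP; rewrite oppr_eq0 => /eqP.
move=> /(dirichlet_eq0 (Q := fun i j => cond i j u)) H i.
have {}H : forall i j, phi i u = phi j u.
  apply: (cond_connected hPhi halpha (u := u)) => a b; apply: H => c d.
    exact: condC.
  exact: cond_ge0.
have := sum_curv_gap alpha hPhi u; rewrite (eq_bigr (fun=> phi i u)); last by move=> j _; exact: H.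
rewrite sum_cst_ord => /eqP; rewrite mulf_eq0 pnatr_eq0.
by rewrite (gtn_eqF (vertices_gt0 T)) => /eqP.
Qed.

(** This flow preserves the product of the radii, which is the case beta = 0. *)
Lemma modified_conserved u : \sum_i expR (0 * u 0 i) * modified_log i u = 0.
Proof.
under eq_bigr do rewrite /modified_log mul0r expR0 mul1r.
rewrite sumrN (laplacian_sum0 (Q := fun i j => cond i j u)) ?oppr0// => i j.
exact: condC.
Qed.

Lemma constant_curvature_unique r r' :
  constant_alpha_curvature T Phi alpha r -> constant_alpha_curvature T Phi alpha r' ->
  exists2 c : R, 0 < c & r' = c *: r.
Proof.
move=> Hr Hr'; have [r0 _] := Hr; have [r'0 _] := Hr'.
move: Hr Hr'; rewrite -(expv_lnv r0) -(expv_lnv r'0).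
move=> /(constant_curvature_gap alpha hPhi) z /(constant_curvature_gap alpha hPhi) z'.
pose i0 : 'I_N := Ordinal (vertices_gt0 T).
have E := @zero_phi_unique R N phi (grad_gap T Phi alpha) (@curv_gap_has_grad R N T Phi alpha hPhi)
  (@grad_gap_ker R N T Phi alpha hPhi halpha) _ _ z z'.
exists (expR (lnv r' 0 i0 - lnv r 0 i0)); first exact: expR_gt0.
apply/rowP => i; rewrite [RHS]mxE !expvE -expRD; congr expR.
by rewrite -(E i i0) subrK.
Qed.

(** Condition (5) of the theorem for a given r. *)
Definition prescribable r := forall I : {set 'I_N}, I != finset.set0 -> I != [set: 'I_N]%SET ->
  link_bound T Phi I < 2 * pi * (euler_char T)%:~R
     * ((\sum_(i in I) r 0 i `^ alpha) / alpha_norm alpha r).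

Lemma prescribable_share u (I : {set 'I_N}) :
  (\sum_(i in I) expv u 0 i `^ alpha) / alpha_norm alpha (expv u)
  = \sum_(i in I) share alpha i u.
Proof.
rewrite alpha_norm_expv mulr_suml; apply: eq_bigr => i _.
by rewrite expvE expR_powR.
Qed.

Lemma constant_curvature_prescribable r : constant_alpha_curvature T Phi alpha r ->
  prescribable r.
Proof.
move=> Hr I I0 I1; have [r0 _] := Hr.
move: Hr; rewrite -(expv_lnv r0) => /(constant_curvature_gap alpha hPhi) z.
rewrite prescribable_share mulr_sumr -/(total_curvature R T).
have -> : \sum_(i in I) chi2pi * share alpha i (lnv r) = \sum_(i in I) curvature T Phi (expv (lnv r)) i.
  apply: eq_bigr => i _; have /eqP := z i; rewrite subr_eq0 => /eqP; exact: esym.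
by apply: Thurston_inequality => //; exact: expv_metric.
Qed.

Lemma prescribable_coercive r : circle_packing_metric r -> prescribable r ->
  exists c C : R, 0 < c /\ forall u i j,
    c * (u 0 i - u 0 j) - C <= \sum_k phi k u * u 0 k.
Proof.
move=> r0 Hr; apply: (curv_gap_coercive hPhi halpha (q := fun i => share alpha i (lnv r))).
- by move=> k; exact: share_ge0.
- exact: sum_share T alpha _.
- move=> a0 k; have m : mass alpha (lnv r) = N%:R.
    rewrite /mass (eq_bigr (fun=> 1)) ?sum_cst_ord ?mulr1// => l _.
    by rewrite a0 mul0r expR0.
  by rewrite /share m a0 mul0r expR0 div1r.
- move=> I I0 I1; have := Hr I I0 I1.
  by rewrite -{1 2}(expv_lnv r0) prescribable_share.
Qed.

Lemma converging_flow r (X : 'I_N -> rV -> R) (beta : R) :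
  circle_packing_metric r -> prescribable r ->
  (forall i, loclip (X i)) -> (forall u, \sum_i phi i u * X i u <= 0) ->
  (forall u, \sum_i phi i u * X i u = 0 -> forall i, phi i u = 0) ->
  (forall u, \sum_i expR (beta * u 0 i) * X i u = 0) ->
  forall u0, exists x : R -> rV, exists us : rV, [/\ x 0 = u0,
    forall t, 0 <= t -> forall i, der t (fun s => x s 0 i) (X i (x t)) &
    x t @[t --> +oo] --> us].
Proof.
move=> r0 Hr lX dX dX0 cX u0.
have [c [C [c0 co]]] := prescribable_coercive r0 Hr.
have [F gF] := curv_gap_potential alpha hPhi.
apply: (@flow_converges R N phi (grad_gap T Phi alpha) _ _ _ _ _ F gF
  (vertices_gt0 T) c C c0 co X beta lX dX dX0 cX u0).
- exact: curv_gap_has_grad.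
- by move=> i j; exact: grad_gap_loclip.
- exact: grad_gap_psd.
- exact: grad_gap_ker.
- by move=> u; exact: sum_curv_gap.
Qed.

Lemma equilibrium_constant_curvature (X : 'I_N -> rV -> R) r :
  (forall u, \sum_i phi i u * X i u = 0 -> forall i, phi i u = 0) ->
  circle_packing_metric r -> (forall i, X i (lnv r) = 0) ->
  constant_alpha_curvature T Phi alpha r.
Proof.
move=> H r0 X0; rewrite -(expv_lnv r0); apply/(constant_curvature_gap alpha hPhi).
by apply: H; rewrite big1// => i _; rewrite X0 mulr0.
Qed.

Lemma prescribable_admissible r : circle_packing_metric r -> prescribable r ->
  admissible T Phi (\row_i (chi2pi * share alpha i (lnv r))).
Proof.
move=> r0 Hr; split.
  under eq_bigr do rewrite mxE.
  by rewrite -mulr_sumr (sum_share T) mulr1.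
move=> I I0 I1; have := Hr I I0 I1.
rewrite -{1 2}(expv_lnv r0) prescribable_share mulr_sumr => /lt_le_trans; apply.
by rewrite le_eqVlt; apply/orP; left; apply/eqP; apply: eq_bigr => i _; rewrite mxE.
Qed.

Lemma admissible_prescribable (x : rV) : alpha != 0 ->
  (forall i, 0 < x 0 i / chi2pi) -> admissible T Phi x ->
  exists2 r, circle_packing_metric r & prescribable r.
Proof.
(* Dividing by [chi2pi], the sum of the x_i, gives u mass 1, so that [chi2pi * share] is x
   itself. *)
move=> a0 xpos [xs xI]; pose u : rV := \row_i (ln (x 0 i / chi2pi) / alpha).
have eu i : expR (alpha * u 0 i) = x 0 i / chi2pi.
  by rewrite mxE mulrCA mulfV// mulr1 lnK// posrE.
have c0 : chi2pi != 0.
  apply/eqP => c0; have := xpos (Ordinal (vertices_gt0 T)).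
  by rewrite c0 invr0 mulr0 ltxx.
have m : mass alpha u = 1.
  by rewrite /mass (eq_bigr _ (fun i _ => eu i)) -mulr_suml xs mulfV.
exists (expv u); first exact: expv_metric.
move=> I I0 I1; rewrite prescribable_share -/(total_curvature R T) mulr_sumr.
rewrite (eq_bigr (fun i => x 0 i)); first exact: xI.
by move=> i _; rewrite /share eu m divr1 mulrC divfK.
Qed.

Lemma admissible_const_prescribable :
  admissible T Phi (const_mx (2 * pi * (euler_char T)%:~R / N%:R)) ->
  prescribable (const_mx 1).
Proof.
move=> [_ H] I I0 I1; have := H I I0 I1.
have one i : (const_mx 1 : rV) 0 i `^ alpha = 1 by rewrite mxE powR1.
rewrite /alpha_norm !(eq_bigr _ (fun i _ => one i)) sum_cst_ord mulr1.
rewrite (eq_bigr (fun=> 2 * pi * (euler_char T)%:~R / N%:R * 1)); last first.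
  by move=> i _; rewrite mxE mulr1.
by rewrite -mulr_sumr mulrA mulrAC.
Qed.

Lemma prescribable_iff : (exists2 r, circle_packing_metric r & prescribable r) <->
  [/\ (0 < alpha -> euler_char T < 0 ->
       admissible T Phi `&` [set x : 'rV[R]_N | forall i, x 0 i < 0] !=set0),
      (alpha < 0 -> 0 < euler_char T ->
       admissible T Phi `&` [set x : 'rV[R]_N | forall i, 0 < x 0 i] !=set0) &
      (alpha * (euler_char T)%:~R = 0 ->
       admissible T Phi (const_mx (2 * pi * (euler_char T)%:~R / N%:R)))].
Proof.
have pi2 : 0 < 2 * pi :> R by rewrite mulr_gt0// pi_gt0.
have chiN : euler_char T < 0 -> chi2pi < 0.
  by move=> h; rewrite /total_curvature pmulr_rlt0// ltrz0.
have chiP : 0 < euler_char T -> 0 < chi2pi.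
  by move=> h; rewrite /total_curvature pmulr_rgt0// ltr0z.
split=> [[r r0 Hr]|[H1 H2 H3]].
  have adm := prescribable_admissible r0 Hr; split.
  - move=> _ /chiN c0; eexists; split; first exact: adm.
    by move=> i; rewrite /= mxE nmulr_rlt0// share_gt0.
  - move=> _ /chiP c0; eexists; split; first exact: adm.
    by move=> i; rewrite /= mxE mulr_gt0// share_gt0.
  - move=> /eqP; rewrite mulf_eq0 => h.
    rewrite (_ : const_mx _ = \row_i (chi2pi * share alpha i (lnv r)))//.
    apply/rowP => i; rewrite !mxE -/(total_curvature R T).
    have [/eqP a0|a0] := boolP (alpha == 0).
      have m : mass alpha (lnv r) = N%:R.
        rewrite /mass (eq_bigr (fun=> 1)) ?sum_cst_ord ?mulr1// => l _.
        by rewrite a0 mul0r expR0.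
      by rewrite /share m a0 mul0r expR0 div1r.
    rewrite (negbTE a0) /= in h; rewrite /total_curvature (eqP h).
    by rewrite !mulr0 !mul0r.
have [h|h] := eqVneq (alpha * (euler_char T)%:~R) 0.
  exists (const_mx 1); first by move=> i; rewrite mxE.
  exact: admissible_const_prescribable (H3 h).
have hneg : alpha * (euler_char T)%:~R < 0 by rewrite lt_def eq_sym h.
have [a0|a0|a0] := ltgtP alpha 0.
- have c0 : 0 < euler_char T by move: hneg; rewrite nmulr_rlt0// ltr0z.
  have [x [xA xp]] := H2 a0 c0.
  apply: (admissible_prescribable _ _ xA); first by rewrite lt_eqF.
  by move=> i; rewrite divr_gt0// chiP.
- have c0 : euler_char T < 0 by move: hneg; rewrite pmulr_rlt0// ltrz0.
  have [x [xA xp]] := H1 a0 c0.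
  apply: (admissible_prescribable _ _ xA); first by rewrite gt_eqF.
  by move=> i; rewrite nmulr_lgt0 ?invr_lt0 ?chiN//; exact: xp.
- by rewrite a0 mul0r eqxx in h.
Qed.

End Main.

Theorem theorem1p6 (R : realType) (N : nat) (T : triangulated_surface N)
    (Phi : {set 'I_N} -> R) (alpha : R)
    (hPhi : is_weight T Phi)
    (halpha : alpha * (euler_char T)%:~R <= 0) :
  (forall r r' : 'rV[R]_N,
     constant_alpha_curvature T Phi alpha r ->
     constant_alpha_curvature T Phi alpha r' ->
     exists2 c : R, 0 < c & r' = c *: r)
  /\
  (forall r0 : 'rV[R]_N, circle_packing_metric r0 ->
   [<-> (* 1 *)
        exists r : 'rV[R]_N, constant_alpha_curvature T Phi alpha r;
        (* 2 *)
        ricci_flow_converges T Phi alpha r0;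
        (* 3 *)
        calabi_flow_converges T Phi alpha r0;
        (* 4 *)
        modified_calabi_flow_converges T Phi alpha r0;
        (* 5 *)
        exists2 rs : 'rV[R]_N, circle_packing_metric rs &
          forall I : {set 'I_N}, I != finset.set0 -> I != [set: 'I_N]%SET ->
            2 * pi * (euler_char T)%:~R
              * ((\sum_(i in I) rs 0 i `^ alpha) / alpha_norm alpha rs)
            > link_bound T Phi I;
        (* 6 *)
        [/\ (0 < alpha -> euler_char T < 0 ->
             admissible T Phi `&` [set x : 'rV[R]_N | forall i, x 0 i < 0] !=set0),
            (alpha < 0 -> 0 < euler_char T ->
             admissible T Phi `&` [set x : 'rV[R]_N | forall i, 0 < x 0 i] !=set0) &
            (alpha * (euler_char T)%:~R = 0 ->
             admissible T Phi
               (const_mx (2 * pi * (euler_char T)%:~R / N%:R)))]]).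
Proof.
split=> [r r'|r0 r00]; first exact: constant_curvature_unique.
set P1 := exists r : 'rV[R]_N, _.
set P5 := exists2 rs : 'rV[R]_N, _ & _.
have P15 : P1 -> P5.
  by move=> [r Hr]; have [rp _] := Hr; exists r => //; exact: constant_curvature_prescribable Hr.
have P52 : P5 -> ricci_flow_converges T Phi alpha r0.
  move=> [rs rs0 Hrs].
  have [x [us [x0 dx cx]]] := converging_flow hPhi halpha rs0 Hrs
    (@ricci_log_loclip _ _ T Phi alpha hPhi) (ricci_dissipative T Phi alpha)
    (@ricci_dissipative_eq0 _ _ T Phi alpha) (ricci_conserved alpha hPhi) (lnv r0).
  exists (fun t => expv (x t)).
    by apply: (log_flow_solution _ r00 x0 dx) => u i; exact: ricci_fieldE.
  by exists (expv us); [exact: expv_metric|exact: cvg_expv].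
have P53 : P5 -> calabi_flow_converges T Phi alpha r0.
  move=> [rs rs0 Hrs].
  have [x [us [x0 dx cx]]] := converging_flow hPhi halpha rs0 Hrs
    (@calabi_log_loclip _ _ T Phi alpha hPhi) (calabi_dissipative alpha hPhi)
    (@calabi_dissipative_eq0 _ _ T Phi alpha hPhi) (calabi_conserved T Phi alpha) (lnv r0).
  exists (fun t => expv (x t)).
    by apply: (log_flow_solution _ r00 x0 dx) => u i; exact: calabi_fieldE.
  by exists (expv us); [exact: expv_metric|exact: cvg_expv].
have P54 : P5 -> modified_calabi_flow_converges T Phi alpha r0.
  move=> [rs rs0 Hrs].
  have [x [us [x0 dx cx]]] := converging_flow hPhi halpha rs0 Hrs
    (@modified_log_loclip _ _ T Phi alpha hPhi) (modified_dissipative hPhi halpha)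
    (@modified_dissipative_eq0 _ _ T Phi alpha hPhi halpha) (modified_conserved T Phi alpha) (lnv r0).
  exists x; last by exists (expv us); [exact: expv_metric|exact: cvg_expv].
  apply: flow_solution_der => // t t0 i.
  by rewrite modified_calabi_fieldE//; exact: dx.
have P21 : ricci_flow_converges T Phi alpha r0 -> P1.
  move=> [x sx [rs rs0 cx]]; exists rs.
  apply: (equilibrium_constant_curvature hPhi (@ricci_dissipative_eq0 _ _ T Phi alpha) rs0).
  apply: (log_flow_limit _ _ sx rs0 cx) => [u i|i]; first exact: ricci_fieldE.
  exact: ricci_log_loclip.
have P31 : calabi_flow_converges T Phi alpha r0 -> P1.
  move=> [x sx [rs rs0 cx]]; exists rs.
  apply: (equilibrium_constant_curvature hPhi (@calabi_dissipative_eq0 _ _ T Phi alpha hPhi) rs0).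
  apply: (log_flow_limit _ _ sx rs0 cx) => [u i|i]; first exact: calabi_fieldE.
  exact: calabi_log_loclip.
have P41 : modified_calabi_flow_converges T Phi alpha r0 -> P1.
  move=> [x sx [rs rs0 cx]]; exists rs.
  apply: (equilibrium_constant_curvature hPhi (@modified_dissipative_eq0 _ _ T Phi alpha hPhi halpha) rs0).
  have {}cx : x t @[t --> +oo] --> lnv rs.
    have := cvg_lnv rs0 cx; rewrite (_ : (fun t => _) = x)//.
    by apply/funext => t /=; rewrite lnv_expv.
  move=> i; rewrite -modified_calabi_fieldE//.
  have /cvg_rowP/(_ i) cxi := cx.
  apply: (limit_derivative0 (fun t t0 => der_flow_solution sx t0 i) cxi).
  have cX := loclip_continuous (@modified_log_loclip _ _ T Phi alpha hPhi i).
  rewrite (_ : (fun t => _) = (fun t => modified_log T Phi alpha i (x t))).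
    rewrite modified_calabi_fieldE//.
    by apply: (@cvg_comp _ _ _ x (modified_log T Phi alpha i) _ (nbhs (lnv rs))); last exact: cX.
  by apply/funext => t; rewrite modified_calabi_fieldE.
have P56 := prescribable_iff Phi halpha.
(* The arrows of the cycle are composed of those into and out of (1) and (5). *)
tfae; rewrite -/P1 -/P5.
- by move=> /P15/P52.
- by move=> /P21/P15/P53.
- by move=> /P31/P15/P54.
- by move=> /P41/P15.
- by move=> h; apply/P56.
- by move=> h; apply: P21; apply: P52; apply/P56.
Qed.
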